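(* Consider the setting of the context. Let $\delta,\alpha>0$, let $d,n,h$ be positive integers, and let $(\mathbf{M},\mathbf{N})\in L^2(\mathcal{H}_{\mathscr{S}^h\mathscr{P}\mathscr{A}},\gamma_n)\times L^2(\mathcal{H}_{\mathscr{T}^h\mathscr{Q}\mathscr{B}},\gamma_n)$ be degree-$d$ multilinear joint random operators such that: (i) for all $a,b,p,q$, $\mathbf{M}_{p,a}=\sum_{S\subseteq[n]}\mathbf{g}_SM_{S,p,a}$ and $\mathbf{N}_{q,b}=\sum_{S\subseteq[n]}\mathbf{h}_SN_{S,q,b}$, where $(\mathbf{g},\mathbf{h})\sim\mathcal{G}_\rho^{\otimes n}$, $\mathbf{g}_S=\prod_{i\in S}\mathbf{g}_i$, $\mathbf{h}_S=\prod_{i\in S}\mathbf{h}_i$, $M_{S,p,a}\in\mathcal{H}_{\mathscr{S}^h}$, $N_{S,q,b}\in\mathcal{H}_{\mathscr{T}^h}$; (ii) for all $a,b,p,q$, $\mathbb{E}[|||\mathbf{M}_{p,a}|||_2^2]\le1$ and $\mathbb{E}[|||\mathbf{N}_{q,b}|||_2^2]\le1$; (iii) $\mathbf{M}_0=\mathbb{1}_{\mathscr{S}^h\mathscr{P}}/\sqrt{\mathsf{a}}$ and $\mathbf{N}_0=\mathbb{1}_{\mathscr{T}^h\mathscr{Q}}/\sqrt{\mathsf{b}}$. Then there exists an explicitly computable $n_0=n_0(d,\delta,\mathsf{p},\mathsf{q})$ such that the following holds. For $G\in\mathbb{R}^{n\times n_0}$ with $i$-th row $G_i$ (regarded as a vector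 in $\mathbb{R}^{n_0}$), define joint random operators $(\mathbf{M}^G,\mathbf{N}^G)\in L^2(\mathcal{H}_{\mathscr{S}^h\mathscr{P}\mathscr{A}},\gamma_{n_0})\times L^2(\mathcal{H}_{\mathscr{T}^h\mathscr{Q}\mathscr{B}},\gamma_{n_0})$ with Gaussian inputs $(\mathbf{x},\mathbf{y})\sim\mathcal{G}_\rho^{\otimes n_0}$ by $$\mathbf{M}^G_{p,a}=\sum_{S\subseteq[n]}\prod_{i\in S}\frac{G_i^T\mathbf{x}}{\|\mathbf{x}\|_2}\cdot M_{S,p,a},\qquad \mathbf{N}^G_{q,b}=\sum_{S\subseteq[n]}\prod_{i\in S}\frac{G_i^T\mathbf{y}}{\|\mathbf{y}\|_2}\cdot N_{S,q,b}.$$ If $\mathbf{G}\sim\gamma_{n\times n_0}$ (independent standard Gaussian entries), then with probability at least $1-2(\mathsf{a}\mathsf{b}\mathsf{p}\mathsf{q}\mathsf{r})^2\delta-2\alpha$ over $\mathbf{G}$, all of the following hold: 1. For all $a,b,p,q$: $\mathbb{E}_{\mathbf{x}}[|||\mathbf{M}^{\mathbf{G}}_{p,a}|||_2^2]\le(1+\delta)\,\mathbb{E}[|||\mathbf{M}_{p,a}|||_2^2]$ and $\mathbb{E}_{\mathbf{y}}[|||\mathbf{N}^{\mathbf{G}}_{q,b}|||_2^2]\le(1+\delta)\,\mathbb{E}[|||\mathbf{N}_{q,b}|||_2^2]$. 2. $\mathbb{E}_{\mathbf{x}}[\mathrm{Tr}\,\zeta(\mathbf{M}^{\mathbf{G}})]\le\frac1\alpha\mathbb{E}_{\mathbf{g}}[\mathrm{Tr}\,\zeta(\mathbf{M})]$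 and $\mathbb{E}_{\mathbf{y}}[\mathrm{Tr}\,\zeta(\mathbf{N}^{\mathbf{G}})]\le\frac1\alpha\mathbb{E}_{\mathbf{h}}[\mathrm{Tr}\,\zeta(\mathbf{N})]$. 3. For all $a,b,r$: $$\Big|\mathbb{E}_{\mathbf{x},\mathbf{y}}\mathrm{Tr}\big[(\mathbf{M}^{\mathbf{G}}_a\otimes\mathbf{N}^{\mathbf{G}}_b\otimes\widetilde{\mathcal{R}_r})(\phi_{\mathsf{in}}\otimes\psi^{\otimes h})\big]-\mathbb{E}_{\mathbf{g},\mathbf{h}}\mathrm{Tr}\big[(\mathbf{M}_a\otimes\mathbf{N}_b\otimes\widetilde{\mathcal{R}_r})(\phi_{\mathsf{in}}\otimes\psi^{\otimes h})\big]\Big|\le\delta.$$ 4. $\mathbf{M}^{\mathbf{G}}_0=\mathbb{1}_{\mathscr{S}^h\mathscr{P}}/\sqrt{\mathsf{a}}$ and $\mathbf{N}^{\mathbf{G}}_0=\mathbb{1}_{\mathscr{T}^h\mathscr{Q}}/\sqrt{\mathsf{b}}$. In particular, one may take $n_0=O\big(\mathsf{p}^8\mathsf{q}^8d^{O(d)}/\delta^6\big)$.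
   Context: General notation. Quantum systems are finite-dimensional complex Hilbert spaces; juxtaposition means tensor product, $\mathscr{S}^h=\mathscr{S}^{\otimes h}$. $[N]_{\ge0}=\{0,\dots,N-1\}$. $\mathcal{H}_{\mathscr{X}}$ is the real space of Hermitian operators on $\mathscr{X}$; if $|\mathscr{X}|=m$, its inner product is $\langle P,Q\rangle=\frac1m\mathrm{Tr}PQ$ and $|||H|||_2=(\frac1m\mathrm{Tr}H^2)^{1/2}$. Orthonormal bases are over $\mathbb{R}$ with respect to this inner product. Setting. $\mathscr{P},\mathscr{Q},\mathscr{R},\mathscr{S},\mathscr{T},\mathscr{A},\mathscr{B}$ are quantum systems with dimensions $\mathsf{p},\mathsf{q},\mathsf{r},\mathsf{s},\mathsf{t},\mathsf{a},\mathsf{b}$; $\phi_{\mathsf{in}}$ is a state on $\mathscr{P}\mathscr{Q}\mathscr{R}$; $\psi=\psi^{\mathscr{S}\mathscr{T}}$ is a noisy maximally entangled state: its marginals are $\mathbb{1}_{\mathscr{S}}/\mathsf{s}$, $\mathbb{1}_{\mathscr{T}}/\mathsf{t}$ and its maximal correlation $\rho=\sup\{|\mathrm{Tr}((P\otimes Q)\psi)|:P\in\mathcal{H}_{\mathscr{S}},Q\in\mathcal{H}_{\mathscr{T}},\mathrm{Tr}P=\mathrm{Tr}Q=0,|||P|||_2=|||Q|||_2=1\}$ satisfies $\rho<1$. $\{\mathcal{A}_a\},\{\mathcal{B}_b\},\{\mathcal{P}_p\},\{\mathcal{Q}_q\},\{\mathcal{R}_r\}$ (indices starting at $0$) are orthonormal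 bases of $\mathcal{H}_{\mathscr{A}},\mathcal{H}_{\mathscr{B}},\mathcal{H}_{\mathscr{P}},\mathcal{H}_{\mathscr{Q}},\mathcal{H}_{\mathscr{R}}$; $\widetilde{\mathcal{A}_a}=\mathcal{A}_a/\sqrt{\mathsf{a}}$ and similarly for the others. ''For all $a$'' means for all $a\in[\mathsf{a}^2]_{\ge0}$, etc. For an operator (or random operator) $M$ on $\mathscr{S}^h\mathscr{P}\mathscr{A}$ define $M_a$ on $\mathscr{S}^h\mathscr{P}$ and $M_{p,a}$ on $\mathscr{S}^h$ by $M=\sum_aM_a\otimes\widetilde{\mathcal{A}_a}$, $M_a=\sum_pM_{p,a}\otimes\widetilde{\mathcal{P}_p}$. Similarly for $N$ on $\mathscr{T}^h\mathscr{Q}\mathscr{B}$: $N=\sum_bN_b\otimes\widetilde{\mathcal{B}_b}$, $N_b=\sum_qN_{q,b}\otimes\widetilde{\mathcal{Q}_q}$. In traces, tensor factors are matched by system. Random operators. $\gamma_n$ is the standard Gaussian measure on $\mathbb{R}^n$. $L^2(\mathcal{H}_{\mathscr{X}},\gamma_n)$ is the set of functions $\mathbb{R}^n\to\mathcal{H}_{\mathscr{X}}$ all of whose coefficients in a basis of $\mathcal{H}_{\mathscr{X}}$ are square integrable with respect to $\gamma_n$; evaluated at a Gaussian vector they are called random operators. A random operator is degree-$d$ multilinear if all its coefficients are multilinear polynomials of degree at most $d$ in the Gaussian variables. $\mathcal{G}_\rho$ is the law of a centered Gaussian pair with unit variances and covariance $\rho$; joint random operators are pairs whose Gaussian inputs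 are drawn from $\mathcal{G}_\rho^{\otimes n}$. $\zeta(x)=x^2$ if $x\le0$ and $\zeta(x)=0$ otherwise, applied to Hermitian operators by functional calculus. *)

(* Defs.v *)
From HB Require Import structures.
From mathcomp Require Import all_boot all_order all_algebra.
From mathcomp Require Import spectral sesquilinear.
From mathcomp Require Import all_classical all_reals all_analysis.
From mathcomp Require Import complex mxtens.

Set Implicit Arguments.
Unset Strict Implicit.
Unset Printing Implicit Defensive.

Import Order.TTheory GRing.Theory Num.Theory.
Import numFieldNormedType.Exports.

Local Open Scope classical_set_scope.
Local Open Scope ring_scope.
Local Open Scope complex_scope.
Local Open Scope sesquilinear_scope.

Notation "A *t B" := (tensmx A B)
  (at level 40, left associativity, format "A  *t  B") : ring_scope.

(* An operator on a system of dimension [m] is a matrix ['M[R[i]]_m]; the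
   Hermitian ones are those in [hermsymmx]. *)

Section Operators.
Variable R : realType.
Local Notation C := R[i].

Definition hdot m (P Q : 'M[C]_m) : C := (m%:R)^-1 * \tr (P *m Q).

(* [hdot H H] is real for Hermitian [H]. *)
Definition hnorm2 m (H : 'M[C]_m) : R := Num.sqrt (complex.Re (hdot H H)).

Definition orthonormal_basis m (B : 'I_(m ^ 2)%N -> 'M[C]_m) : Prop :=
  [/\ forall i, B i \is hermsymmx,
      forall i j, hdot (B i) (B j) = (i == j)%:R
    & forall H : 'M[C]_m, H \is hermsymmx ->
        exists c : 'I_(m ^ 2)%N -> R, H = \sum_i (c i)%:C *: B i].

Definition tilde m (H : 'M[C]_m) : 'M[C]_m := ((Num.sqrt m%:R)^-1)%:C *: H.

Definition quantum_state m (D : 'M[C]_m) : Prop :=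
  [/\ D \is hermsymmx,
      forall v : 'cV[C]_m, 0 <= (v ^t* *m D *m v) 0 0
    & \tr D = 1].

Definition marginal1 m n (D : 'M[C]_(m * n)) : 'M[C]_m :=
  \matrix_(i, j) \sum_k D (mxtens_index (i, k)) (mxtens_index (j, k)).

Definition marginal2 m n (D : 'M[C]_(m * n)) : 'M[C]_n :=
  \matrix_(i, j) \sum_k D (mxtens_index (k, i)) (mxtens_index (k, j)).

(* If [m <= 1] or [n <= 1] the set is empty, and [sup set0 = 0]. *)
Definition max_correlation m n (psi : 'M[C]_(m * n)) : R :=
  sup [set x : R | exists P : 'M[C]_m, exists Q : 'M[C]_n,
    [/\ P \is hermsymmx /\ Q \is hermsymmx,
        \tr P = 0 /\ \tr Q = 0,
        hnorm2 P = 1 /\ hnorm2 Q = 1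
      & x = complex.Re `| \tr ((P *t Q) *m psi) |]].

Definition noisy_max_entangled m n (psi : 'M[C]_(m * n)) (rho : R) : Prop :=
  [/\ quantum_state psi,
      marginal1 psi = (m%:R^-1)%:M,
      marginal2 psi = (n%:R^-1)%:M,
      rho = max_correlation psi
    & rho < 1].

(* The computational basis of the [h]-th tensor power of a system of
   dimension [s] is labelled by the functions ['I_h -> 'I_s]. *)

Definition pow_dim (s h : nat) : nat := #|{ffun 'I_h -> 'I_s}|.

Definition pow_label s h (i : 'I_(pow_dim s h)) : {ffun 'I_h -> 'I_s} :=
  enum_val i.

(* The [h]-th tensor power of [psi], with the systems reordered from
   (ST)...(ST) to (S...S)(T...T). *)
Definition state_pow s t h (psi : 'M[C]_(s * t)) :
    'M[C]_(pow_dim s h * pow_dim t h) :=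
  \matrix_(i, j)
    let: (iS, iT) := mxtens_unindex i in
    let: (jS, jT) := mxtens_unindex j in
    \prod_(k < h) psi (mxtens_index (pow_label iS k, pow_label iT k))
                      (mxtens_index (pow_label jS k, pow_label jT k)).

(* [phi (x) chi] for [phi] on PQR and [chi] on ST, with the systems reordered
   to (SP)(TQ)R. *)
Definition joint_state s t p q r
    (phi : 'M[C]_(p * q * r)) (chi : 'M[C]_(s * t)) :
    'M[C]_((s * p) * (t * q) * r) :=
  \matrix_(i, j)
    let: (iSPTQ, iR) := mxtens_unindex i in
    let: (iSP, iTQ) := mxtens_unindex iSPTQ in
    let: (iS, iP) := mxtens_unindex iSP in
    let: (iT, iQ) := mxtens_unindex iTQ in
    let: (jSPTQ, jR) := mxtens_unindex j in
    let: (jSP, jTQ) := mxtens_unindex jSPTQ in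
    let: (jS, jP) := mxtens_unindex jSP in
    let: (jT, jQ) := mxtens_unindex jTQ in
    phi (mxtens_index (mxtens_index (iP, iQ), iR))
        (mxtens_index (mxtens_index (jP, jQ), jR))
    * chi (mxtens_index (iS, iT)) (mxtens_index (jS, jT)).

(* Functional calculus on Hermitian matrices, through the spectral
   decomposition [A = invmx P *m diag_mx D *m P], [P] unitary, [D] real. *)
Definition func_calc (f : R -> R) m (A : 'M[C]_m) : 'M[C]_m :=
  invmx (spectralmx A)
    *m diag_mx (map_mx (fun z : C => (f (complex.Re z))%:C) (spectral_diag A))
    *m spectralmx A.

Definition zeta (x : R) : R := if x <= 0 then x ^+ 2 else 0.

(* [func_calc zeta A] is Hermitian, so its trace is real. *)
Definition tr_zeta m (A : 'M[C]_m) : R := complex.Re (\tr (func_calc zeta A)).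

End Operators.

Section ProductPower.
Context d (T : measurableType d) (R : realType).

Definition cons_pair n (x : T * n.-tuple T) : n.+1.-tuple T :=
  [the n.+1.-tuple T of x.1 :: x.2].

Lemma measurable_cons_pair n : measurable_fun setT (@cons_pair n).
Proof. by apply: measurable_cons. Qed.

HB.instance Definition _ n :=
  @isMeasurableFun.Build _ _ _ _ (@cons_pair n) (@measurable_cons_pair n).

Fixpoint prob_pow (P : probability T R) (n : nat) :
    probability (n.-tuple T) R :=
  if n is n'.+1 then distribution (P \x prob_pow P n')%E (@cons_pair n')
  else \d_[tuple].

End ProductPower.

Section Gaussian.
Variable R : realType.

Definition gauss_prob : probability (measurableTypeR R) R := normal_prob 0 1.

Definition gvec n := n.-tuple (measurableTypeR R).
Definition gmat n n0 := n.-tuple (n0.-tuple (measurableTypeR R)).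
Definition gpairs n := n.-tuple (measurableTypeR R * measurableTypeR R)%type.

Definition gaussn n : probability (n.-tuple (measurableTypeR R)) R :=
  prob_pow gauss_prob n.

(* Rows are independent, each with law [gaussn n0]. *)
Definition gaussmx n n0 :
    probability (n.-tuple (n0.-tuple (measurableTypeR R))) R :=
  prob_pow (gaussn n0) n.

Definition correlate (rho : R) (uv : measurableTypeR R * measurableTypeR R) :
    measurableTypeR R * measurableTypeR R :=
  (uv.1, rho * (uv.1 : R) + Num.sqrt (1 - rho ^+ 2) * (uv.2 : R)).

Lemma measurable_correlate rho : measurable_fun setT (correlate rho).
Proof.
apply/measurable_fun_pairP; split => /=; first exact: measurable_fst.
apply: measurable_realfun.measurable_funD => /=.
  by apply: measurable_realfun.measurable_funM => //; exact: measurable_fst.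
by apply: measurable_realfun.measurable_funM => //; exact: measurable_snd.
Qed.

HB.instance Definition _ rho :=
  @isMeasurableFun.Build _ _ _ _ (correlate rho) (@measurable_correlate rho).

(* For [u], [v] independent standard Gaussians and [`|rho| <= 1], the pair
   [(u, rho u + sqrt (1 - rho^2) v)] is Gaussian and centered, with unit
   variances and covariance [rho]. *)
Definition corr_gauss (rho : R) :
    probability (measurableTypeR R * measurableTypeR R)%type R :=
  distribution (gauss_prob \x gauss_prob)%E (correlate rho).

Definition corr_gaussn (rho : R) n :
    probability (n.-tuple (measurableTypeR R * measurableTypeR R)%type) R :=
  prob_pow (corr_gauss rho) n.

Definition fsts n (z : gpairs n) : gvec n := map_tuple fst z.
Definition snds n (z : gpairs n) : gvec n := map_tuple snd z.

Definition gcoord n (g : gvec n) (i : 'I_n) : R := tnth g i.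

Definition sketch n n0 (G : gmat n n0) (x : gvec n0) (i : 'I_n) : R :=
  (\sum_j gcoord (tnth G i) j * gcoord x j)
  / Num.sqrt (\sum_j gcoord x j ^+ 2).

(* [A] itself need not be known to be measurable. *)
Definition prob_at_least d (T : measurableType d) (P : probability T R)
    (A : set T) (c : R) : Prop :=
  exists E : set T, [/\ measurable E, E `<=` A & (c%:E <= P E)%E].

Definition expectC d (T : measurableType d) (P : probability T R)
    (f : T -> R[i]) : R[i] :=
  (\int[P]_(x in setT) complex.Re (f x))%R
  +i* (\int[P]_(x in setT) complex.Im (f x))%R.

End Gaussian.

Section RandomOperators.
Variable R : realType.
Local Notation C := R[i].

(* The coefficient of [M g] on [B i], for an orthonormal basis [B]. *)
Definition coeff m (B : 'I_(m ^ 2)%N -> 'M[C]_m) n (M : gvec R n -> 'M[C]_m)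
    (i : 'I_(m ^ 2)%N) (g : gvec R n) : R :=
  complex.Re (hdot (B i) (M g)).

Definition L2_random_operator m n (M : gvec R n -> 'M[C]_m) : Prop :=
  (forall g, M g \is hermsymmx) /\
  forall B : 'I_(m ^ 2)%N -> 'M[C]_m, orthonormal_basis B ->
    forall i, coeff B M i \in Lfun (gaussn R n) 2%:E.

Definition multilinear_poly n (d : nat) (f : gvec R n -> R) : Prop :=
  exists c : {set 'I_n} -> R,
    (forall S : {set 'I_n}, (d < #|S|)%N -> c S = 0) /\
    forall g, f g = \sum_(S : {set 'I_n}) c S * \prod_(i in S) gcoord g i.

(* The coefficients in one basis are real-linear combinations of those in
   another, so the choice of the basis is immaterial. *)
Definition multilinear_operator m n (d : nat) (M : gvec R n -> 'M[C]_m) : Prop :=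
  exists2 B : 'I_(m ^ 2)%N -> 'M[C]_m, orthonormal_basis B &
    forall i, multilinear_poly d (coeff B M i).

Section Assemble.
Variables (n s p a : nat).
Variables (bP : 'I_(p ^ 2)%N -> 'M[C]_p) (bA : 'I_(a ^ 2)%N -> 'M[C]_a).
Variable MS : {set 'I_n} -> 'I_(p ^ 2)%N -> 'I_(a ^ 2)%N -> 'M[C]_s.

(* The three definitions below give M_{p,a}, M_a and M when the variables
   take the values [w]: [w = gcoord g] for M itself, and [w = sketch G x]
   for the operator with reduced input dimension. *)
Definition op_pa (w : 'I_n -> R) (jp : 'I_(p ^ 2)%N) (ja : 'I_(a ^ 2)%N) :
    'M[C]_s :=
  \sum_(S : {set 'I_n}) (\prod_(i in S) w i)%:C *: MS S jp ja.

Definition op_a (w : 'I_n -> R) (ja : 'I_(a ^ 2)%N) : 'M[C]_(s * p) :=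
  \sum_jp op_pa w jp ja *t tilde (bP jp).

Definition op (w : 'I_n -> R) : 'M[C]_(s * p * a) :=
  \sum_ja op_a w ja *t tilde (bA ja).

End Assemble.

(* [K] and [k] are the absolute constants hidden in
   [O(p^8 q^8 d^O(d) / delta^6)]. *)
Definition sketch_dim (K k d : nat) (delta : R) (p q : nat) : nat :=
  `|Num.ceil (K%:R * p%:R ^+ 8 * q%:R ^+ 8 * d%:R ^+ (k * d)
              / delta ^+ 6)|%N.

End RandomOperators.

(* Main.v *)
Require Import Defs.
Set Warnings "-notation-overridden,-ambiguous-paths,-notation-incompatible-prefix".
From HB Require Import structures.
From mathcomp Require Import all_boot all_order all_algebra.
From mathcomp Require Import spectral sesquilinear.
From mathcomp Require Import all_classical all_reals all_analysis.
From mathcomp Require Import complex mxtens.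
From mathcomp Require Import measurable_realfun ring lra.

Set Implicit Arguments.
Unset Strict Implicit.
Unset Printing Implicit Defensive.

Import Order.TTheory GRing.Theory Num.Theory.
Import numFieldNormedType.Exports.

Local Open Scope classical_set_scope.
Local Open Scope ring_scope.

(* Fix [G], and let [u = x / |x|], [v = y / |y|]. Every norm or correlation of the
   sketched operators is a mean [F(G) = E_{x,y} B(G u, G v)] for a form [B] that is
   multilinear in the rows of [G]. For fixed [u] and [v] the pairs
   [(G_i u, G_i v)] are independent standard Gaussian pairs of covariance
   [<u, v>], so [E_G F = sum_S B(S, S) E <u, v>^|S|], and [<u, v>] is within
   [O(1 / sqrt n0)] of [rho] on average.

   The variance of [F] is the mean, over two independent copies [(u, v)] and
   [(u', v')], of the covariance over [G] of [B(G u, G v)] and [B(G u', G v')].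
   For a single row this covariance is at most [s] times the sum of the two
   variances, where [s] measures the overlap of [span(u, v)] and [span(u', v')]
   and has mean [O(1 / sqrt n0)]; such an inequality tensorizes over the rows.
   Bonami's inequality bounds the variances by [9^d], and Chebyshev's inequality
   gives items 1 and 3.

   For fixed [x <> 0] the vector [G x / |x|] is a standard Gaussian one, so the
   mean over [G] of [E_x Tr zeta(M^G)] is [E_g Tr zeta(M)] and item 2 is Markov's
   inequality. Item 4 holds for every value of the variables. *)

(** * Expectations of functions of polynomial growth *)

(** The dimension may not depend on [n], [h], [s] or [t]. The form [B] therefore enters the
    estimates only through a Cauchy-Schwarz bound by two vector-valued polynomials, whose
    coefficient norms the normalization hypotheses control; summing over the basis elements of P and
    Q costs the factors p^4 and q^4.

    The obstacle is the normalization by the norms of x and y: the sketched form is not a polynomial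
    in x and y. Only the dependence on G is expanded, for fixed directions. The directions then
    enter through inner products, and their denominators are removed by bounds that are polynomial
    in the inner products of x, y, x', y'. These bounds trade a deviation for its square by AM-GM
    with weight sqrt(n0), which is why the rate is 1 / sqrt(n0).

    The row inequality has the sum of two variances on its right, not their geometric mean, because
    it is then linear in all covariances and can be integrated over a row.

    Chebyshev's inequality asks for 9^d p^4 q^4 / (sqrt(n0) delta^2) to be at most a multiple of
    delta, whence p^8 q^8 d^O(d) / delta^6. *)

Section Tame.
Context d (T : measurableType d) (R : realType).
Implicit Types (w f g : T -> R) (P : probability T R).

(* [w] plays the role of a function with all moments; functions of polynomial
   growth in [w] form an algebra of integrable functions. *)
Definition tame w f : Prop :=
  measurable_fun setT f /\
  exists C k, 0 <= C /\ forall x, `|f x| <= C * w x ^+ k.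

(** The bound [1 <= w] makes powers of [w] increase with the exponent, so that two growth bounds can
    be merged under the larger one. *)
Definition weight P w : Prop :=
  [/\ measurable_fun setT w, forall x, 1 <= w x
    & forall k, P.-integrable setT (EFin \o (fun x => w x ^+ k))].

Definition mean P f : R := (\int[P]_(x in setT) f x)%R.

Section Closure.
Variable w : T -> R.
Hypothesis w1 : forall x, 1 <= w x.

Lemma weightX_le k l x : (k <= l)%N -> w x ^+ k <= w x ^+ l.
Proof. by move=> kl; rewrite ler_weXn2l. Qed.

Lemma weightX_ge0 k x : 0 <= w x ^+ k.
Proof. by rewrite exprn_ge0// (le_trans _ (w1 x)). Qed.

Lemma tame_cst c : tame w (fun=> c).
Proof.
split; first exact: measurable_cst.
by exists `|c|, 0%N; split=> // x; rewrite expr0 mulr1.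
Qed.

Lemma tame_bound f g : measurable_fun setT f -> tame w g ->
  (forall x, `|f x| <= `|g x|) -> tame w f.
Proof.
move=> mf [mg [C [k [C0 gC]]]] fg; split=> //; exists C, k; split=> // x.
exact: le_trans (fg x) (gC x).
Qed.

Lemma tameD f g : tame w f -> tame w g -> tame w (fun x => f x + g x).
Proof.
move=> [mf [C [k [C0 fC]]]] [mg [D [l [D0 gD]]]]; split.
  exact: measurable_funD.
exists (C + D), (maxn k l); split=> [|x]; first exact: addr_ge0.
rewrite (le_trans (ler_normD _ _))// mulrDl lerD//.
  by rewrite (le_trans (fC x))// ler_wpM2l// weightX_le// leq_maxl.
by rewrite (le_trans (gD x))// ler_wpM2l// weightX_le// leq_maxr.
Qed.

Lemma tameM f g : tame w f -> tame w g -> tame w (fun x => f x * g x).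
Proof.
move=> [mf [C [k [C0 fC]]]] [mg [D [l [D0 gD]]]]; split.
  exact: measurable_funM.
exists (C * D), (k + l)%N; split=> [|x]; first exact: mulr_ge0.
by rewrite normrM exprD mulrACA ler_pM.
Qed.

Lemma tameN f : tame w f -> tame w (fun x => - f x).
Proof.
move=> tf; rewrite (_ : (fun x => _) = (fun x => (-1) * f x)).
  by apply: tameM => //; exact: tame_cst.
by apply/funext => x; rewrite mulN1r.
Qed.

Lemma tameB f g : tame w f -> tame w g -> tame w (fun x => f x - g x).
Proof. by move=> tf tg; apply: tameD => //; exact: tameN. Qed.

Lemma tameZ c f : tame w f -> tame w (fun x => c * f x).
Proof. by move=> tf; apply: tameM => //; exact: tame_cst. Qed.

Lemma tameX f n : tame w f -> tame w (fun x => f x ^+ n).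
Proof.
move=> tf; elim: n => [|n IH].
  by under eq_fun do rewrite expr0; exact: tame_cst.
by under eq_fun do rewrite exprS; exact: tameM.
Qed.

Lemma tame_norm f : tame w f -> tame w (fun x => `|f x|).
Proof.
move=> [mf [C [k [C0 fC]]]]; split; first exact: measurableT_comp.
by exists C, k; split=> // x; rewrite normr_id.
Qed.

Lemma tame_sum I (r : seq I) (Q : pred I) (F : I -> T -> R) :
  (forall i, Q i -> tame w (F i)) -> tame w (fun x => \sum_(i <- r | Q i) F i x).
Proof.
move=> tF; elim: r => [|i r IH].
  by under eq_fun do rewrite big_nil; exact: tame_cst.
case: (boolP (Q i)) => Qi; last first.
  by under eq_fun do rewrite big_cons (negbTE Qi); exact: IH.
by under eq_fun do rewrite big_cons Qi; apply: tameD => //; exact: tF.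
Qed.

Lemma tame_prod I (r : seq I) (Q : pred I) (F : I -> T -> R) :
  (forall i, Q i -> tame w (F i)) -> tame w (fun x => \prod_(i <- r | Q i) F i x).
Proof.
move=> tF; elim: r => [|i r IH].
  by under eq_fun do rewrite big_nil; exact: tame_cst.
case: (boolP (Q i)) => Qi; last first.
  by under eq_fun do rewrite big_cons (negbTE Qi); exact: IH.
by under eq_fun do rewrite big_cons Qi; apply: tameM => //; exact: tF.
Qed.

End Closure.

Lemma weight_ge1 P w : weight P w -> forall x, 1 <= w x.
Proof. by case. Qed.

Section Mean.
Variables (P : probability T R) (w : T -> R).
Hypothesis wP : weight P w.
Let w1 : forall x, 1 <= w x. Proof. by case: wP. Qed.

Lemma tame_integrable f : tame w f -> P.-integrable setT (EFin \o f).
Proof.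
move=> [mf [C [k [C0 fC]]]]; case: wP => _ _ /(_ k) iw.
apply: (@le_integrable _ _ _ P _ _ _ (fun x => (C * w x ^+ k)%:E)) => //.
- exact/measurable_EFinP.
- move=> x _ /=; rewrite lee_fin (le_trans (fC x))//.
  by rewrite ger0_norm// mulr_ge0// weightX_ge0.
- have := integrableZl measurableT C iw.
  by apply: eq_integrable => // x _; rewrite /= EFinM.
Qed.

Lemma tame_meanE f : tame w f -> (\int[P]_x (f x)%:E)%E = (mean P f)%:E.
Proof.
move=> tf; rewrite /mean /Rintegral fineK//.
by apply: integrable_fin_num => //; exact: tame_integrable.
Qed.

Lemma mean_cst c : mean P (fun=> c) = c.
Proof.
rewrite /mean Rintegral_cst// -[RHS]mulr1; congr (_ * _).
by rewrite -[RHS]/(fine 1%E); congr fine; exact: probability_setT.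
Qed.

Lemma meanD f g : tame w f -> tame w g ->
  mean P (fun x => f x + g x) = mean P f + mean P g.
Proof. by move=> tf tg; rewrite /mean RintegralD//; exact: tame_integrable. Qed.

Lemma meanB f g : tame w f -> tame w g ->
  mean P (fun x => f x - g x) = mean P f - mean P g.
Proof. by move=> tf tg; rewrite /mean RintegralB//; exact: tame_integrable. Qed.

Lemma meanZ c f : tame w f -> mean P (fun x => c * f x) = c * mean P f.
Proof. by move=> tf; rewrite /mean RintegralZl//; exact: tame_integrable. Qed.

Lemma meanZr c f : tame w f -> mean P (fun x => f x * c) = mean P f * c.
Proof. by move=> tf; rewrite /mean RintegralZr//; exact: tame_integrable. Qed.

Lemma mean_sum I (r : seq I) (Q : pred I) (F : I -> T -> R) :
  (forall i, Q i -> tame w (F i)) ->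
  mean P (fun x => \sum_(i <- r | Q i) F i x) = \sum_(i <- r | Q i) mean P (F i).
Proof.
move=> tF; elim: r => [|i r IH].
  by under eq_fun do rewrite big_nil; rewrite big_nil mean_cst.
rewrite big_cons; case: ifPn => Qi; last first.
  by under eq_fun do rewrite big_cons (negbTE Qi).
under eq_fun do rewrite big_cons Qi.
rewrite meanD ?IH//; first exact: tF.
exact: tame_sum.
Qed.

Lemma mean_le f g : tame w f -> tame w g -> (forall x, f x <= g x) ->
  mean P f <= mean P g.
Proof.
by move=> tf tg fg; apply: le_Rintegral => //; exact: tame_integrable.
Qed.

Lemma mean_ge0 f : (forall x, 0 <= f x) -> 0 <= mean P f.
Proof. by move=> f0; apply: Rintegral_ge0. Qed.

Lemma mean_norm f : tame w f -> `|mean P f| <= mean P (fun x => `|f x|).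
Proof. by move=> tf; apply: le_normr_Rintegral => //; exact: tame_integrable. Qed.

(** The variance of [f] is nonnegative. *)
Lemma tame_mean_sqr_le f : tame w f -> mean P f ^+ 2 <= mean P (fun x => f x ^+ 2).
Proof.
move=> tf; set m := mean P f.
have : 0 <= mean P (fun x => (f x - m) ^+ 2) by apply: mean_ge0 => x; exact: sqr_ge0.
have tm : tame w (fun=> m) by exact: tame_cst.
have t2 : tame w (fun x => f x ^+ 2) by exact: tameX.
have tmf : tame w (fun x => 2 * m * f x) by exact: tameZ.
have -> : mean P (fun x => (f x - m) ^+ 2) = mean P (fun x => f x ^+ 2) - m ^+ 2.
  have -> : (fun x => (f x - m) ^+ 2) =
     (fun x => f x ^+ 2 - 2 * m * f x + m ^+ 2).
    by apply/funext => x; ring.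
  rewrite meanD ?meanB ?meanZ ?mean_cst -/m //; try ring.
  - exact: tameB.
  - exact: tame_cst.
by rewrite subr_ge0.
Qed.

(** The quadratic form [key] in (s, t) is nonnegative, so its discriminant has a sign. *)
Lemma mean_cauchy_schwarz f g : tame w f -> tame w g ->
  mean P (fun x => f x * g x) ^+ 2 <=
  mean P (fun x => f x ^+ 2) * mean P (fun x => g x ^+ 2).
Proof.
move=> tf tg; set a := mean P (fun x => f x ^+ 2).
set b := mean P (fun x => g x ^+ 2); set c := mean P _.
have a0 : 0 <= a by apply: mean_ge0 => x; exact: sqr_ge0.
have b0 : 0 <= b by apply: mean_ge0 => x; exact: sqr_ge0.
have tff : tame w (fun x => f x ^+ 2) by exact: tameX.
have tgg : tame w (fun x => g x ^+ 2) by exact: tameX.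
have tfg : tame w (fun x => f x * g x) by exact: tameM.
have key s t : 0 <= s ^+ 2 * a + 2 * s * t * c + t ^+ 2 * b.
  have <- : mean P (fun x => (s * f x + t * g x) ^+ 2) =
            s ^+ 2 * a + 2 * s * t * c + t ^+ 2 * b.
    have -> : (fun x => (s * f x + t * g x) ^+ 2) =
      (fun x => s ^+ 2 * f x ^+ 2 + 2 * s * t * (f x * g x) + t ^+ 2 * g x ^+ 2).
      by apply/funext => x; ring.
    rewrite meanD ?meanD ?meanZ//; try exact: tameZ.
    by apply: tameD => //; exact: tameZ.
  by apply: mean_ge0 => x; exact: sqr_ge0.
have [b00|bN0] := eqVneq b 0.
  have [->|c0] := eqVneq c 0; first by rewrite b00; nra.
  (* With b = 0 the form is affine in t; at this t it equals a - 2 (a + 1) < 0. *)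
  have := key 1 (- (a + 1) / c); rewrite b00 mulr0 addr0 expr1n mul1r mulr1.
  rewrite -!mulrA mulVf// mulr1; lra.
have bp : 0 < b by rewrite lt_neqAle eq_sym bN0.
(* At (b, -c) the form equals b (a b - c^2). *)
have := key b (- c) => H.
have : 0 <= b * (a * b - c ^+ 2) by nra.
by rewrite pmulr_rge0// subr_ge0.
Qed.

End Mean.
End Tame.
Arguments tame {d T R} w f.
Arguments weight {d T R} P w.
Arguments mean {d T R} P f.

(** * Product measures, image measures and finite powers *)

Section Products.
Context d1 d2 (T1 : measurableType d1) (T2 : measurableType d2) (R : realType).
Variables (P1 : probability T1 R) (P2 : probability T2 R).
Variables (w1 : T1 -> R) (w2 : T2 -> R).
Hypotheses (wP1 : weight P1 w1) (wP2 : weight P2 w2).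

Let w1_ge1 x : 1 <= w1 x. Proof. by case: wP1. Qed.
Let w2_ge1 x : 1 <= w2 x. Proof. by case: wP2. Qed.

(** A product and not a sum: the powers factor, so their means are products of means, and the
    product still dominates each factor because both are at least 1. *)
Definition wprod (z : T1 * T2) : R := w1 z.1 * w2 z.2.

Lemma wprod_ge1 z : 1 <= wprod z.
Proof. by rewrite /wprod -[1]mulr1 ler_pM. Qed.

Lemma measurable_wprod : measurable_fun setT wprod.
Proof.
case: wP1 => m1 _ _; case: wP2 => m2 _ _.
by apply: measurable_funM; [exact: (measurableT_comp m1)|exact: (measurableT_comp m2)].
Qed.

Lemma weight_prod : weight (P1 \x P2)%E wprod.
Proof.
split; [exact: measurable_wprod|exact: wprod_ge1|move=> k].
case: wP1 => m1 _ /(_ k) i1; case: wP2 => m2 _ /(_ k) i2.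
have mk : measurable_fun setT (EFin \o (fun z => wprod z ^+ k)).
  by apply/measurable_EFinP/measurable_funX; exact: measurable_wprod.
apply/integrableP; split=> //.
rewrite (eq_integral (fun z => (wprod z ^+ k)%:E)); last first.
  by move=> z _ /=; rewrite ger0_norm// exprn_ge0// (le_trans _ (wprod_ge1 z)).
rewrite fubini_tonelli1//; last first.
  by move=> z; rewrite lee_fin exprn_ge0// (le_trans _ (wprod_ge1 z)).
rewrite /fubini_F /=.
under eq_integral => x _.
  under eq_integral => y _ do rewrite /wprod/= exprMn EFinM.
  rewrite integralZl//.
  rewrite (@tame_meanE _ _ _ P2 w2 wP2 (fun y => w2 y ^+ k)); last first.
    split; first exact: measurable_funX.
    exists 1, k; split=> // y; rewrite mul1r ger0_norm// exprn_ge0//.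
    exact: le_trans (w2_ge1 y).
  over.
rewrite /= integralZr//.
rewrite (@tame_meanE _ _ _ P1 w1 wP1 (fun y => w1 y ^+ k)) ?ltry//.
split; first exact: measurable_funX.
exists 1, k; split=> // y; rewrite mul1r ger0_norm// exprn_ge0//.
exact: le_trans (w1_ge1 y).
Qed.

Lemma tame_fst f : tame w1 f -> tame wprod (fun z => f z.1).
Proof.
move=> [mf [C [k [C0 fC]]]]; split; first exact: (measurableT_comp mf).
exists C, k; split=> // z; rewrite (le_trans (fC _))// ler_wpM2l// lerXn2r//.
- by rewrite nnegrE (le_trans _ (w1_ge1 _)).
- by rewrite nnegrE (le_trans _ (wprod_ge1 _)).
- by rewrite /wprod ler_peMr// (le_trans _ (w1_ge1 _)).
Qed.

Lemma tame_snd f : tame w2 f -> tame wprod (fun z => f z.2).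
Proof.
move=> [mf [C [k [C0 fC]]]]; split; first exact: (measurableT_comp mf).
exists C, k; split=> // z; rewrite (le_trans (fC _))// ler_wpM2l// lerXn2r//.
- by rewrite nnegrE (le_trans _ (w2_ge1 _)).
- by rewrite nnegrE (le_trans _ (wprod_ge1 _)).
- by rewrite /wprod ler_peMl// (le_trans _ (w2_ge1 _)).
Qed.

Lemma tame_section1 f y : tame wprod f -> tame w1 (fun x => f (x, y)).
Proof.
move=> [mf [C [k [C0 fC]]]]; split.
  by apply: (measurableT_comp mf); exact: pair2_measurable.
exists (C * w2 y ^+ k), k; split=> [|x].
  by rewrite mulr_ge0// exprn_ge0// (le_trans _ (w2_ge1 _)).
by rewrite (le_trans (fC _))// /wprod exprMn mulrAC mulrA.
Qed.

Lemma tame_section2 f x : tame wprod f -> tame w2 (fun y => f (x, y)).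
Proof.
move=> [mf [C [k [C0 fC]]]]; split.
  by apply: (measurableT_comp mf); exact: pair1_measurable.
exists (C * w1 x ^+ k), k; split=> [|y].
  by rewrite mulr_ge0// exprn_ge0// (le_trans _ (w1_ge1 _)).
by rewrite (le_trans (fC _))// /wprod exprMn mulrA.
Qed.

Let tame_wX2 k : tame w2 (fun y => w2 y ^+ k).
Proof.
case: wP2 => m2 _ _; split; first exact: measurable_funX.
exists 1, k; split=> // y; rewrite mul1r ger0_norm// exprn_ge0//.
exact: le_trans (w2_ge1 y).
Qed.

Let tame_wX1 k : tame w1 (fun y => w1 y ^+ k).
Proof.
case: wP1 => m2 _ _; split; first exact: measurable_funX.
exists 1, k; split=> // y; rewrite mul1r ger0_norm// exprn_ge0//.
exact: le_trans (w1_ge1 y).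
Qed.

(** Integrating out one variable keeps the growth bound, the constant being multiplied by a moment
    of [w2]. This is what allows iterated means without further integrability conditions. *)
Lemma tame_mean2 f : tame wprod f -> tame w1 (fun x => mean P2 (fun y => f (x, y))).
Proof.
move=> tf; have [mf [C [k [C0 fC]]]] := tf; split.
  apply/measurable_EFinP.
  rewrite (_ : _ \o _ = fubini_F P2 (EFin \o f)).
    apply: (measurable_fubini_F (m1 := P1)).
    exact: (tame_integrable weight_prod tf).
  apply/funext => x; rewrite /fubini_F /= -(tame_meanE wP2)//.
  exact: tame_section2.
exists (C * mean P2 (fun y => w2 y ^+ k)), k; split=> [|x].
  rewrite mulr_ge0// mean_ge0// => y; rewrite exprn_ge0//.
  exact: le_trans (w2_ge1 y).
rewrite (le_trans (mean_norm wP2 _))//; first exact: tame_section2.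
rewrite mulrAC -(meanZ wP2)//; apply: (mean_le wP2).
- apply: tame_norm; exact: tame_section2.
- by apply: tameZ => //; exact: tame_wX2.
- by move=> y; rewrite (le_trans (fC _))// /wprod exprMn mulrA.
Qed.

Lemma tame_mean1 f : tame wprod f -> tame w2 (fun y => mean P1 (fun x => f (x, y))).
Proof.
move=> tf; have [mf [C [k [C0 fC]]]] := tf; split.
  apply/measurable_EFinP.
  rewrite (_ : _ \o _ = fubini_G P1 (EFin \o f)).
    apply: (measurable_fubini_G (m2 := P2)).
    exact: (tame_integrable weight_prod tf).
  apply/funext => y; rewrite /fubini_G /= -(tame_meanE wP1)//.
  exact: tame_section1.
exists (C * mean P1 (fun y => w1 y ^+ k)), k; split=> [|y].
  rewrite mulr_ge0// mean_ge0// => x; rewrite exprn_ge0//.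
  exact: le_trans (w1_ge1 x).
rewrite (le_trans (mean_norm wP1 _))//; first exact: tame_section1.
rewrite mulrAC -(meanZ wP1)//; apply: (mean_le wP1).
- apply: tame_norm; exact: tame_section1.
- by apply: tameZ => //; exact: tame_wX1.
- by move=> x; rewrite (le_trans (fC _))// /wprod exprMn mulrAC mulrA.
Qed.

Lemma mean_prod f : tame wprod f ->
  mean (P1 \x P2)%E f = mean P1 (fun x => mean P2 (fun y => f (x, y))).
Proof.
move=> tf; rewrite {1}/mean /Rintegral.
rewrite -(integral12_prod_meas1 (tame_integrable weight_prod tf)) /fubini_F.
rewrite /mean {2}/Rintegral; congr fine; apply: eq_integral => x _ /=.
by rewrite (tame_meanE wP2)//; exact: tame_section2.
Qed.

Lemma mean_swap f : tame wprod f ->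
  mean P1 (fun x => mean P2 (fun y => f (x, y))) =
  mean P2 (fun y => mean P1 (fun x => f (x, y))).
Proof.
move=> tf; rewrite -mean_prod// {1}/mean /Rintegral.
rewrite -(integral21_prod_meas1 (tame_integrable weight_prod tf)) /fubini_G.
rewrite /mean {2}/Rintegral; congr fine; apply: eq_integral => x _ /=.
by rewrite (tame_meanE wP1)//; exact: tame_section1.
Qed.

End Products.
Arguments wprod {d1 d2 T1 T2 R} w1 w2 z.

Section Distribution.
Context d1 d2 (T1 : measurableType d1) (T2 : measurableType d2) (R : realType).
Variables (P : probability T1 R) (X : {mfun T1 >-> T2}) (w : T2 -> R).
Hypotheses (mw : measurable_fun setT w) (wPX : weight P (w \o X)).

Lemma weight_distribution : (forall x, 1 <= w x) -> weight (distribution P X) w.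
Proof.
move=> w1; split=> // k; apply/integrableP; split.
  exact/measurable_EFinP/measurable_funX.
rewrite ge0_integral_distribution//; last first.
  by apply/measurable_EFinP; apply: measurableT_comp => //; exact: measurable_funX.
by case: wPX => _ _ /(_ k) /integrableP[].
Qed.

Lemma mean_distribution f : tame w f -> mean (distribution P X) f = mean P (f \o X).
Proof.
move=> [mf [C [k [C0 fC]]]]; rewrite /mean /Rintegral integral_distribution//.
  exact/measurable_EFinP.
apply: (tame_integrable wPX (f := f \o X)); split; first exact: measurableT_comp.
by exists C, k; split=> // x; exact: fC.
Qed.

End Distribution.

Section Powers.
Context d (T : measurableType d) (R : realType).
Variables (P : probability T R) (w : T -> R).
Hypothesis wP : weight P w.
Let w1 x : 1 <= w x. Proof. by case: wP. Qed.

Definition wpow n (t : n.-tuple T) : R := \prod_i w (tnth t i).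

Lemma tnth_cons_pair0 n (z : T * n.-tuple T) : tnth (cons_pair z) ord0 = z.1.
Proof. by []. Qed.

Lemma tnth_cons_pairS n (z : T * n.-tuple T) i :
  tnth (cons_pair z) (lift ord0 i) = tnth z.2 i.
Proof. by rewrite /cons_pair tnthS. Qed.

Lemma wpow_cons n z : wpow (@cons_pair _ T n z) = wprod w (@wpow n) z.
Proof.
rewrite /wpow big_ord_recl tnth_cons_pair0; congr (_ * _).
by apply: eq_bigr => i _; rewrite tnth_cons_pairS.
Qed.

Lemma wpow_ge1 n t : 1 <= @wpow n t.
Proof. by rewrite /wpow; elim/big_ind: _ => // x y x1 y1; rewrite -[1]mulr1 ler_pM. Qed.

Lemma measurable_wpow n : measurable_fun setT (@wpow n).
Proof.
apply: measurable_prod => i _; case: wP => mw _ _.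
exact: (measurableT_comp mw (measurable_tnth i)).
Qed.

Lemma weight_pow n : weight (prob_pow P n) (@wpow n).
Proof.
elim: n => [|n IH].
  split; [exact: measurable_wpow|exact: wpow_ge1|move=> k].
  apply/integrableP; split.
    by apply/measurable_EFinP/measurable_funX; exact: measurable_wpow.
  rewrite /= integral_dirac//= ?diracT ?mul1e ?ltry//.
  apply/measurable_EFinP; apply: measurableT_comp => //.
  by apply: measurable_funX; exact: measurable_wpow.
apply: weight_distribution; first exact: measurable_wpow.
  have -> : @wpow n.+1 \o @cons_pair _ T n = wprod w (@wpow n).
    by apply/funext => z /=; rewrite wpow_cons.
  exact: weight_prod.
exact: wpow_ge1.
Qed.

Lemma tame_tnth n f i : tame w f -> tame (@wpow n) (fun t => f (tnth t i)).
Proof.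
move=> [mf [C [k [C0 fC]]]]; split.
  exact: (measurableT_comp mf (measurable_tnth i)).
exists C, k; split=> // t; rewrite (le_trans (fC _))// ler_wpM2l// lerXn2r//.
- by rewrite nnegrE (le_trans _ (w1 _)).
- by rewrite nnegrE (le_trans _ (wpow_ge1 _)).
rewrite /wpow (bigD1 i)//= ler_peMr// ?(le_trans _ (w1 _))//.
by elim/big_ind: _ => // x y x1 y1; rewrite -[1]mulr1 ler_pM.
Qed.

Lemma tame_cons n f : tame (@wpow n.+1) f ->
  tame (wprod w (@wpow n)) (fun z => f (cons_pair z)).
Proof.
move=> [mf [C [k [C0 fC]]]]; split.
  exact: (measurableT_comp mf (@measurable_cons_pair _ T n)).
by exists C, k; split=> // z; rewrite -wpow_cons.
Qed.

Lemma mean_pow0 f : measurable_fun setT f ->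
  mean (prob_pow P 0) f = f [tuple].
Proof.
move=> mf; rewrite /mean /Rintegral /= integral_dirac ?diracT ?mul1e//.
exact/measurable_EFinP.
Qed.

Lemma mean_powS n f : tame (@wpow n.+1) f ->
  mean (prob_pow P n.+1) f =
  mean P (fun x => mean (prob_pow P n) (fun t => f (cons_pair (x, t)))).
Proof.
move=> tf; have wn := weight_pow n.
rewrite [LHS](mean_distribution _ tf); last first.
  have -> : @wpow n.+1 \o @cons_pair _ T n = wprod w (@wpow n).
    by apply/funext => z /=; rewrite wpow_cons.
  exact: weight_prod.
by rewrite (mean_prod wP wn)//; exact: tame_cons.
Qed.

(** Independence of the coordinates, by splitting off the first one. *)
Lemma mean_pow_prod n (F : 'I_n -> T -> R) : (forall i, tame w (F i)) ->
  mean (prob_pow P n) (fun t => \prod_i F i (tnth t i)) = \prod_i mean P (F i).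
Proof.
elim: n F => [|n IH] F tF.
  rewrite mean_pow0 ?big_ord0//.
  by under eq_fun do rewrite big_ord0; exact: measurable_cst.
have tG n' (G : 'I_n' -> T -> R) : (forall i, tame w (G i)) ->
    tame (@wpow n') (fun t => \prod_i G i (tnth t i)).
  by move=> tG; apply: tame_prod => i _; exact: tame_tnth.
rewrite mean_powS ?big_ord_recl; last exact: tG.
rewrite -IH//; under eq_fun => x.
  under eq_fun => t.
    rewrite big_ord_recl tnth_cons_pair0 /=.
    under eq_bigr do rewrite tnth_cons_pairS /=.
    over.
  rewrite (meanZ (weight_pow n))//; last by apply: (tG _ (fun i => F (lift ord0 i))) => i; exact: tF.
  over.
by rewrite (meanZr wP).
Qed.

Lemma mean_tnth n f i : tame w f ->
  mean (prob_pow P n) (fun t => f (tnth t i)) = mean P f.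
Proof.
move=> tf; pose F j := if j == i then f else fun=> 1.
have -> : (fun t => f (tnth t i)) = (fun t : n.-tuple T => \prod_j F j (tnth t j)).
  apply/funext => t; rewrite (bigD1 i)//= /F eqxx big1 ?mulr1// => j /negPf ji.
  by rewrite ji.
rewrite mean_pow_prod => [|j].
  rewrite (bigD1 i)//= /F eqxx big1 ?mulr1// => j /negPf ->.
  exact: (mean_cst P).
by rewrite /F; case: ifP => // _; exact: tame_cst.
Qed.

(** The Tonelli form of [mean_powS], for nonnegative functions with no growth bound; it serves to
    identify laws. *)
Lemma ge0_integral_powS n (f : n.+1.-tuple T -> \bar R) :
  measurable_fun setT f -> (forall t, 0 <= f t)%E ->
  (\int[prob_pow P n.+1]_t f t =
   \int[P]_x \int[prob_pow P n]_t f (cons_pair (x, t)))%E.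
Proof.
move=> mf f0; rewrite ge0_integral_distribution// fubini_tonelli1 => [//||z].
  exact: (measurableT_comp mf (@measurable_cons_pair _ T n)).
exact: f0.
Qed.

End Powers.
Arguments wpow {d T R} w n t.

(** * Gaussian integrals *)

Section AffineChange.
Variable R : realType.
Notation mu := (@lebesgue_measure R).

Definition affine (a b : R) (x : measurableTypeR R) : measurableTypeR R :=
  a * (x : R) + b.

Lemma measurable_affine a b : measurable_fun setT (affine a b).
Proof. by apply: measurable_funD => //; exact: measurable_funM. Qed.

Definition affine_measure (a b : R) : {measure set (measurableTypeR R) -> \bar R} :=
  measure_function_pushforward__canonical__measure_function_Measure
    mu (measurable_affine a b).

(** By uniqueness of Lebesgue measure, half-open intervals suffice. A negative slope moves the open
    end to the other side, which does not change the length. *)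
Lemma lebesgue_measure_affine (a b : R) (a0 : a != 0) (A : set (measurableTypeR R)) :
  measurable A ->
  mu A = mscale (NngNum (normr_ge0 a)) (affine_measure a b) A.
Proof.
apply: lebesgue_measure_unique => _ [[c d] _ <-] /=.
rewrite /mscale/= /affine_measure/= /pushforward lebesgue_measure_itv /= lte_fin.
have [apos|aneg|a00] := ltgtP a 0; last by rewrite a00 eqxx in a0.
- have -> : affine a b @^-1` `]c, d] = `[(d - b) / a, (c - b) / a[%classic.
    apply/seteqP; split=> x /=; rewrite !in_itv/= /affine;
      by rewrite ler_ndivrMr// ltr_ndivlMr// lerBrDr ltrBlDr mulrC => /andP[-> ->].
  rewrite lebesgue_measure_itv /= lte_fin ltr_nM2r ?invr_lt0//.
  rewrite ltrD2r; case: ifPn => cd; last by rewrite mule0.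
  rewrite -!EFinB -EFinM; congr EFin; rewrite ltr0_norm//.
  by field.
- have -> : affine a b @^-1` `]c, d] = `](c - b) / a, (d - b) / a]%classic.
    apply/seteqP; split=> x /=; rewrite !in_itv/= /affine;
      by rewrite ler_pdivlMr// ltr_pdivrMr// lerBrDr ltrBlDr mulrC => /andP[-> ->].
  rewrite lebesgue_measure_itv /= lte_fin ltr_pM2r ?invr_gt0//.
  rewrite ltrD2r; case: ifPn => cd; last by rewrite mule0.
  rewrite -!EFinB -EFinM; congr EFin; rewrite gtr0_norm//.
  by field.
Qed.

Lemma ge0_integral_affine (a b : R) (f : measurableTypeR R -> \bar R) :
  a != 0 -> measurable_fun setT f -> (forall x, 0 <= f x)%E ->
  (\int[mu]_x f x = `|a|%:E * \int[mu]_x f (a * x + b)%R)%E.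
Proof.
move=> a0 mf f0.
have H := @lebesgue_measure_affine a b a0.
rewrite (eq_measure_integral
  (mscale (NngNum (normr_ge0 a)) (affine_measure a b))) => [|A mA _].
  rewrite ge0_integral_mscale//; congr (_ * _)%E.
  exact: (ge0_integral_pushforward (measurable_affine a b)).
exact: H.
Qed.

End AffineChange.

Section NormalIntegral.
Variables (R : realType) (m s : R).
Notation mu := (@lebesgue_measure R).
Notation N := (normal_prob m s).
Notation pdf := (normal_pdf m s).

Let mpdf : measurable_fun setT pdf := measurable_normal_pdf m s.

Let ge0_pdfM (f : R -> R) : (forall x, 0 <= f x) ->
  forall x, (0 <= (f x * pdf x)%:E)%E.
Proof. by move=> f0 x; rewrite lee_fin mulr_ge0// normal_pdf_ge0. Qed.

Import HBNNSimple.

Let integral_normal_nnsfun (f : {nnsfun measurableTypeR R >-> R}) :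
  (\int[N]_x (f x)%:E = \int[mu]_x (f x * pdf x)%:E)%E.
Proof.
under [LHS]eq_integral do rewrite fimfunE -fsumEFin//.
rewrite [LHS]ge0_integral_fsum//; last 2 first.
  - by move=> r; exact/measurable_EFinP/measurableT_comp.
  - by move=> n x _; rewrite EFinM nnfun_muleindic_ge0.
under [RHS]eq_integral.
  move=> x xD; rewrite EFinM fimfunE -fsumEFin// muleC ge0_mule_fsumr; last first.
    by move=> r; rewrite EFinM nnfun_muleindic_ge0.
  over.
rewrite [RHS]ge0_integral_fsum//; last 2 first.
  - by move=> r; apply/measurable_EFinP; apply: measurable_funM => //; exact: measurable_funM.
  - move=> n x _; rewrite EFinM mule_ge0 ?lee_fin ?normal_pdf_ge0//.
    by have := nnfun_muleindic_ge0 f n x; rewrite -EFinM lee_fin.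
apply: eq_fsbigr => r _; rewrite integralZl_indic_nnsfun//= integral_indic// setIT.
rewrite /normal_prob -integralZl//=; last first.
  apply: (integrableS measurableT) => //; exact: integrable_normal_pdf.
rewrite integral_mkcond/=; apply: eq_integral => x _.
rewrite patchE indicE; case: ifPn => xE.
  by rewrite mulr1 muleC.
by rewrite mulr0 mule0.
Qed.

(** Simple functions by linearity, then monotone convergence along [nnsfun_approx] on both sides. *)
Lemma ge0_eintegral_normal (f : measurableTypeR R -> \bar R) :
  measurable_fun setT f -> (forall x, 0 <= f x)%E ->
  (\int[N]_x f x = \int[mu]_x (f x * (pdf x)%:E))%E.
Proof.
move=> mf f0; pose f_ := nnsfun_approx measurableT mf.
transitivity (lim (\int[N]_x (f_ n x)%:E @[n --> \oo])%E).
  rewrite -monotone_convergence//=.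
  - apply: eq_integral => x /[!inE] xD; apply/esym/cvg_lim => //=.
    exact: cvg_nnsfun_approx.
  - by move=> n; exact/measurable_EFinP/measurable_funTS.
  - by move=> n ? _; rewrite lee_fin.
  - by move=> ? _ ? ? mn; rewrite lee_fin; exact/lefP/nd_nnsfun_approx.
rewrite [X in _ = X](_ : _ = lim
    (\int[mu]_x (f_ n x * pdf x)%:E @[n --> \oo])%E); last first.
  rewrite -monotone_convergence//=.
  - apply: eq_integral => x /[!inE] xD; apply/esym/cvg_lim => //.
    have H : (((f_ n x)%:E * (pdf x)%:E)%E @[n --> \oo] -->
              (f x * (pdf x)%:E)%E).
      by apply: cvgeZr => //; exact: cvg_nnsfun_approx.
    exact: H.
  - by move=> n; apply/measurable_EFinP; apply: measurable_funM.
  - by move=> n ? _; apply: ge0_pdfM.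
  - move=> x _ a b ab; rewrite lee_fin ler_wpM2r ?normal_pdf_ge0//.
    exact/lefP/nd_nnsfun_approx.
by apply: congr_lim; apply/funext => n /=; exact: integral_normal_nnsfun.
Qed.

Lemma ge0_integral_normal (f : measurableTypeR R -> R) :
  measurable_fun setT f -> (forall x, 0 <= f x) ->
  (\int[N]_x (f x)%:E = \int[mu]_x (f x * pdf x)%:E)%E.
Proof.
move=> mf f0; apply: ge0_eintegral_normal; first exact/measurable_EFinP.
by move=> x; rewrite lee_fin.
Qed.

End NormalIntegral.

(** * Laws of measurable maps *)

Section Law.
Context d1 d2 (T1 : measurableType d1) (T2 : measurableType d2) (R : realType).
Variables (P : probability T1 R) (X : T1 -> T2) (Q : probability T2 R).

(** Stated for a bare function, so that the maps used below need not be bundled with their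
    measurability. *)
Definition has_law : Prop :=
  measurable_fun setT X /\ forall A, measurable A -> P (X @^-1` A) = Q A.

Lemma has_law_ge0_integral (f : T2 -> \bar R) : has_law ->
  measurable_fun setT f -> (forall x, 0 <= f x)%E ->
  (\int[P]_x f (X x) = \int[Q]_y f y)%E.
Proof.
move=> [mX XQ] mf f0.
rewrite -(ge0_integral_pushforward mX P measurableT mf)//.
by apply: eq_measure_integral => A mA _; exact: XQ.
Qed.

Lemma has_law_mean (w : T1 -> R) (f : T2 -> R) : has_law -> weight P w ->
  measurable_fun setT f -> tame w (fun x => f (X x)) ->
  mean P (fun x => f (X x)) = mean Q f.
Proof.
move=> [mX XQ] wP mf tf; rewrite /mean /Rintegral; congr fine.
have mEf : measurable_fun setT (EFin \o f) by exact/measurable_EFinP.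
apply: (etrans (esym (integral_pushforward mX mEf (tame_integrable wP tf) measurableT))).
by apply: eq_measure_integral => A mA _; exact: XQ.
Qed.

(** Indicators already determine the law; the criterion with all nonnegative functions is the one
    that Tonelli's theorem delivers. *)
Lemma has_lawP : measurable_fun setT X ->
  (forall f : T2 -> R, measurable_fun setT f -> (forall x, 0 <= f x) ->
    (\int[P]_x (f (X x))%:E = \int[Q]_y (f y)%:E)%E) -> has_law.
Proof.
move=> mX H; split=> // A mA.
have mXA : measurable (X @^-1` A).
  by rewrite -[X in measurable X]setTI; exact: mX.
have e1 : (\int[Q]_y (\1_A y)%:E)%E = Q A by rewrite integral_indic// setIT.
have e2 : (\int[P]_x (\1_A (X x))%:E)%E = P (X @^-1` A).
  by rewrite -[X in P X]setIT -integral_indic.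
by rewrite -e1 -e2; apply: H => [|x]; [exact: measurable_indic|rewrite indicE].
Qed.

End Law.
Arguments has_law {d1 d2 T1 T2 R} P X Q.

Lemma integral_pow0 d (T : measurableType d) (R : realType) (P : probability T R)
    (f : 0.-tuple T -> R) : measurable_fun setT f ->
  (\int[prob_pow P 0]_t (f t)%:E = (f [tuple])%:E)%E.
Proof.
move=> mf; rewrite /= integral_dirac ?diracT ?mul1e//.
exact/measurable_EFinP.
Qed.

(** Induction on the number of coordinates: the integral over the remaining ones is a nonnegative
    measurable function of the first, to which the law of a single coordinate applies. *)
Lemma has_law_pow d1 d2 (T1 : measurableType d1) (T2 : measurableType d2)
    (R : realType) (P : probability T1 R) (X : T1 -> T2) (Q : probability T2 R) n :
  has_law P X Q -> has_law (prob_pow P n) (fun t => map_tuple X t) (prob_pow Q n).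
Proof.
move=> XQ; have [mX _] := XQ.
have mmap m : measurable_fun setT (fun t : m.-tuple T1 => map_tuple X t).
  apply/measurable_fun_tnthP => i.
  rewrite (_ : _ \o _ = X \o (fun t => tnth t i)).
    by apply: measurableT_comp => //; exact: measurable_tnth.
  by apply/funext => t /=; rewrite tnth_map.
apply: has_lawP; first exact: mmap.
elim: n => [|n IH] f mf f0.
  rewrite (integral_pow0 Q mf) (integral_pow0 P (f := fun t => f (map_tuple X t))).
    by congr (f _)%:E; exact/val_inj.
  by apply: measurableT_comp => //; exact: mmap.
have mfE : measurable_fun setT (EFin \o f) by exact/measurable_EFinP.
rewrite ge0_integral_powS => [||t]; last by rewrite lee_fin.
  rewrite [RHS]ge0_integral_powS//.
  transitivity (\int[P]_x \int[prob_pow Q n]_y (f (cons_pair (X x, y)))%:E)%E.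
    apply: eq_integral => x _; rewrite -IH//.
      apply: eq_integral => t _; congr (f _)%:E; exact/val_inj.
    apply: (measurableT_comp mf).
    apply: (measurableT_comp (@measurable_cons_pair _ T2 n)).
    exact: pair1_measurable.
  apply: (has_law_ge0_integral XQ
    (f := fun x => (\int[prob_pow Q n]_y (f (cons_pair (x, y)))%:E)%E)).
    apply: (@measurable_fun_fubini_tonelli_F _ _ _ _ _ (prob_pow Q n)
      (fun z => (f (cons_pair z))%:E)) => [|z]; last by rewrite lee_fin.
    apply/measurable_EFinP; apply: (measurableT_comp mf).
    exact: measurable_cons_pair.
  by move=> x; apply: integral_ge0 => t _; rewrite lee_fin.
by apply/measurable_EFinP; apply: measurableT_comp => //; exact: mmap.
Qed.

Section GaussianLaw.
Variable R : realType.
Notation mu := (@lebesgue_measure R).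
Notation gauss := (gauss_prob R).

(** It dominates |x|, so that all polynomials are tame, and all its powers have finite Gaussian
    mean. *)
Definition gweight (x : measurableTypeR R) : R := expR `|x : R|.

Lemma normal_pdf0E (m s x : R) : 0 < s ->
  normal_pdf m s x = normal_peak 1 / s * expR (- (x - m) ^+ 2 / (s ^+ 2 * 2)).
Proof.
move=> s0; rewrite normal_pdfE ?gt_eqF// /normal_fun mulr_natr; congr (_ * _).
rewrite /normal_peak (_ : s ^+ 2 * pi *+ 2 = s ^+ 2 * (1 ^+ 2 * pi *+ 2)); last first.
  by rewrite expr1n mul1r mulrnAr.
by rewrite sqrtrM ?sqr_ge0// sqrtr_sqr gtr0_norm// invfM mulrC.
Qed.

Lemma weight_gauss : weight gauss gweight.
Proof.
have mw : measurable_fun setT gweight.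
  by apply: measurableT_comp => //; exact: measurableT_comp.
split=> // [x|k]; first by rewrite /gweight -expR0 ler_expR.
apply/integrableP; split; first exact/measurable_EFinP/measurable_funX.
rewrite (eq_integral (fun x => (gweight x ^+ k)%:E)); last first.
  by move=> z _ /=; rewrite ger0_norm// exprn_ge0// expR_ge0.
rewrite ge0_integral_normal; last 2 first.
- exact: measurable_funX.
- by move=> x; rewrite exprn_ge0// expR_ge0.
(* Since k |x| <= k^2 + 3 x^2 / 8, the integrand is at most 2 exp(k^2) times the density of N(0, 4),
   the prefactor 2 undoing the smaller peak. *)
apply: (@le_lt_trans _ _
  (\int[mu]_x ((2 * expR (k%:R ^+ 2)) * normal_pdf 0 2 x)%:E)%E).
  apply: ge0_le_integral => //.
  - by move=> x _; rewrite lee_fin mulr_ge0 ?normal_pdf_ge0// exprn_ge0// expR_ge0.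
  - apply/measurable_EFinP/measurable_funM; first exact: measurable_funX.
    exact: measurable_normal_pdf.
  - apply/measurable_EFinP/measurable_funM => //.
    exact: measurable_normal_pdf.
  - move=> x _; rewrite lee_fin !normal_pdf0E// !subr0.
    rewrite [leLHS]mulrCA mulrA [leRHS](_ : _ =
      normal_peak 1 * (expR (k%:R ^+ 2) * expR (- x ^+ 2 / (2 ^+ 2 * 2)))); last first.
      by field.
    rewrite divr1 -mulrA ler_wpM2l ?normal_peak_ge0// /gweight -expRM_natl -!expRD ler_expR.
    have : `|x| ^+ 2 = x ^+ 2 by rewrite real_normK// num_real.
    have := normr_ge0 x.
    move: (`|x|) (k%:R) => y l y0 <-.
    rewrite expr1n mul1r; have := sqr_ge0 (3 * y - 4 * l); have := sqr_ge0 l.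
    lra.
under eq_integral do rewrite EFinM.
rewrite integralZl//=; last exact: integrable_normal_pdf.
by rewrite integral_normal_pdf mule1 ltry.
Qed.

Lemma tame_gauss_id : tame gweight (fun x => x).
Proof.
split; first exact: measurable_id.
exists 1, 1%N; split=> // x; rewrite mul1r expr1 /gweight.
by rewrite (le_trans _ (expR_ge1Dx _))// lerDr.
Qed.

Lemma gauss_opp_law : has_law gauss
  (fun x : measurableTypeR R => - (x : R) : measurableTypeR R) gauss.
Proof.
apply: has_lawP; first exact: measurableT_comp.
move=> f mf f0; rewrite !ge0_integral_normal//; last first.
  by apply: measurableT_comp => //; exact: measurableT_comp.
rewrite [RHS](@ge0_integral_affine _ (-1) 0) ?oppr_eq0 ?oner_eq0//; last 2 first.
- apply/measurable_EFinP/measurable_funM => //; exact: measurable_normal_pdf.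
- by move=> x; rewrite lee_fin mulr_ge0// normal_pdf_ge0.
rewrite normrN1 mul1e; apply: eq_integral => x _.
by rewrite mulN1r addr0 !normal_pdf0E// !subr0 sqrrN.
Qed.

(* Integrating the density of N(0, s^2) against that of N(0, 1). *)
Lemma gauss_expR_sqr (s : R) : 0 < s ->
  (\int[gauss]_x (expR ((1 - s ^- 2) / 2 * (x : R) ^+ 2))%:E = s%:E)%E.
Proof.
move=> s0; have mf : measurable_fun setT
    (fun x : measurableTypeR R => expR ((1 - s ^- 2) / 2 * (x : R) ^+ 2)).
  by apply: measurableT_comp => //; apply: measurable_funM.
rewrite (ge0_integral_normal _ _ mf) => [|x]; last exact: expR_ge0.
transitivity (\int[mu]_x (s%:E * (normal_pdf 0 s x)%:E))%E.
  apply: eq_integral => x _; rewrite -EFinM !normal_pdf0E// !subr0; congr EFin.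
  rewrite divr1 mulrCA -expRD [RHS]mulrA [s * _]mulrCA divff ?gt_eqF// mulr1.
  by congr (_ * expR _); rewrite expr1n; field; rewrite gt_eqF.
rewrite integralZl//=; last exact: integrable_normal_pdf.
by rewrite integral_normal_pdf mule1.
Qed.

End GaussianLaw.

Lemma integral_prob_cst d (T : measurableType d) (R : realType)
    (P : probability T R) (c : R) : (\int[P]_x c%:E = c%:E)%E.
Proof.
rewrite integral_cst// -[RHS]mule1; congr (_ * _)%E; exact: probability_setT.
Qed.

Section GaussianMoments.
Variable R : realType.
Notation mu := (@lebesgue_measure R).
Notation gauss := (gauss_prob R).
Notation gw := (@gweight R).

Let wg : weight gauss gw := weight_gauss R.

Lemma tame_gaussX n : tame gw (fun x => (x : R) ^+ n).
Proof. by apply: tameX; exact: tame_gauss_id. Qed.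

(** Inserting 1 + z <= exp(z) into [gauss_expR_sqr] gives (s^2 - 1) m <= 2 s^2 (s - 1) for all s >
    0. Divided by s - 1, this bounds m from above for s > 1 and from below for s < 1, and both
    bounds tend to 1 as s tends to 1. *)
Lemma gauss_moment2 : mean gauss (fun x => (x : R) ^+ 2) = 1.
Proof.
set m := mean _ _.
have m0 : 0 <= m by apply: mean_ge0 => x; exact: sqr_ge0.
have key (s : R) : 0 < s -> 1 + (1 - s ^- 2) / 2 * m <= s.
  move=> s0; pose f (x : measurableTypeR R) := expR ((1 - s ^- 2) / 2 * (x : R) ^+ 2).
  have If : (\int[gauss]_x (f x)%:E = s%:E)%E := gauss_expR_sqr s0.
  have mf : measurable_fun setT f.
    by apply: measurableT_comp => //; apply: measurable_funM.
  have if_ : gauss.-integrable setT (EFin \o f).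
    apply/integrableP; split; first exact/measurable_EFinP.
    rewrite (eq_integral (fun x => (f x)%:E)) ?If ?ltry// => x _ /=.
    by rewrite ger0_norm// expR_ge0.
  have sE : mean gauss f = s by rewrite /mean /Rintegral If.
  rewrite -[leRHS]sE.
  have t2 : tame gw (fun x => (1 - s ^- 2) / 2 * (x : R) ^+ 2).
    by apply: tameZ; exact: tame_gaussX.
  rewrite -(meanZ wg); last exact: tame_gaussX.
  have tc : tame gw (fun=> 1) by exact: tame_cst.
  have := meanD wg tc t2; rewrite (mean_cst gauss) => <-.
  apply: le_Rintegral => //.
    by apply: (tame_integrable wg); apply: tameD => //; case: wg.
  by move=> x _; exact: expR_ge1Dx.
have key2 (s : R) : 0 < s -> (s ^+ 2 - 1) * m <= 2 * s ^+ 2 * (s - 1).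
  move=> s0; have := key s s0; have s2 : 0 < 2 * s ^+ 2 by rewrite mulr_gt0// exprn_gt0.
  rewrite -lerBrDl -(ler_pM2l s2).
  rewrite (_ : _ * (_ * m) = (s ^+ 2 - 1) * m) ?[in leRHS]mulrA//.
  by field; rewrite gt_eqF.
apply/eqP; rewrite eq_le; apply/andP; split; rewrite leNgt; apply/negP => m1.
(* An explicit s = 1 + t close to 1 replaces the limit; the next case uses s = 1 - t. *)
- pose t := (m - 1) / (4 * m).
  have mp : 0 < m by lra.
  have t0 : 0 < t by rewrite divr_gt0 ?mulr_gt0//; lra.
  have tE : t * (4 * m) = m - 1 by rewrite /t divfK// gt_eqF// mulr_gt0.
  have t1 : t <= 1 / 4 by nra.
  have := key2 (1 + t) ltac:(lra).
  have -> : ((1 + t) ^+ 2 - 1) * m = t * ((2 + t) * m) by ring.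
  have -> : 2 * (1 + t) ^+ 2 * (1 + t - 1) = t * (2 * (1 + t) ^+ 2) by ring.
  rewrite ler_pM2l//; nra.
- pose t := (1 - m) / 4.
  have t0 : 0 < t by rewrite /t; lra.
  have mt : m = 1 - 4 * t by rewrite /t; lra.
  have t1 : t <= 1 / 4 by lra.
  have := key2 (1 - t) ltac:(lra).
  have -> : ((1 - t) ^+ 2 - 1) * m = - (t * ((2 - t) * m)) by ring.
  have -> : 2 * (1 - t) ^+ 2 * (1 - t - 1) = - (t * (2 * (1 - t) ^+ 2)) by ring.
  rewrite lerN2 ler_pM2l// mt; nra.
Qed.

Lemma gauss_moment_odd n : odd n -> mean gauss (fun x => (x : R) ^+ n) = 0.
Proof.
move=> on; have := has_law_mean (gauss_opp_law R) wg.
move=> /(_ (fun x => (x : R) ^+ n)) H.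
have mn : measurable_fun setT (fun x : measurableTypeR R => (x : R) ^+ n).
  by case: (tame_gaussX n).
have tN : tame gw (fun x => (- (x : R)) ^+ n).
  by apply: tameX; apply: tameN; exact: tame_gauss_id.
have := H mn tN.
have -> : (fun x : measurableTypeR R => (- (x : R)) ^+ n) = (fun x => -1 * (x : R) ^+ n).
  by apply/funext => x; rewrite exprNn -signr_odd on expr1.
rewrite (meanZ wg); last exact: tame_gaussX.
set m := mean _ _; lra.
Qed.

(** With t = a x + b y, the joint density of (x, t) is the standard density of t times the density
    of N(a t, b^2) at x, and the latter integrates to 1. *)
Let gauss_stable_unit (a b : R) (f : measurableTypeR R -> R) :
    0 < b -> a ^+ 2 + b ^+ 2 = 1 -> measurable_fun setT f -> (forall x, 0 <= f x) ->
  (\int[gauss]_x \int[gauss]_y (f (a * (x : R) + b * (y : R)))%:E =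
   \int[gauss]_x (f x)%:E)%E.
Proof.
move=> b0 ab mf f0; have bN0 : b != 0 by rewrite gt_eqF.
pose pdf := @normal_pdf R 0 1.
have mpdf : measurable_fun setT pdf := measurable_normal_pdf 0 1.
have pdf0 x : 0 <= pdf x := normal_pdf_ge0 0 1 x.
have maff (c e : R) : measurable_fun setT (fun x : R => c * x + e).
  by apply: measurable_funD => //; exact: measurable_funM.
have inner (x : R) : (\int[gauss]_y (f (a * x + b * (y : R)))%:E =
    \int[mu]_t (b^-1 * (f t * pdf ((t - a * x) / b)))%:E)%E.
  rewrite ge0_integral_normal//; last first.
    apply: (measurableT_comp mf).
    by under eq_fun do rewrite addrC; exact: maff.
  rewrite [RHS](@ge0_integral_affine _ b (a * x))//; last 2 first.
  - apply/measurable_EFinP; apply: measurable_funM => //.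
    apply: measurable_funM => //; apply: (measurableT_comp mpdf).
    apply: measurable_funM => //; exact: measurable_funB.
  - by move=> t; rewrite lee_fin mulr_ge0 ?invr_ge0 ?(ltW b0)// mulr_ge0.
  rewrite -ge0_integralZl//; last 2 first.
  - apply/measurable_EFinP; apply: measurable_funM => //.
    apply: measurable_funM => //; first exact: (measurableT_comp mf (maff _ _)).
    apply: (measurableT_comp mpdf).
    apply: measurable_funM => //; apply: measurable_funB => //; exact: maff.
  - by move=> t _; rewrite lee_fin mulr_ge0 ?invr_ge0 ?(ltW b0)// mulr_ge0.
  apply: eq_integral => y _; rewrite -EFinM gtr0_norm// mulVKf//.
  rewrite [b * y + _]addrC; congr (_ * pdf _)%:E.
  by field.
under eq_integral do rewrite inner.
have mF : measurable_fun setT (fun z : R * R =>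
    (b^-1 * (f z.2 * pdf ((z.2 - a * z.1) / b)))).
  apply: measurable_funM => //; apply: measurable_funM.
    exact: (measurableT_comp mf).
  apply: (measurableT_comp mpdf); apply: measurable_funM => //.
  by apply: measurable_funB => //; exact: measurable_funM.
have F0 x y : 0 <= b^-1 * (f y * pdf ((y - a * x) / b)).
  by rewrite mulr_ge0 ?invr_ge0 ?(ltW b0)// mulr_ge0.
pose F (z : R * R) := (b^-1 * (f z.2 * pdf ((z.2 - a * z.1) / b)) * pdf z.1)%:E.
have mG : measurable_fun setT (fun x => \int[mu]_t
    (b^-1 * (f t * pdf ((t - a * x) / b)))%:E)%E.
  apply: (@measurable_fun_fubini_tonelli_F _ _ _ _ _ mu
    (fun z : R * R => (b^-1 * (f z.2 * pdf ((z.2 - a * z.1) / b)))%:E)).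
    exact/measurable_EFinP.
  by move=> z; rewrite lee_fin.
rewrite ge0_eintegral_normal//; last first.
  by move=> x; apply: integral_ge0 => t _; rewrite lee_fin.
transitivity (\int[mu]_x \int[mu]_y F (x, y))%E.
  apply: eq_integral => x _; rewrite -ge0_integralZr//.
  - apply/measurable_EFinP; exact: (measurableT_comp mF (pair1_measurable _)).
  - by move=> t _; rewrite lee_fin.
  - by rewrite lee_fin.
have EF0 z : (0 <= F z)%E by rewrite lee_fin mulr_ge0.
have mEF : measurable_fun setT F.
  apply/measurable_EFinP; apply: measurable_funM => //.
  exact: (measurableT_comp mpdf).
rewrite (@sfinite_Fubini _ _ _ _ R mu mu F EF0 mEF).
rewrite ge0_integral_normal//; apply: eq_integral => t _.
transitivity (\int[mu]_x ((f t * pdf t)%:E * (normal_pdf (a * t) b x)%:E))%E.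
  apply: eq_integral => x _; rewrite /F /= -EFinM; congr EFin.
  rewrite /pdf !normal_pdf0E// !subr0 !divr1 expr1n mul1r.
  set e1 := expR _; set e2 := expR _; set e3 := expR _; set e4 := expR _.
  have E : e1 * e2 = e3 * e4.
    rewrite /e1 /e2 /e3 /e4 -!expRD; congr expR.
    set l := (X in X = _); set r := (X in _ = X).
    (* Completing the square: the two exponents differ by a multiple of a^2 + b^2 - 1. *)
    have : l = r - (a ^+ 2 + b ^+ 2 - 1) * (x ^+ 2 - t ^+ 2) / (2 * b ^+ 2).
      by rewrite /l /r; field.
    by rewrite ab subrr !mul0r subr0.
  set p := normal_peak 1.
  transitivity (b^-1 * f t * p ^+ 2 * (e1 * e2)); first by ring.
  by rewrite E; field.
rewrite integralZl//=; last exact: integrable_normal_pdf.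
by rewrite integral_normal_pdf mule1.
Qed.

(** Scaling by sqrt(a^2 + b^2) reduces to the unit case. For b = 0 there is no density to divide by,
    and the square root is |a|, so a negative a calls for the symmetry of the Gaussian law. *)
Lemma gauss_stable (a b : R) (f : measurableTypeR R -> R) : 0 <= b ->
  measurable_fun setT f -> (forall x, 0 <= f x) ->
  (\int[gauss]_x \int[gauss]_y (f (a * (x : R) + b * (y : R)))%:E =
   \int[gauss]_x (f (Num.sqrt (a ^+ 2 + b ^+ 2) * (x : R)))%:E)%E.
Proof.
rewrite le_eqVlt => /predU1P[<-|b0] mf f0.
  rewrite expr0n addr0 sqrtr_sqr.
  under eq_integral => x _.
    under eq_integral => y _ do rewrite mul0r addr0.
    rewrite integral_prob_cst.
    over.
  have [a0|a0] := ger0P a => //.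
  rewrite -(has_law_ge0_integral (gauss_opp_law R) 
    (f := fun x : measurableTypeR R => (f (- a * (x : R)))%:E)).
  - by apply: eq_integral => x _; rewrite mulrNN.
  - by apply/measurable_EFinP; apply: (measurableT_comp mf); exact: measurable_funM.
  - by move=> x; rewrite lee_fin.
set r := Num.sqrt _; have r2 : r ^+ 2 = a ^+ 2 + b ^+ 2.
  by rewrite sqr_sqrtr// addr_ge0 ?sqr_ge0.
have r0 : 0 < r by rewrite sqrtr_gt0 ltr_wpDl ?sqr_ge0// exprn_gt0.
have mfr : measurable_fun setT (fun x : measurableTypeR R => f (r * (x : R))).
  by apply: (measurableT_comp mf); exact: measurable_funM.
have ab : (a / r) ^+ 2 + (b / r) ^+ 2 = 1.
  by rewrite !exprMn -mulrDl -r2 exprVn divff// gt_eqF// exprn_gt0.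
apply/esym; apply: etrans; first apply/esym/(gauss_stable_unit _ ab mfr).
- by rewrite divr_gt0.
- by move=> x; exact: f0.
- apply: eq_integral => x _; apply: eq_integral => y _; congr (f _)%:E.
  by field; rewrite gt_eqF.
Qed.

(** (x + y) / sqrt 2 is again standard Gaussian; expanding its fourth power gives m = m / 4 + 6 / 4
    + m / 4. *)
Lemma gauss_moment4 : mean gauss (fun x => (x : R) ^+ 4) = 3.
Proof.
pose a : R := (Num.sqrt 2)^-1.
have a2 : a ^+ 2 = 1 / 2 by rewrite exprVn sqr_sqrtr// mul1r.
pose X (z : measurableTypeR R * measurableTypeR R) : measurableTypeR R :=
  a * (z.1 : R) + a * (z.2 : R).
have mX : measurable_fun setT X.
  by apply: measurable_funD; apply: measurable_funM => //.
have lawX : has_law (gauss \x gauss)%E X gauss.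
  apply: has_lawP => // f mf f0.
  rewrite fubini_tonelli1/=; last 2 first.
  - by apply/measurable_EFinP; exact: measurableT_comp.
  - by move=> z; rewrite lee_fin.
  rewrite /fubini_F /X /= gauss_stable// ?invr_ge0 ?sqrtr_ge0//.
  apply: eq_integral => x _; congr (f _)%:E.
  by rewrite a2 (_ : 1 / 2 + 1 / 2 = 1) ?sqrtr1 ?mul1r//; field.
have tXn n : tame (wprod gw gw) (fun z => X z ^+ n).
  apply: tameX; apply: tameD; first exact: (weight_ge1 (weight_prod wg wg)).
    by apply: tameZ; exact: (tame_fst wg wg (tame_gauss_id R)).
  by apply: tameZ; exact: (tame_snd wg wg (tame_gauss_id R)).
have := has_law_mean lawX (weight_prod wg wg) 
  (f := fun x : measurableTypeR R => (x : R) ^+ 4).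
have mn : measurable_fun setT (fun x : measurableTypeR R => (x : R) ^+ 4).
  by case: (tame_gaussX 4).
move=> /(_ mn (tXn 4)); set m := mean gauss _.
rewrite (mean_prod wg wg (tXn 4)).
have inner (x : R) : mean gauss (fun y => X (x, y) ^+ 4) =
    a ^+ 4 * x ^+ 4 + 6 * a ^+ 4 * x ^+ 2 + a ^+ 4 * m.
  have -> : (fun y => X (x, y) ^+ 4) = (fun y : measurableTypeR R =>
      \sum_(i < 5) (([:: 1; 4; 6; 4; 1]`_i * a ^+ 4 * x ^+ (4 - i)) * (y : R) ^+ i)).
    by apply/funext => y; rewrite !big_ord_recr big_ord0 /= /X /=; ring.
  rewrite (mean_sum wg) => [|i _]; last by apply: tameZ; exact: tame_gaussX.
  have mom (i : 'I_5) : mean gauss (fun y => (y : R) ^+ i) = [:: 1; 0; 1; 0; m]`_i.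
    case: i => [[|[|[|[|[|i]]]]] lti] //=.
    - exact: (mean_cst gauss 1).
    - exact: (@gauss_moment_odd 1).
    - exact: gauss_moment2.
    - exact: (@gauss_moment_odd 3).
  under eq_bigr => i _ do rewrite (meanZ wg _ (tame_gaussX i)) mom.
  by rewrite !big_ord_recr big_ord0 /=; ring.
under eq_fun do rewrite inner.
rewrite !(meanD wg)//; last 4 first.
- by apply: tameZ; exact: tame_gaussX.
- by apply: tameZ; exact: tame_gaussX.
- apply: tameD; [exact: (weight_ge1 wg)|apply: tameZ; exact: tame_gaussX|].
  by apply: tameZ; exact: tame_gaussX.
- exact: tame_cst.
rewrite !(meanZ wg); try exact: tame_gaussX; last exact: tame_cst.
rewrite (mean_cst gauss) gauss_moment2 -/m.
have -> : a ^+ 4 = 1 / 4 by rewrite (exprM a 2 2) a2; field.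
lra.
Qed.

End GaussianMoments.

(** * Moments of linear forms in a Gaussian vector *)

Section GaussianVectors.
Variable R : realType.
Notation gauss := (gauss_prob R).
Notation gw := (@gweight R).
Let wg : weight gauss gw := weight_gauss R.

Definition dotp D (u v : 'I_D -> R) : R := \sum_j u j * v j.

Definition lin D (u : 'I_D -> R) (g : gvec R D) : R := \sum_j gcoord g j * u j.

Lemma weight_gaussn D : weight (gaussn R D) (wpow gw D).
Proof. exact: weight_pow. Qed.

Lemma tame_lin D (u : 'I_D -> R) : tame (wpow gw D) (lin u).
Proof.
apply: tame_sum => [|j _]; first exact: (weight_ge1 (weight_gaussn D)).
apply: tameM; last exact: tame_cst.
exact: (tame_tnth wg j (tame_gauss_id R)).
Qed.

Lemma lin_cons D (u : 'I_D.+1 -> R) z :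
  lin u (cons_pair z) = (z.1 : R) * u ord0 + lin (u \o lift ord0) z.2.
Proof.
rewrite /lin big_ord_recl; congr (_ + _); apply: eq_bigr => j _.
by rewrite /gcoord tnth_cons_pairS.
Qed.

Lemma dotpC D (u v : 'I_D -> R) : dotp u v = dotp v u.
Proof. by apply: eq_bigr => j _; rewrite mulrC. Qed.

Lemma dotp_recl D (u v : 'I_D.+1 -> R) :
  dotp u v = u ord0 * v ord0 + dotp (u \o lift ord0) (v \o lift ord0).
Proof. by rewrite /dotp big_ord_recl. Qed.

Lemma dotp_ge0 D (u : 'I_D -> R) : 0 <= dotp u u.
Proof. by apply: sumr_ge0 => j _; rewrite -expr2 sqr_ge0. Qed.

(** Stability, applied one coordinate at a time: the form is a Gaussian variable of variance
    [dotp u u]. *)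
Lemma ge0_integral_lin D (u : 'I_D -> R) (f : measurableTypeR R -> R) :
  measurable_fun setT f -> (forall x, 0 <= f x) ->
  (\int[gaussn R D]_g (f (lin u g))%:E =
   \int[gauss]_x (f (Num.sqrt (dotp u u) * (x : R)))%:E)%E.
Proof.
elim: D u f => [|D IH] u f mf f0.
  rewrite (@integral_pow0 _ _ _ gauss (fun g => f (lin u g))); last first.
    by apply: (measurableT_comp mf); case: (tame_lin u).
  rewrite /lin /dotp !big_ord0 sqrtr0.
  by under eq_integral do rewrite mul0r; rewrite integral_prob_cst.
rewrite (@ge0_integral_powS _ _ _ gauss D (fun g => (f (lin u g))%:E)); last 2 first.
- apply/measurable_EFinP; apply: (measurableT_comp mf); by case: (tame_lin u).
- by move=> t; rewrite lee_fin.
rewrite dotp_recl -expr2; set c := Num.sqrt (dotp (u \o lift ord0) (u \o lift ord0)).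
have -> : dotp (u \o lift ord0) (u \o lift ord0) = c ^+ 2.
  by rewrite sqr_sqrtr// dotp_ge0.
rewrite -gauss_stable ?sqrtr_ge0//; apply: eq_integral => x _.
under eq_integral do rewrite lin_cons /=.
rewrite (IH _ (fun r : measurableTypeR R => f (x * u ord0 + (r : R))))//.
  by apply: eq_integral => y _; rewrite [x * _]mulrC.
by apply: (measurableT_comp mf); exact: measurable_funD.
Qed.

(** Integrates out one coordinate of a product of at most four linear forms, which is all that the
    moments below require. *)
Lemma mean_gauss_poly4 (c0 c1 c2 c3 c4 : R) :
  mean gauss (fun x => c0 + c1 * (x : R) + c2 * (x : R) ^+ 2 + c3 * (x : R) ^+ 3
                       + c4 * (x : R) ^+ 4) = c0 + c2 + 3 * c4.
Proof.
have -> : (fun x : measurableTypeR R => c0 + c1 * (x : R) + c2 * (x : R) ^+ 2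
    + c3 * (x : R) ^+ 3 + c4 * (x : R) ^+ 4) =
  (fun x : measurableTypeR R => \sum_(i < 5) [:: c0; c1; c2; c3; c4]`_i * (x : R) ^+ i).
  by apply/funext => x; rewrite !big_ord_recr big_ord0 /=; ring.
rewrite (mean_sum wg) => [|i _]; last by apply: tameZ; exact: tame_gaussX.
under eq_bigr => i _ do rewrite (meanZ wg _ (tame_gaussX R i)).
rewrite !big_ord_recr big_ord0 /=.
rewrite gauss_moment2 gauss_moment4 (@gauss_moment_odd R 1)// (@gauss_moment_odd R 3)//.
rewrite (_ : mean gauss _ = 1); first by ring.
exact: (mean_cst gauss 1).
Qed.

(** The first coordinate is integrated innermost, so that the inner integrand is a polynomial in one
    Gaussian variable. *)
Lemma mean_gaussnS D (f : gvec R D.+1 -> R) : tame (wpow gw D.+1) f ->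
  mean (gaussn R D.+1) f =
  mean (gaussn R D) (fun t => mean gauss (fun x => f (cons_pair (x, t)))).
Proof.
move=> tf; rewrite (mean_powS wg tf).
exact: (mean_swap wg (weight_gaussn D) (tame_cons tf)).
Qed.

Let tlin D (u : 'I_D -> R) := tame_lin u.
Let w1 D := weight_ge1 (weight_gaussn D).
Let wgn := weight_gaussn.

Ltac tame_lins := repeat first
  [ exact: tame_cst | exact: tlin | exact: w1 | apply: tameD | apply: tameM ].

Lemma mean_lin D (u : 'I_D -> R) : mean (gaussn R D) (lin u) = 0.
Proof.
elim: D u => [|D IH] u.
  by rewrite mean_pow0 ?/lin ?big_ord0//; case: (tame_lin u).
rewrite mean_gaussnS//.
have -> : (fun t => mean gauss (fun x => lin u (cons_pair (x, t)))) =
          lin (u \o lift ord0).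
  apply/funext => t; set c0 := lin _ t.
  transitivity (c0 + 0 + 3 * 0); last by ring.
  rewrite -(mean_gauss_poly4 c0 (u ord0) 0 0 0).
  by congr mean; apply/funext => x; rewrite lin_cons /= -/c0; ring.
exact: IH.
Qed.

Lemma mean_lin2 D (u v : 'I_D -> R) :
  mean (gaussn R D) (fun g => lin u g * lin v g) = dotp u v.
Proof.
elim: D u v => [|D IH] u v.
  rewrite mean_pow0 ?/lin ?/dotp ?big_ord0 ?mulr0//.
  by apply: measurable_funM; [case: (tame_lin u)|case: (tame_lin v)].
rewrite mean_gaussnS; last by tame_lins.
set u' := u \o lift ord0; set v' := v \o lift ord0.
have -> : (fun t => mean gauss (fun x => lin u (cons_pair (x, t)) * lin v (cons_pair (x, t)))) =
          (fun t => lin u' t * lin v' t + u ord0 * v ord0).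
  apply/funext => t; set c0 := lin u' t; set c1 := lin v' t.
  transitivity (c0 * c1 + u ord0 * v ord0 + 3 * 0); last by ring.
  rewrite -(mean_gauss_poly4 (c0 * c1) (c0 * v ord0 + c1 * u ord0) (u ord0 * v ord0) 0 0).
  by congr mean; apply/funext => x; rewrite !lin_cons /= -/u' -/v' -/c0 -/c1; ring.
rewrite (meanD (wgn D)); [|tame_lins..].
by rewrite IH (mean_cst (gaussn R D)) dotp_recl addrC.
Qed.

Lemma mean_lin3 D (u v w : 'I_D -> R) :
  mean (gaussn R D) (fun g => lin u g * lin v g * lin w g) = 0.
Proof.
elim: D u v w => [|D IH] u v w.
  rewrite mean_pow0 ?/lin ?big_ord0 ?mulr0//.
  by apply: measurable_funM; [apply: measurable_funM|];
    [case: (tame_lin u)|case: (tame_lin v)|case: (tame_lin w)].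
rewrite mean_gaussnS; last by tame_lins.
set a := u ord0; set b := v ord0; set c := w ord0.
set u' := u \o lift ord0; set v' := v \o lift ord0; set w' := w \o lift ord0.
have -> : (fun t => mean gauss (fun x => lin u (cons_pair (x, t)) *
             lin v (cons_pair (x, t)) * lin w (cons_pair (x, t)))) =
          (fun t => lin u' t * lin v' t * lin w' t +
             (a * b * lin w' t + a * c * lin v' t + b * c * lin u' t)).
  apply/funext => t; set c0 := lin u' t; set c1 := lin v' t; set c2 := lin w' t.
  set d2 := a * b * c2 + _ + _.
  transitivity (c0 * c1 * c2 + d2 + 3 * 0); last by ring.
  rewrite -(mean_gauss_poly4 (c0 * c1 * c2) (a * c1 * c2 + b * c0 * c2 + c * c0 * c1)
    d2 (a * b * c) 0).
  congr mean; apply/funext => x.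
  by rewrite !lin_cons /= -/u' -/v' -/w' -/c0 -/c1 -/c2 -/a -/b -/c /d2; ring.
rewrite !(meanD (wgn D)); [|tame_lins..].
rewrite !(meanZ (wgn D)); [|tame_lins..].
rewrite IH !mean_lin; ring.
Qed.

(** Isserlis's formula. A new coordinate contributes six terms of second order and the fourth moment
    3, and these complete the three pairings. *)
Lemma mean_lin4 D (u v w y : 'I_D -> R) :
  mean (gaussn R D) (fun g => lin u g * lin v g * (lin w g * lin y g)) =
  dotp u v * dotp w y + dotp u w * dotp v y + dotp u y * dotp v w.
Proof.
elim: D u v w y => [|D IH] u v w y.
  rewrite mean_pow0 ?/lin ?/dotp ?big_ord0 ?mulr0 ?addr0//.
  by apply: measurable_funM; apply: measurable_funM;
    [case: (tame_lin u)|case: (tame_lin v)|case: (tame_lin w)|case: (tame_lin y)].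
rewrite mean_gaussnS; last by tame_lins.
set a := u ord0; set b := v ord0; set c := w ord0; set e := y ord0.
set u' := u \o lift ord0; set v' := v \o lift ord0.
set w' := w \o lift ord0; set y' := y \o lift ord0.
have -> : (fun t => mean gauss (fun x => lin u (cons_pair (x, t)) *
             lin v (cons_pair (x, t)) * (lin w (cons_pair (x, t)) *
             lin y (cons_pair (x, t))))) =
          (fun t => lin u' t * lin v' t * (lin w' t * lin y' t) +
             (a * b * (lin w' t * lin y' t) + a * c * (lin v' t * lin y' t) +
              a * e * (lin v' t * lin w' t) + b * c * (lin u' t * lin y' t) +
              b * e * (lin u' t * lin w' t) + c * e * (lin u' t * lin v' t)) +
             3 * (a * b * c * e)).
  apply/funext => t; set c0 := lin u' t; set c1 := lin v' t.
  set c2 := lin w' t; set c3 := lin y' t.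
  set d2 := a * b * (c2 * c3) + _ + _ + _ + _ + _.
  rewrite -(mean_gauss_poly4 (c0 * c1 * (c2 * c3))
    (a * c1 * c2 * c3 + b * c0 * c2 * c3 + c * c0 * c1 * c3 + e * c0 * c1 * c2)
    d2 (a * b * c * c3 + a * b * e * c2 + a * c * e * c1 + b * c * e * c0) (a * b * c * e)).
  congr mean; apply/funext => x.
  by rewrite !lin_cons /= -/u' -/v' -/w' -/y' -/c0 -/c1 -/c2 -/c3 -/a -/b -/c -/e /d2; ring.
rewrite !(meanD (wgn D)); [|tame_lins..].
rewrite !(meanZ (wgn D)); [|tame_lins..].
rewrite IH !mean_lin2 (mean_cst (gaussn R D)) !dotp_recl.
rewrite -/a -/b -/c -/e -/u' -/v' -/w' -/y'; ring.
Qed.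

End GaussianVectors.

(** * Covariances of functions of independent rows *)

Section Covariance.
Context d (T : measurableType d) (R : realType).
Variables (P : probability T R) (w : T -> R).
Hypothesis wP : weight P w.

Definition cov (f g : T -> R) : R :=
  mean P (fun x => f x * g x) - mean P f * mean P g.

(** The variance of f - g is nonnegative. *)
Lemma cov_sum_le_half f g : tame w f -> tame w g ->
  2 * cov f g <= cov f f + cov g g.
Proof.
move=> tf tg; have w1 := weight_ge1 wP.
have tff : tame w (fun x => f x * f x) by exact: tameM.
have tgg : tame w (fun x => g x * g x) by exact: tameM.
have tfg : tame w (fun x => f x * g x) by exact: tameM.
have := tame_mean_sqr_le wP (tameB w1 tf tg).
rewrite (meanB wP)//.
have -> : (fun x => (f x - g x) ^+ 2) =
    (fun x => f x * f x - 2 * (f x * g x) + g x * g x).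
  by apply/funext => x; ring.
rewrite (meanD wP)//; last by apply: tameB => //; exact: tameZ.
rewrite (meanB wP)//; last exact: tameZ.
rewrite (meanZ wP)// /cov; lra.
Qed.

Lemma mean_cov_le s (a b c b1 e b2 : T -> R) :
  tame w a -> tame w b -> tame w c -> tame w b1 -> tame w e -> tame w b2 ->
  (forall x, 2 * (a x - b x) <= s * (c x - b1 x + (e x - b2 x))) ->
  2 * (mean P a - mean P b) <=
  s * (mean P c - mean P b1 + (mean P e - mean P b2)).
Proof.
move=> ta tb tc tb1 te tb2 H; have w1 := weight_ge1 wP.
have tab := tameB w1 ta tb; have tcb := tameB w1 tc tb1; have teb := tameB w1 te tb2.
have tD := tameD w1 tcb teb.
have := mean_le wP (tameZ 2 tab) (tameZ s tD) H.
by rewrite (meanZ wP _ tab) (meanZ wP _ tD) (meanD wP tcb teb) !(meanB wP).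
Qed.

End Covariance.

(* For each [i], and the other coordinates fixed, [F x y] lies in the span of
   [1], [x i], [y i] and [x i * y i]. *)
Fixpoint biaffine (R : realType) n : (('I_n -> R) -> ('I_n -> R) -> R) -> Prop :=
  if n is n'.+1 then fun F => exists A B C E : ('I_n' -> R) -> ('I_n' -> R) -> R,
    [/\ biaffine A, biaffine B, biaffine C & biaffine E] /\
    forall x y, let x' := x \o lift ord0 in let y' := y \o lift ord0 in
      F x y = A x' y' + x ord0 * B x' y' + y ord0 * C x' y'
              + x ord0 * y ord0 * E x' y'
  else fun F => exists c, forall x y, F x y = c.

Section Biaffine.
Variable R : realType.

Lemma biaffine_cst n (c : R) : biaffine (fun _ _ : 'I_n -> R => c).
Proof.
elim: n c => [|n IH] c /=; first by exists c.
exists (fun _ _ => c), (fun _ _ => 0), (fun _ _ => 0), (fun _ _ => 0).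
by split=> // x y; ring.
Qed.

Lemma biaffineD n (F G : ('I_n -> R) -> ('I_n -> R) -> R) :
  biaffine F -> biaffine G -> biaffine (fun x y => F x y + G x y).
Proof.
elim: n F G => [|n IH] F G /=.
  by move=> [c Fc] [e Ge]; exists (c + e) => x y; rewrite Fc Ge.
move=> [A [B [C [E [[hA hB hC hE] FE]]]]] [A' [B' [C' [E' [[hA' hB' hC' hE'] GE]]]]].
exists (fun x y => A x y + A' x y), (fun x y => B x y + B' x y),
  (fun x y => C x y + C' x y), (fun x y => E x y + E' x y).
by split=> [|x y]; [split; exact: IH|rewrite FE GE; ring].
Qed.

Lemma biaffineZ n c (F : ('I_n -> R) -> ('I_n -> R) -> R) :
  biaffine F -> biaffine (fun x y => c * F x y).
Proof.
elim: n F => [|n IH] F /=.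
  by move=> [e Fe]; exists (c * e) => x y; rewrite Fe.
move=> [A [B [C [E [[hA hB hC hE] FE]]]]].
exists (fun x y => c * A x y), (fun x y => c * B x y),
  (fun x y => c * C x y), (fun x y => c * E x y).
by split=> [|x y]; [split; exact: IH|rewrite FE; ring].
Qed.

Lemma biaffine_sum n I (r : seq I) (F : I -> ('I_n -> R) -> ('I_n -> R) -> R) :
  (forall i, biaffine (F i)) -> biaffine (fun x y => \sum_(i <- r) F i x y).
Proof.
move=> hF; elim: r => [|i r IH].
  rewrite (_ : (fun x y => _) = fun _ _ => 0); first exact: biaffine_cst.
  by apply/funext => x; apply/funext => y; rewrite big_nil.
rewrite (_ : (fun x y => _) = fun x y => F i x y + \sum_(i <- r) F i x y).
  exact: biaffineD.
by apply/funext => x; apply/funext => y; rewrite big_cons.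
Qed.

Lemma biaffine_prod n (p q : 'I_n -> bool) :
  @biaffine R n (fun x y => \prod_(i < n) ((if p i then x i else 1) * (if q i then y i else 1))).
Proof.
elim: n p q => [|n IH] p q /=; first by exists 1 => x y; rewrite big_ord0.
pose F (x y : 'I_n -> R) := \prod_(i < n) ((if (p \o lift ord0) i then x i else 1) *
  (if (q \o lift ord0) i then y i else 1)).
have hF : biaffine F by exact: IH.
(* The first factor is one of 1, x_0, y_0, x_0 y_0, so just one of the four coefficients
   survives. *)
exists (fun x y => (~~ p ord0 && ~~ q ord0)%:R * F x y),
  (fun x y => (p ord0 && ~~ q ord0)%:R * F x y),
  (fun x y => (~~ p ord0 && q ord0)%:R * F x y),
  (fun x y => (p ord0 && q ord0)%:R * F x y).
split=> [|x y]; first by split; exact: biaffineZ.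
rewrite big_ord_recl -/(F (x \o lift ord0) (y \o lift ord0)).
by case: (p ord0); case: (q ord0) => /=; ring.
Qed.

(** The bilinear form [B] evaluated on the vectors of all square-free monomials in [x] and in
    [y]. *)
Definition polar n (B : {set 'I_n} -> {set 'I_n} -> R) (x y : 'I_n -> R) : R :=
  \sum_(S : {set 'I_n}) \sum_(S' : {set 'I_n})
    B S S' * (\prod_(i in S) x i * \prod_(i in S') y i).

Lemma biaffine_polar n B : biaffine (@polar n B).
Proof.
apply: biaffine_sum => S; apply: biaffine_sum => S'; apply: biaffineZ.
rewrite (_ : (fun x y => _) = fun x y : 'I_n -> R =>
   \prod_(i < n) ((if i \in S then x i else 1) * (if i \in S' then y i else 1))).
  exact: biaffine_prod.
by apply/funext => x; apply/funext => y; rewrite big_split -!big_mkcond.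
Qed.

Context d (T : measurableType d).
Variables (P : probability T R) (w : T -> R).
Hypothesis wP : weight P w.
Let w1 := weight_ge1 wP.

(** Each row of a matrix is read through one function of a row; with [U = lin u] and the rows of G
    this is the vector G u. *)
Definition rowf n (U : T -> R) (t : n.-tuple T) (i : 'I_n) : R := U (tnth t i).

Lemma rowf_cons0 n U (z : T * n.-tuple T) : rowf U (cons_pair z) ord0 = U z.1.
Proof. by []. Qed.

Lemma rowf_consS n U (z : T * n.-tuple T) : rowf U (cons_pair z) \o lift ord0 = rowf U z.2.
Proof. by apply/funext => i /=; rewrite /rowf tnth_cons_pairS. Qed.

Section Tame.
Variables U V : T -> R.
Hypotheses (tU : tame w U) (tV : tame w V).

Lemma tame_biaffine n F : @biaffine R n F ->
  tame (wpow w n) (fun t => F (rowf U t) (rowf V t)).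
Proof.
have tpow m : forall x, 1 <= wpow w m x := weight_ge1 (weight_pow wP m).
elim: n F => [|n IH] F /=.
  by move=> [c Fc]; under eq_fun do rewrite Fc; exact: tame_cst.
move=> [A [B [C [E [[hA hB hC hE] FE]]]]].
have tsh G : biaffine G -> tame (wpow w n.+1)
    (fun t => G (rowf U t \o lift ord0) (rowf V t \o lift ord0)).
  move=> /IH [mG [K [k [K0 GK]]]]; split.
    have -> : (fun t : n.+1.-tuple T => G (rowf U t \o lift ord0) (rowf V t \o lift ord0)) =
        (fun t => G (rowf U t) (rowf V t)) \o (fun t : n.+1.-tuple T => [tuple of behead t]).
      apply/funext => t /=; congr G; apply/funext => i /=; rewrite /rowf;
        by rewrite tnth_behead (_ : inord i.+1 = lift ord0 i)//;
          apply/val_inj; rewrite /= inordK// ltnS.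
    exact: (measurableT_comp mG (@measurable_behead _ T n)).
  exists K, k; split=> // t.
  have tE : t = cons_pair (thead t, [tuple of behead t]).
    by rewrite [LHS](tuple_eta t); apply/val_inj.
  rewrite tE !rowf_consS (le_trans (GK _))// ler_wpM2l// lerXn2r//.
  - by rewrite nnegrE (le_trans _ (tpow _ _)).
  - by rewrite nnegrE (le_trans _ (tpow _ _)).
  by rewrite wpow_cons /wprod /= ler_peMl// (le_trans _ (tpow _ _)).
under eq_fun do rewrite FE /=.
have t0 Z : tame w Z -> tame (wpow w n.+1) (fun t => rowf Z t ord0).
  by move=> tZ; exact: (tame_tnth wP ord0 tZ).
by repeat first [exact: tpow | exact: tsh | exact: t0 | apply: tameD | apply: tameM].
Qed.

End Tame.

(* Tensorization: a covariance inequality for one row, when stated with the sum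
   of the two variances, passes to products by the law of total covariance. *)
Lemma tensor_cov (s : R) (U V U' V' : T -> R) :
  tame w U -> tame w V -> tame w U' -> tame w V' -> 0 <= s ->
  (forall k a b c k' a' b' c',
    let f x := k + a * U x + b * V x + c * (U x * V x) in
    let f' x := k' + a' * U' x + b' * V' x + c' * (U' x * V' x) in
    2 * cov P f f' <= s * (cov P f f + cov P f' f')) ->
  forall n F F', @biaffine R n F -> @biaffine R n F' ->
    let f t := F (rowf U t) (rowf V t) in
    let f' t := F' (rowf U' t) (rowf V' t) in
    2 * cov (prob_pow P n) f f' <=
    s * (cov (prob_pow P n) f f + cov (prob_pow P n) f' f').
Proof.
move=> tU tV tU' tV' s0 row; elim=> [|n IH] F F'.
  move=> [c Fc] [c' Fc'] /=.
  have cst0 (e e' : R) : cov (prob_pow P 0) (fun=> e) (fun=> e') = 0.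
    by rewrite /cov !(mean_cst (prob_pow P 0)) subrr.
  do 2 under [in X in cov _ X _]eq_fun do rewrite ?Fc ?Fc'.
  have -> : (fun t => F (rowf U t) (rowf V t)) = (fun=> c) by apply/funext => t.
  have -> : (fun t => F' (rowf U' t) (rowf V' t)) = (fun=> c') by apply/funext => t.
  by rewrite !cst0 mulr0 addr0 mulr0.
move=> hF hF'; have [A [B [C [E [[hA hB hC hE] FE]]]]] := hF.
have [A' [B' [C' [E' [[hA' hB' hC' hE'] FE']]]]] := hF'.
pose f (t : n.+1.-tuple T) := F (rowf U t) (rowf V t).
pose f' (t : n.+1.-tuple T) := F' (rowf U' t) (rowf V' t).
change (2 * cov (prob_pow P n.+1) f f' <=
  s * (cov (prob_pow P n.+1) f f + cov (prob_pow P n.+1) f' f')).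
have tf : tame (wpow w n.+1) f by exact: tame_biaffine.
have tf' : tame (wpow w n.+1) f' by exact: tame_biaffine.
have wn := weight_pow wP n.
have wn1 := weight_ge1 (weight_pow wP n.+1).
pose Fx x := fun u v => A u v + U x * B u v + V x * C u v + U x * V x * E u v.
pose Fx' x := fun u v => A' u v + U' x * B' u v + V' x * C' u v + U' x * V' x * E' u v.
have hFx x : biaffine (Fx x) by do 3 (apply: biaffineD; last exact: biaffineZ).
have hFx' x : biaffine (Fx' x) by do 3 (apply: biaffineD; last exact: biaffineZ).
have fE x t : f (cons_pair (x, t)) = Fx x (rowf U t) (rowf V t).
  by rewrite /f FE /= !rowf_consS !rowf_cons0.
have fE' x t : f' (cons_pair (x, t)) = Fx' x (rowf U' t) (rowf V' t).
  by rewrite /f' FE' /= !rowf_consS !rowf_cons0.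
pose En g := fun x => mean (prob_pow P n) (fun t => g (cons_pair (x, t))).
have tEn g : tame (wpow w n.+1) g -> tame w (En g).
  by move=> tg; exact: (tame_mean2 wP wn (tame_cons tg)).
have EnE g : tame (wpow w n.+1) g -> mean (prob_pow P n.+1) g = mean P (En g).
  by move=> tg; rewrite (mean_powS wP tg).
have tff : tame (wpow w n.+1) (fun t => f t * f t) by exact: tameM.
have tff' : tame (wpow w n.+1) (fun t => f t * f' t) by exact: tameM.
have tf'f' : tame (wpow w n.+1) (fun t => f' t * f' t) by exact: tameM.
(* Averaged over the other rows, a biaffine function is k + a U + b V + c U V in the first row, the
   shape to which the one-row hypothesis applies. *)
have affE X Y (tX : tame w X) (tY : tame w Y) (G H K L : ('I_n -> R) -> ('I_n -> R) -> R) :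
    biaffine G -> biaffine H -> biaffine K -> biaffine L ->
    (fun x => mean (prob_pow P n) (fun t => G (rowf X t) (rowf Y t)
      + X x * H (rowf X t) (rowf Y t) + Y x * K (rowf X t) (rowf Y t)
      + X x * Y x * L (rowf X t) (rowf Y t))) =
    (fun x => mean (prob_pow P n) (fun t => G (rowf X t) (rowf Y t))
      + mean (prob_pow P n) (fun t => H (rowf X t) (rowf Y t)) * X x
      + mean (prob_pow P n) (fun t => K (rowf X t) (rowf Y t)) * Y x
      + mean (prob_pow P n) (fun t => L (rowf X t) (rowf Y t)) * (X x * Y x)).
  move=> bG bH bK bL; apply/funext => x.
  have wn1' := weight_ge1 wn.
  have tG Z : biaffine Z -> tame (wpow w n) (fun t => Z (rowf X t) (rowf Y t)).
    exact: tame_biaffine.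
  have tbG := tG _ bG; have tbH := tG _ bH; have tbK := tG _ bK; have tbL := tG _ bL.
  rewrite !(meanD wn); try by repeat first [exact: wn1' | assumption | apply: tameD | apply: tameZ].
  by rewrite !(meanZ wn)//; ring.
have EnfE := affE _ _ tU tV _ _ _ _ hA hB hC hE.
have Enf'E := affE _ _ tU' tV' _ _ _ _ hA' hB' hC' hE'.
have Enf : En f = (fun x => mean (prob_pow P n) (fun t => Fx x (rowf U t) (rowf V t))).
  by apply/funext => x; congr mean; apply/funext => t; exact: fE.
have Enf' : En f' = (fun x => mean (prob_pow P n) (fun t => Fx' x (rowf U' t) (rowf V' t))).
  by apply/funext => x; congr mean; apply/funext => t; exact: fE'.
have rowE := row _ _ _ _ _ _ _ _; move: rowE.
move=> /(_ (mean (prob_pow P n) (fun t => A (rowf U t) (rowf V t)))).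
move=> /(_ (mean (prob_pow P n) (fun t => B (rowf U t) (rowf V t)))).
move=> /(_ (mean (prob_pow P n) (fun t => C (rowf U t) (rowf V t)))).
move=> /(_ (mean (prob_pow P n) (fun t => E (rowf U t) (rowf V t)))).
move=> /(_ (mean (prob_pow P n) (fun t => A' (rowf U' t) (rowf V' t)))).
move=> /(_ (mean (prob_pow P n) (fun t => B' (rowf U' t) (rowf V' t)))).
move=> /(_ (mean (prob_pow P n) (fun t => C' (rowf U' t) (rowf V' t)))).
move=> /(_ (mean (prob_pow P n) (fun t => E' (rowf U' t) (rowf V' t)))).
cbv zeta; rewrite -EnfE -Enf'E -Enf -Enf' => rowE.
(* With the first row fixed, the function stays biaffine in the others and the induction hypothesis
   bounds the conditional covariance. *)
have sect x : 2 * (En (fun t => f t * f' t) x - En f x * En f' x) <=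
    s * (En (fun t => f t * f t) x - En f x * En f x +
         (En (fun t => f' t * f' t) x - En f' x * En f' x)).
  have e : (fun t => Fx x (rowf U t) (rowf V t)) = (fun t => f (cons_pair (x, t))).
    by apply/funext => t; rewrite fE.
  have e' : (fun t => Fx' x (rowf U' t) (rowf V' t)) = (fun t => f' (cons_pair (x, t))).
    by apply/funext => t; rewrite fE'.
  by have := IH _ _ (hFx x) (hFx' x); cbv zeta; rewrite e e'.
have tm1 := tEn _ tff; have tm2 := tEn _ tff'; have tm3 := tEn _ tf'f'.
have tm4 := tEn _ tf; have tm5 := tEn _ tf'.
have tmul X Y : tame w X -> tame w Y -> tame w (fun x => X x * Y x) by exact: tameM.
(* Total covariance: the mean of the conditional covariances, bounded here, plus the covariance of
   the conditional means, bounded by [rowE]. *)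
have := @mean_cov_le _ _ _ P w wP s (En (fun t => f t * f' t))
  (fun x => En f x * En f' x) (En (fun t => f t * f t)) (fun x => En f x * En f x)
  (En (fun t => f' t * f' t)) (fun x => En f' x * En f' x)
  tm2 (tmul _ _ tm4 tm5) tm1 (tmul _ _ tm4 tm4) tm3 (tmul _ _ tm5 tm5) sect.
move: rowE; rewrite /cov !EnE//.
set e1 := mean P (En (fun t => f t * f' t)); set e2 := mean P (En (fun t => f t * f t)).
set e3 := mean P (En (fun t => f' t * f' t)).
set e4 := mean P (fun x => En f x * En f' x); set e5 := mean P (fun x => En f x * En f x).
set e6 := mean P (fun x => En f' x * En f' x).
move: (mean P (En f) * _) (mean P (En f) * _) (mean P (En f') * _).
clear; move: e1 e2 e3 e4 e5 e6 => e1 e2 e3 e4 e5 e6 m1 m2 m3 h1 h2; lra.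
Qed.

End Biaffine.

Section RowCovariance.
Variables (R : realType) (D : nat).
Notation gn := (gaussn R D).
Notation vec := ('I_D -> R).
Implicit Types u v x y : vec.
Let wn := @weight_gaussn R D.
Let w1 := weight_ge1 wn.

Definition quadf u v (k a b c : R) (g : gvec R D) : R :=
  k + a * lin u g + b * lin v g + c * (lin u g * lin v g).

Ltac tame_lins := repeat first
  [ exact: tame_cst | exact: tame_lin | exact: w1 | apply: tameD | apply: tameM ].

Lemma tame_quadf u v k a b c : tame (wpow (@gweight R) D) (quadf u v k a b c).
Proof. by rewrite /quadf; tame_lins. Qed.

Lemma mean_quadf u v k a b c : mean gn (quadf u v k a b c) = k + c * dotp u v.
Proof.
rewrite /quadf !(meanD wn); [|tame_lins..].
rewrite !(meanZ wn); [|tame_lins..].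
by rewrite (mean_cst gn) !mean_lin mean_lin2; ring.
Qed.

(** By parity the linear and the bilinear parts are uncorrelated. Of the three pairings of the
    bilinear parts, the one pairing each part with itself cancels against the product of the
    means. *)
Lemma cov_quadf u v u' v' k a b c k' a' b' c' :
  cov gn (quadf u v k a b c) (quadf u' v' k' a' b' c') =
  a * a' * dotp u u' + a * b' * dotp u v' + b * a' * dotp v u' + b * b' * dotp v v'
  + c * c' * (dotp u u' * dotp v v' + dotp u v' * dotp v u').
Proof.
rewrite /cov !mean_quadf.
have -> : (fun g => quadf u v k a b c g * quadf u' v' k' a' b' c' g) =
  (fun g => (k * k' + (k * a' * lin u' g + k * b' * lin v' g + k' * a * lin u g
      + k' * b * lin v g))
    + (a * a' * (lin u g * lin u' g) + a * b' * (lin u g * lin v' g)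
      + b * a' * (lin v g * lin u' g) + b * b' * (lin v g * lin v' g)
      + k * c' * (lin u' g * lin v' g) + k' * c * (lin u g * lin v g))
    + (a * c' * (lin u g * lin u' g * lin v' g) + b * c' * (lin v g * lin u' g * lin v' g)
      + c * a' * (lin u g * lin v g * lin u' g) + c * b' * (lin u g * lin v g * lin v' g))
    + c * c' * (lin u g * lin v g * (lin u' g * lin v' g))).
  by apply/funext => g; rewrite /quadf; ring.
rewrite !(meanD wn); [|tame_lins..].
rewrite !(meanZ wn); [|tame_lins..].
by rewrite (mean_cst gn) !mean_lin !mean_lin2 !mean_lin3 mean_lin4; ring.
Qed.

(** For s >= 1 this is AM-GM on the covariance. For s < 1 the linear parts are the hypothesis
    itself; in the bilinear parts the four inner products are at most t <= 1/2 in absolute value, so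
    the covariance coefficient is at most 2 t^2 <= t, while u, v being unit vectors makes each
    variance at least c^2. *)
Lemma row_cov_le (s t : R) u v u' v' :
  1 <= s \/
  [/\ dotp u u = 1 /\ dotp v v = 1, dotp u' u' = 1 /\ dotp v' v' = 1, 0 <= t, 2 * t <= s &
    forall a b a' b',
      2 * (a * a' * dotp u u' + a * b' * dotp u v' + b * a' * dotp v u'
           + b * b' * dotp v v') <=
      t * (a ^+ 2 * dotp u u + 2 * a * b * dotp u v + b ^+ 2 * dotp v v +
           (a' ^+ 2 * dotp u' u' + 2 * a' * b' * dotp u' v' + b' ^+ 2 * dotp v' v'))] ->
  forall k a b c k' a' b' c',
    let f := quadf u v k a b c in let f' := quadf u' v' k' a' b' c' in
    2 * cov gn f f' <= s * (cov gn f f + cov gn f' f').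
Proof.
move=> H k a b c k' a' b' c' /=.
have cov0 x y e0 e1 e2 e3 : 0 <= cov gn (quadf x y e0 e1 e2 e3) (quadf x y e0 e1 e2 e3).
  rewrite /cov subr_ge0 -!expr2; have := tame_mean_sqr_le wn (tame_quadf x y e0 e1 e2 e3).
  by under eq_fun do rewrite expr2.
have c1 := cov0 u v k a b c; have c2 := cov0 u' v' k' a' b' c'.
have [s1|s1] := leP 1 s.
  apply: le_trans (cov_sum_le_half wn (tame_quadf _ _ _ _ _ _) (tame_quadf _ _ _ _ _ _)) _.
  by rewrite -[leLHS]mul1r ler_wpM2r// addr_ge0.
case: H => [|[[u1 v1] [u1' v1'] t0 ts H]]; first by rewrite leNgt s1.
have t1 : t <= 1 / 2 by lra.
(* Coordinate vectors with both signs bound each of the four inner products by t in absolute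
   value. *)
have Huu := H 1 0 1 0; have Huu' := H 1 0 (-1) 0.
have Huv := H 1 0 0 1; have Huv' := H 1 0 0 (-1).
have Hvu := H 0 1 1 0; have Hvu' := H 0 1 (-1) 0.
have Hvv := H 0 1 0 1; have Hvv' := H 0 1 0 (-1).
(* Added to [H], the cross terms cancel and the linear variances on the right are seen to be
   nonnegative, which permits doubling t. *)
have HN := H a b (- a') (- b'); have {}H := H a b a' b'.
apply: (@le_trans _ _ (2 * t * (cov gn (quadf u v k a b c) (quadf u v k a b c) +
   cov gn (quadf u' v' k' a' b' c') (quadf u' v' k' a' b' c')))); last first.
  by rewrite ler_wpM2r// addr_ge0.
rewrite !cov_quadf u1 v1 u1' v1' (dotpC v u) (dotpC v' u').
move: Huu Huu' Huv Huv' Hvu Hvu' Hvv Hvv' H HN; rewrite !u1 !v1 !u1' !v1'.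
move: (dotp u u') (dotp u v') (dotp v u') (dotp v v') (dotp u v) (dotp u' v')
  => uu uv vu vv e e'.
clear -t0 t1 => Huu Huu' Huv Huv' Hvu Hvu' Hvv Hvv' H HN.
have auu : `|uu| <= t by rewrite ler_norml; apply/andP; split; lra.
have auv : `|uv| <= t by rewrite ler_norml; apply/andP; split; lra.
have avu : `|vu| <= t by rewrite ler_norml; apply/andP; split; lra.
have avv : `|vv| <= t by rewrite ler_norml; apply/andP; split; lra.
have q : 2 * (c * c' * (uu * vv + uv * vu)) <= 2 * t * (c ^+ 2 + c' ^+ 2).
  apply: le_trans (ler_norm _) _.
  have n2 : `|uu * vv + uv * vu| <= t.
    rewrite (le_trans (ler_normD _ _))// !normrM.
    have p1 : `|uu| * `|vv| <= t * t by rewrite ler_pM.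
    have p2 : `|uv| * `|vu| <= t * t by rewrite ler_pM.
    nra.
  rewrite normrM [`|2|]ger0_norm// normrM mulrA.
  have n3 : 2 * `|c * c'| <= c ^+ 2 + c' ^+ 2.
    rewrite normrM -(real_normK (num_real c)) -(real_normK (num_real c')).
    by have := sqr_ge0 (`|c| - `|c'|); lra.
  apply: (@le_trans _ _ ((c ^+ 2 + c' ^+ 2) * t)); first by rewrite ler_pM// mulr_ge0.
  have := sqr_ge0 c; have := sqr_ge0 c'; nra.
have E1 : 0 <= 2 * t * (c * c * (1 * 1 + e * e)) - 2 * t * c ^+ 2.
  have := sqr_ge0 (c * e); nra.
have E2 : 0 <= 2 * t * (c' * c' * (1 * 1 + e' * e')) - 2 * t * c' ^+ 2.
  have := sqr_ge0 (c' * e'); nra.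
lra.
Qed.
End RowCovariance.

(** * Overlap of two planes in terms of Gram matrices *)

Section GramBounds.
Variable R : realType.

Let eqW (x y : R) : x = y -> x <= y. Proof. by move=> ->. Qed.

(** The bilinear form is bounded by the Frobenius norm sqrt q of its matrix, and the Euclidean norms
    by 2/d times the Gram forms. AM-GM with parameter l then replaces sqrt q by a polynomial in q,
    whose Gaussian mean can be computed. *)
Lemma bilin4_le (A B A' B' T1 T2 T3 T4 d l G G' : R) : 0 < d -> 0 < l ->
  d / 2 * (A ^+ 2 + B ^+ 2) <= G -> d / 2 * (A' ^+ 2 + B' ^+ 2) <= G' ->
  let q := T1 ^+ 2 + T2 ^+ 2 + T3 ^+ 2 + T4 ^+ 2 in
  2 * (A * A' * T1 + A * B' * T2 + B * A' * T3 + B * B' * T4) <=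
  (l * q / d ^+ 2 + l^-1) * (G + G').
Proof.
move=> d0 l0 hG hG' /=; set q := T1 ^+ 2 + T2 ^+ 2 + T3 ^+ 2 + T4 ^+ 2.
set L := A * A' * T1 + A * B' * T2 + B * A' * T3 + B * B' * T4.
set e := A ^+ 2 + B ^+ 2; set e' := A' ^+ 2 + B' ^+ 2.
have e0 : 0 <= e by rewrite addr_ge0 ?sqr_ge0.
have e0' : 0 <= e' by rewrite addr_ge0 ?sqr_ge0.
have q0 : 0 <= q by rewrite !addr_ge0 ?sqr_ge0.
have Lq : L ^+ 2 <= q * (e * e').
  (* Lagrange's identity for the four products of coordinates. *)
  rewrite -subr_ge0 (_ : _ - _ =
    (T1 * (A * B') - T2 * (A * A')) ^+ 2 + (T1 * (B * A') - T3 * (A * A')) ^+ 2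
    + (T1 * (B * B') - T4 * (A * A')) ^+ 2 + (T2 * (B * A') - T3 * (A * B')) ^+ 2
    + (T2 * (B * B') - T4 * (A * B')) ^+ 2 + (T3 * (B * B') - T4 * (B * A')) ^+ 2).
    by rewrite !addr_ge0 ?sqr_ge0.
  by rewrite /L /q /e /e'; ring.
pose tau := Num.sqrt q.
have tau0 : 0 <= tau by exact: sqrtr_ge0.
have tauE : tau ^+ 2 = q by rewrite sqr_sqrtr.
have L2 : 2 * L <= tau * (e + e').
  apply: le_trans (ler_norm _) _.
  have te : 0 <= tau * (e + e') by rewrite mulr_ge0// addr_ge0.
  rewrite -(@ler_pXn2r _ 2)// ?nnegrE//.
  rewrite real_normK ?num_real// exprMn.
  apply: (@le_trans _ _ (2 ^+ 2 * (q * (e * e')))).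
    by rewrite ler_wpM2l// sqr_ge0.
  rewrite exprMn tauE mulrCA ler_wpM2l//.
  by have := sqr_ge0 (e - e'); lra.
apply: le_trans L2 _.
have tq : tau * (2 / d) <= l * q / d ^+ 2 + l^-1.
  rewrite -tauE -subr_ge0 (_ : _ - _ = l * (tau / d - l^-1) ^+ 2).
    by rewrite mulr_ge0 ?sqr_ge0// ltW.
  by field; rewrite !gt_eqF.
apply: (@le_trans _ _ (tau * (2 / d) * (G + G'))).
  have -> : tau * (e + e') = tau * (2 / d) * (d / 2 * e + d / 2 * e').
    by field; rewrite gt_eqF.
  by rewrite ler_wpM2l ?lerD// mulr_ge0// divr_ge0// ltW.
rewrite ler_wpM2r//; apply: addr_ge0.
  by apply: le_trans hG; rewrite mulr_ge0// divr_ge0// ltW.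
by apply: le_trans hG'; rewrite mulr_ge0// divr_ge0// ltW.
Qed.

(** The Gram matrix divided by d differs from the identity by at most 1/2 in Frobenius norm, so its
    least eigenvalue is at least 1/2. *)
Lemma gram_lower (d X Xt r a b : R) : 0 < d ->
  (X / d - 1) ^+ 2 + (Xt / d - 1) ^+ 2 + 2 * (r / d) ^+ 2 <= 1 / 4 ->
  d / 2 * (a ^+ 2 + b ^+ 2) <= a ^+ 2 * X + 2 * a * b * r + b ^+ 2 * Xt.
Proof.
move=> d0; set p := X / d - 1; set pt := Xt / d - 1; set s := r / d => H.
have XE : X = d * (1 + p) by rewrite /p; field; rewrite gt_eqF.
have XtE : Xt = d * (1 + pt) by rewrite /pt; field; rewrite gt_eqF.
have rE : r = d * s by rewrite /s; field; rewrite gt_eqF.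
rewrite XE XtE rE.
have -> : a ^+ 2 * (d * (1 + p)) + 2 * a * b * (d * s) + b ^+ 2 * (d * (1 + pt)) =
  d * (a ^+ 2 * (1 + p) + 2 * a * b * s + b ^+ 2 * (1 + pt)) by ring.
rewrite -mulrA ler_pM2l// -subr_ge0.
set e := a ^+ 2 + b ^+ 2.
have e0 : 0 <= e by rewrite addr_ge0 ?sqr_ge0.
set Q := a ^+ 2 * p + 2 * a * b * s + b ^+ 2 * pt.
have -> : a ^+ 2 * (1 + p) + 2 * a * b * s + b ^+ 2 * (1 + pt) - 2^-1 * e = e / 2 + Q.
  by rewrite /Q /e; field.
have Q2 : Q ^+ 2 <= (e / 2) ^+ 2.
  apply: (@le_trans _ _ (e ^+ 2 * (p ^+ 2 + pt ^+ 2 + 2 * s ^+ 2))).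
    rewrite -subr_ge0 (_ : _ - _ = 2 * (a ^+ 2 * s - a * b * p) ^+ 2 +
      (a ^+ 2 * pt - b ^+ 2 * p) ^+ 2 + 2 * (a * b * pt - b ^+ 2 * s) ^+ 2); last first.
      by rewrite /Q /e; ring.
    by repeat first [exact: sqr_ge0 | apply: addr_ge0 | apply: mulr_ge0; first by []].
  rewrite [(e / 2) ^+ 2](_ : _ = e ^+ 2 * (1 / 4)); last by field.
  by rewrite ler_wpM2l ?sqr_ge0.
have : `|Q| <= e / 2.
  by rewrite -(@ler_pXn2r _ 2)// ?nnegrE ?divr_ge0// real_normK ?num_real.
by rewrite ler_norml => /andP[+ _]; lra.
Qed.

Section Vectors.
Variable D : nat.
Implicit Types u v x y : 'I_D -> R.

Definition scalev (c : R) x : 'I_D -> R := fun j => x j * c.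
Definition combv (a b : R) x y : 'I_D -> R := fun j => a * x j + b * y j.
(** At x = 0 the convention 0^-1 = 0 gives the zero vector, in agreement with [sketch]; hence norms
    of directions are at most 1, not always equal to 1. *)
Definition unitv x : 'I_D -> R := scalev (Num.sqrt (dotp x x))^-1 x.

Lemma dotp_scalel c x y : dotp (scalev c x) y = c * dotp x y.
Proof. by rewrite /dotp mulr_sumr; apply: eq_bigr => j _; rewrite /scalev; ring. Qed.

Lemma dotp_scaler c x y : dotp x (scalev c y) = c * dotp x y.
Proof. by rewrite dotpC dotp_scalel dotpC. Qed.

Lemma dotp_combl a b x y u : dotp (combv a b x y) u = a * dotp x u + b * dotp y u.
Proof.
rewrite /dotp !mulr_sumr -big_split; apply: eq_bigr => j _ /=.
by rewrite /combv; ring.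
Qed.

Lemma dotp_combr a b x y u : dotp u (combv a b x y) = a * dotp u x + b * dotp u y.
Proof. by rewrite dotpC dotp_combl !(dotpC _ u). Qed.

Lemma dotp_unitv x : 0 < dotp x x -> dotp (unitv x) (unitv x) = 1.
Proof.
move=> x0; rewrite /unitv dotp_scalel dotp_scaler mulrA -expr2 exprVn.
by rewrite sqr_sqrtr ?ltW// mulVf// gt_eqF.
Qed.

Lemma dotp_unitv_le1 x : dotp (unitv x) (unitv x) <= 1.
Proof.
have [x0|x0] := ltP 0 (dotp x x); first by rewrite dotp_unitv.
have x00 : dotp x x = 0 by apply/eqP; rewrite eq_le x0 dotp_ge0.
by rewrite /unitv dotp_scalel dotp_scaler x00 !mulr0.
Qed.

(* [rowcorr] bounds the correlation between two functions of a Gaussian row, one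
   read along the span of [x, y] and the other along the span of [x', y']. It is
   a polynomial, so that its mean over Gaussian [x, y, x', y'] can be computed:
   the terms in [gramdev] make the bound trivial unless the Gram matrices of
   [x, y] and [x', y'] are close to [D] times the identity. *)
Definition gramdev x y : R :=
  (dotp x x / D%:R - 1) ^+ 2 + (dotp y y / D%:R - 1) ^+ 2 + 2 * (dotp x y / D%:R) ^+ 2.

Definition crossdev x y x' y' : R :=
  dotp x x' ^+ 2 + dotp x y' ^+ 2 + dotp y x' ^+ 2 + dotp y y' ^+ 2.

Definition rowcorr x y x' y' : R :=
  2 * (Num.sqrt D%:R * crossdev x y x' y' / D%:R ^+ 2 + (Num.sqrt D%:R)^-1)
  + 4 * gramdev x y + 4 * gramdev x' y'.

Lemma gramdev_ge0 x y : 0 <= gramdev x y.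
Proof.
by repeat first [exact: sqr_ge0 | apply: addr_ge0 | apply: mulr_ge0; first by []].
Qed.

Lemma crossdev_ge0 x y x' y' : 0 <= crossdev x y x' y'.
Proof. by rewrite !addr_ge0 ?sqr_ge0. Qed.

Lemma rowcorr_ge0 x y x' y' : 0 <= rowcorr x y x' y'.
Proof.
have g := gramdev_ge0 x y; have g' := gramdev_ge0 x' y'.
have h : 0 <= Num.sqrt D%:R * crossdev x y x' y' / D%:R ^+ 2 + (Num.sqrt D%:R)^-1.
  rewrite addr_ge0 ?invr_ge0 ?sqrtr_ge0// mulr_ge0 ?invr_ge0 ?exprn_ge0//.
  by rewrite mulr_ge0 ?sqrtr_ge0 ?crossdev_ge0.
rewrite /rowcorr; lra.
Qed.

(** The linear parts live in the spans of x, y and of x', y'. Written in these coordinates, they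
    fall under [bilin4_le] with d = D and l = sqrt D, the Gram forms being bounded below by
    [gram_lower]. *)
Lemma row_cov_rowcorr (rho : R) x y x' y' : (0 < D)%N -> 0 <= rho <= 1 ->
  let rot a b := combv rho (Num.sqrt (1 - rho ^+ 2)) a b in
  forall k a b c k' a' b' c',
    let f := quadf (unitv x) (unitv (rot x y)) k a b c in
    let f' := quadf (unitv x') (unitv (rot x' y')) k' a' b' c' in
    2 * cov (gaussn R D) f f' <= rowcorr x y x' y' *
      (cov (gaussn R D) f f + cov (gaussn R D) f' f').
Proof.
move=> D0 /andP[r0 r1] rot; set sg := Num.sqrt (1 - rho ^+ 2).
have sg2 : sg ^+ 2 = 1 - rho ^+ 2.
  by rewrite sqr_sqrtr// subr_ge0 -[1](expr1n _ 2) lerXn2r ?nnegrE.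
have d0 : 0 < D%:R :> R by rewrite ltr0n.
pose l := Num.sqrt D%:R : R; have l0 : 0 < l by rewrite sqrtr_gt0.
pose t := l * crossdev x y x' y' / D%:R ^+ 2 + l^-1.
have t0 : 0 <= t.
  rewrite addr_ge0 ?invr_ge0 ?sqrtr_ge0// mulr_ge0 ?invr_ge0 ?exprn_ge0//.
  by rewrite mulr_ge0 ?sqrtr_ge0 ?crossdev_ge0.
apply: (@row_cov_le R D (rowcorr x y x' y') t).
have g0 := gramdev_ge0 x y; have g0' := gramdev_ge0 x' y'.
have sE : rowcorr x y x' y' = 2 * t + 4 * gramdev x y + 4 * gramdev x' y' by [].
(* The factors 4 in [rowcorr] are chosen for this: below 1, both Gram deviations are below 1/4. *)
have [s1|s1] := leP 1 (rowcorr x y x' y'); [by left|right].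
have h : gramdev x y <= 1 / 4 by lra.
have h' : gramdev x' y' <= 1 / 4 by lra.
have lo a b := gram_lower a b d0 h; have lo' a b := gram_lower a b d0 h'.
have xx : 0 < dotp x x by have := lo 1 0; nra.
have xx' : 0 < dotp x' x' by have := lo' 1 0; nra.
have rotE a b : dotp (rot a b) (rot a b) =
    rho ^+ 2 * dotp a a + 2 * rho * sg * dotp a b + sg ^+ 2 * dotp b b.
  by rewrite /rot -/sg dotp_combl !dotp_combr (dotpC b a); ring.
have yy : 0 < dotp (rot x y) (rot x y).
  by rewrite rotE; have := lo rho sg; rewrite sg2; nra.
have yy' : 0 < dotp (rot x' y') (rot x' y').
  by rewrite rotE; have := lo' rho sg; rewrite sg2; nra.
split; [by rewrite !dotp_unitv|by rewrite !dotp_unitv|exact: t0|lra|].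
move=> a b a' b'.
pose i := (Num.sqrt (dotp x x))^-1; pose j := (Num.sqrt (dotp (rot x y) (rot x y)))^-1.
pose i' := (Num.sqrt (dotp x' x'))^-1; pose j' := (Num.sqrt (dotp (rot x' y') (rot x' y')))^-1.
(* a u + b v has coordinates a i + b j rho along x and b j sg along y. *)
have := bilin4_le (dotp x x') (dotp x y') (dotp y x') (dotp y y') d0 l0
  (lo (a * i + b * j * rho) (b * j * sg)) (lo' (a' * i' + b' * j' * rho) (b' * j' * sg)).
rewrite /unitv -/i -/j -/i' -/j' /= -/(crossdev x y x' y') -/t.
clearbody i j i' j' t; rewrite /rot -/sg.
rewrite !(dotp_scalel, dotp_scaler, dotp_combl, dotp_combr) (dotpC y x) (dotpC y' x').
move: (dotp x x) (dotp x y) (dotp y y) (dotp x' x') (dotp x' y') (dotp y' y').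
move: (dotp x x') (dotp x y') (dotp y x') (dotp y y')
  => t1 t2 t3 t4 g1 g2 g3 g4 g5 g6 H.
 apply: (le_trans _ (le_trans H _)); apply/eqW; ring.
Qed.

End Vectors.
End GramBounds.

Section PowerSums.
Context d (T : measurableType d) (R : realType).
Variables (P : probability T R) (w : T -> R).
Hypothesis wP : weight P w.

Lemma tame_sum_tnth n (F : 'I_n -> T -> R) : (forall j, tame w (F j)) ->
  tame (wpow w n) (fun t => \sum_j F j (tnth t j)).
Proof.
move=> tF; apply: tame_sum => [|j _]; first exact: (weight_ge1 (weight_pow wP n)).
exact: (tame_tnth wP j (tF j)).
Qed.

(** The summands are independent and centred, so the cross terms vanish. *)
Lemma mean_sqr_sum_tnth n (F : 'I_n -> T -> R) : (forall j, tame w (F j)) ->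
  (forall j, mean P (F j) = 0) ->
  mean (prob_pow P n) (fun t => (\sum_j F j (tnth t j)) ^+ 2) =
  \sum_j mean P (fun x => F j x ^+ 2).
Proof.
elim: n F => [|n IH] F tF F0.
  under eq_fun do rewrite big_ord0.
  by rewrite big_ord0 expr0n; exact: (mean_cst (prob_pow P 0) 0).
have wn := weight_pow wP n; have w1 := weight_ge1 wP; have wn1 := weight_ge1 wn.
rewrite (mean_powS wP); last by apply: tameX; exact: tame_sum_tnth.
pose S (t : n.-tuple T) := \sum_j F (lift ord0 j) (tnth t j).
have tS : tame (wpow w n) S.
  by apply: (tame_sum_tnth (F := fun j => F (lift ord0 j))) => j; exact: tF.
have tS2 : tame (wpow w n) (fun t => S t ^+ 2) by exact: tameX.
have E x : mean (prob_pow P n) (fun t => (\sum_j F j (tnth (cons_pair (x, t)) j)) ^+ 2) =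
    F ord0 x ^+ 2 + (2 * mean (prob_pow P n) S) * F ord0 x
    + mean (prob_pow P n) (fun t => S t ^+ 2).
  have -> : (fun t => (\sum_j F j (tnth (cons_pair (x, t)) j)) ^+ 2) =
      (fun t => F ord0 x ^+ 2 + (2 * F ord0 x) * S t + S t ^+ 2).
    apply/funext => t; rewrite big_ord_recl tnth_cons_pair0 /=.
    under eq_bigr do rewrite tnth_cons_pairS /=.
    by rewrite -/(S t); ring.
  have tc : tame (wpow w n) (fun=> F ord0 x ^+ 2) by exact: tame_cst.
  have tz : tame (wpow w n) (fun t => 2 * F ord0 x * S t) by exact: tameZ.
  rewrite (meanD wn (tameD wn1 tc tz) tS2) (meanD wn tc tz) (meanZ wn _ tS).
  by rewrite (mean_cst (prob_pow P n)); ring.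
under eq_fun do rewrite E.
have t2 : tame w (fun x => F ord0 x ^+ 2) by exact: tameX.
have t1 : tame w (fun x => (2 * mean (prob_pow P n) S) * F ord0 x) by exact: tameZ.
have tc : tame w (fun=> mean (prob_pow P n) (fun t => S t ^+ 2)) by exact: tame_cst.
rewrite (meanD wP (tameD w1 t2 t1) tc) (meanD wP t2 t1) (meanZ wP)// F0 mulr0 addr0 (mean_cst P) big_ord_recl; congr (_ + _).
by apply: IH => j.
Qed.

End PowerSums.

(** * Moments of inner products of Gaussian pairs *)

Section GaussianPairs.
Variable R : realType.
Notation gauss := (gauss_prob R).
Notation gw := (@gweight R).
Let wg : weight gauss gw := weight_gauss R.

(** The two entries are independent; the covariance [rho] enters later by mixing them with
    [combv rho (Num.sqrt (1 - rho ^+ 2))]. *)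
Definition gpair : probability (measurableTypeR R * measurableTypeR R)%type R :=
  (gauss \x gauss)%E.
Definition gpairw := wprod gw gw.

Lemma weight_gpair : weight gpair gpairw. Proof. exact: weight_prod. Qed.

Definition gpairn D := prob_pow gpair D.

Lemma weight_gpairn D : weight (gpairn D) (wpow gpairw D).
Proof. exact: (weight_pow weight_gpair D). Qed.

Definition fstv D (z : gpairs R D) : 'I_D -> R := fun j => (tnth z j).1.
Definition sndv D (z : gpairs R D) : 'I_D -> R := fun j => (tnth z j).2.

Lemma tame_gpair1 : tame gpairw (fun z => z.1 : R).
Proof. exact: (tame_fst wg wg (tame_gauss_id R)). Qed.

Lemma tame_gpair2 : tame gpairw (fun z => z.2 : R).
Proof. exact: (tame_snd wg wg (tame_gauss_id R)). Qed.

Lemma tame_fstv D j : tame (wpow gpairw D) (fun z => fstv z j).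
Proof. exact: (tame_tnth weight_gpair j tame_gpair1). Qed.

Lemma tame_sndv D j : tame (wpow gpairw D) (fun z => sndv z j).
Proof. exact: (tame_tnth weight_gpair j tame_gpair2). Qed.

Let wp := weight_gpair.
Let wp1 := weight_ge1 wp.
Let wD1 D := weight_ge1 (weight_gpairn D).

Ltac tame_tac := repeat first [ exact: tame_cst | exact: tame_gpair1 | exact: tame_gpair2
  | exact: tame_fstv | exact: tame_sndv | exact: wp1 | exact: wD1 | assumption
  | apply: tameX | apply: tameB | apply: tameD | apply: tameM
  | apply: tame_sum => [|? ?] ].

Lemma tame_dotp D (X Y : gpairs R D -> 'I_D -> R) :
  (forall j, tame (wpow gpairw D) (fun z => X z j)) ->
  (forall j, tame (wpow gpairw D) (fun z => Y z j)) ->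
  tame (wpow gpairw D) (fun z => dotp (X z) (Y z)).
Proof. by move=> tX tY; apply: tame_sum => [|j _]; [exact: wD1|exact: tameM]. Qed.

Lemma mean_gpair_fst f : tame gw f -> mean gpair (fun z => f z.1) = mean gauss f.
Proof.
move=> tf; rewrite (mean_prod wg wg (tame_fst wg wg tf)) /=.
by congr mean; apply/funext => x; rewrite (mean_cst gauss).
Qed.

Lemma mean_gpair_snd f : tame gw f -> mean gpair (fun z => f z.2) = mean gauss f.
Proof.
move=> tf; rewrite (mean_prod wg wg (tame_snd wg wg tf)) /=.
by rewrite (mean_cst gauss).
Qed.

Lemma mean_gpair_mul f g : tame gw f -> tame gw g ->
  mean gpair (fun z => f z.1 * g z.2) = mean gauss f * mean gauss g.
Proof.
move=> tf tg; have t1 := tame_fst wg wg tf; have t2 := tame_snd wg wg tg.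
rewrite (mean_prod wg wg (tameM t1 t2)) /=.
by under eq_fun do rewrite (meanZ wg _ tg); rewrite (meanZr wg _ tf).
Qed.

Let tid := tame_gauss_id R.
Let tX n := @tame_gaussX R n.
Let mean1 : mean gauss (fun x => x : R) = 0 := @gauss_moment_odd R 1 erefl.

Lemma mean_sqr_sub1 : mean gauss (fun x => ((x : R) ^+ 2 - 1) ^+ 2) = 2.
Proof.
transitivity (1 + (-2) + 3 * 1 : R); last by ring.
rewrite -(mean_gauss_poly4 1 0 (-2) 0 1).
by congr mean; apply/funext => x; ring.
Qed.

Lemma mean_sub1 : mean gauss (fun x => (x : R) ^+ 2 - 1) = 0.
Proof.
have t1 : tame gw (fun=> 1) by exact: tame_cst.
by rewrite (meanB wg (tX 2) t1) gauss_moment2 (mean_cst gauss) subrr.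
Qed.

Section Moments.
Variable D : nat.
Hypothesis D0 : (0 < D)%N.
Let dp : 0 < D%:R :> R. Proof. by rewrite ltr0n. Qed.
Let dN0 : D%:R != 0 :> R. Proof. by rewrite gt_eqF. Qed.
Let wD := weight_gpairn D.

Let mean_normalized (F : measurableTypeR R * measurableTypeR R -> R) (m c : R) :
  tame gpairw F -> mean gpair (fun z => F z - m) = 0 ->
  mean gpair (fun z => (F z - m) ^+ 2) = c ->
  mean (gpairn D) (fun z => (\sum_j F (tnth z j) / D%:R - m) ^+ 2) = c / D%:R.
Proof.
move=> tF m0 mc.
have tFm : tame gpairw (fun z => F z - m) by tame_tac.
have -> : (fun z : gpairs R D => (\sum_j F (tnth z j) / D%:R - m) ^+ 2) =
    (fun z => D%:R ^- 2 * (\sum_(j < D) (F (tnth z j) - m)) ^+ 2).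
  apply/funext => z; rewrite -mulr_suml sumrB sumr_const card_ord -mulr_natr.
  by field.
rewrite (meanZ wD); last by apply: tameX; exact: (tame_sum_tnth wp (F := fun=> fun z => F z - m)).
rewrite (mean_sqr_sum_tnth wp (F := fun=> fun z => F z - m))//.
rewrite mc sumr_const card_ord -mulr_natr; by field.
Qed.

Let dot_norm (x y : 'I_D -> R) : dotp x y / D%:R = \sum_j x j * y j / D%:R.
Proof. by rewrite /dotp mulr_suml. Qed.

Lemma mean_fstv_dev :
  mean (gpairn D) (fun z => (dotp (fstv z) (fstv z) / D%:R - 1) ^+ 2) = 2 / D%:R.
Proof.
under eq_fun do rewrite dot_norm.
apply: (mean_normalized (F := fun z => (z.1 : R) * (z.1 : R))); first by tame_tac.
  rewrite -[RHS]mean_sub1 -mean_gpair_fst.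
    by congr mean; apply/funext => z; rewrite expr2.
  by apply: tameB => //; [exact: (weight_ge1 wg)|exact: tame_cst].
rewrite -[RHS]mean_sqr_sub1 -(mean_gpair_fst (f := fun x => ((x : R) ^+ 2 - 1) ^+ 2)).
  by congr mean; apply/funext => z; rewrite expr2.
by apply: tameX; apply: tameB => //; [exact: (weight_ge1 wg)|exact: tame_cst].
Qed.

Lemma mean_sndv_dev :
  mean (gpairn D) (fun z => (dotp (sndv z) (sndv z) / D%:R - 1) ^+ 2) = 2 / D%:R.
Proof.
under eq_fun do rewrite dot_norm.
apply: (mean_normalized (F := fun z => (z.2 : R) * (z.2 : R))); first by tame_tac.
  rewrite -[RHS]mean_sub1 -mean_gpair_snd.
    by congr mean; apply/funext => z; rewrite expr2.
  by apply: tameB => //; [exact: (weight_ge1 wg)|exact: tame_cst].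
rewrite -[RHS]mean_sqr_sub1 -(mean_gpair_snd (f := fun x => ((x : R) ^+ 2 - 1) ^+ 2)).
  by congr mean; apply/funext => z; rewrite expr2.
by apply: tameX; apply: tameB => //; [exact: (weight_ge1 wg)|exact: tame_cst].
Qed.

Lemma mean_fst_snd_dev :
  mean (gpairn D) (fun z => (dotp (fstv z) (sndv z) / D%:R) ^+ 2) = D%:R^-1.
Proof.
rewrite -[RHS]mul1r.
have <- : (fun z : gpairs R D => (\sum_j (tnth z j).1 * (tnth z j).2 / D%:R - 0) ^+ 2) =
   (fun z : gpairs R D => (dotp (fstv z) (sndv z) / D%:R) ^+ 2).
  by apply/funext => z; rewrite dot_norm subr0.
apply: (mean_normalized (F := fun z => (z.1 : R) * (z.2 : R))); first by tame_tac.
  under eq_fun do rewrite subr0.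
  by rewrite (mean_gpair_mul tid tid) mean1 mul0r.
have -> : (fun z : measurableTypeR R * measurableTypeR R => ((z.1 : R) * (z.2 : R) - 0) ^+ 2) =
  (fun z => (z.1 : R) ^+ 2 * (z.2 : R) ^+ 2).
  by apply/funext => z; rewrite subr0 exprMn.
by rewrite (mean_gpair_mul (tX 2) (tX 2)) gauss_moment2 mul1r.
Qed.

Lemma tame_gramdev :
  tame (wpow gpairw D) (fun z => gramdev (fstv z) (sndv z)).
Proof.
have t11 := tame_dotp (@tame_fstv D) (@tame_fstv D).
have t22 := tame_dotp (@tame_sndv D) (@tame_sndv D).
have t12 := tame_dotp (@tame_fstv D) (@tame_sndv D).
by rewrite /gramdev; tame_tac.
Qed.

(** 6 = 2 + 2 + 2 * 1: each diagonal deviation has variance 2 / D, and the off-diagonal one, counted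
    twice, has variance 1 / D. *)
Lemma mean_gramdev :
  mean (gpairn D) (fun z => gramdev (fstv z) (sndv z)) = 6 / D%:R.
Proof.
have t11 := tame_dotp (@tame_fstv D) (@tame_fstv D).
have t22 := tame_dotp (@tame_sndv D) (@tame_sndv D).
have t12 := tame_dotp (@tame_fstv D) (@tame_sndv D).
rewrite /gramdev !(meanD wD); [|by tame_tac..].
rewrite (meanZ wD); last by tame_tac.
rewrite mean_fstv_dev mean_sndv_dev mean_fst_snd_dev; by field.
Qed.

(** For fixed [z'] the inner product is a sum of independent centred terms of variance G(z'_j)^2. *)
Lemma mean_cross (F G : measurableTypeR R * measurableTypeR R -> R) :
  tame gpairw F -> tame gpairw G -> mean gpair F = 0 ->
  mean gpair (fun z => F z ^+ 2) = 1 -> mean gpair (fun z => G z ^+ 2) = 1 ->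
  mean (gpairn D) (fun z' => mean (gpairn D) (fun z =>
    dotp (fun j => F (tnth z j)) (fun j => G (tnth z' j)) ^+ 2)) = D%:R.
Proof.
move=> tF tG F0 F2 G2.
have E z' : mean (gpairn D) (fun z : gpairs R D =>
    dotp (fun j => F (tnth z j)) (fun j => G (tnth z' j)) ^+ 2) =
    \sum_j G (tnth z' j) ^+ 2.
  rewrite /dotp (mean_sqr_sum_tnth wp (F := fun j => fun z => F z * G (tnth z' j))).
  - apply: eq_bigr => j _; rewrite -[RHS]mul1r -F2 -(meanZr wp); last by tame_tac.
    by congr mean; apply/funext => z; rewrite exprMn.
  - by move=> j; tame_tac.
  - by move=> j; rewrite (meanZr wp)// F0 mul0r.
under eq_fun do rewrite E.
have tG2 : tame gpairw (fun z => G z ^+ 2) by tame_tac.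
rewrite (mean_sum wD) => [|j _]; last exact: (tame_tnth wp j tG2).
under eq_bigr => j _ do rewrite (mean_tnth wp j tG2) G2.
by rewrite sumr_const card_ord.
Qed.

End Moments.
End GaussianPairs.

(** * Directions of Gaussian vectors and their inner product *)

Section UnitVectors.
Variable R : realType.

(** The power of exponent -1/2 is measurable and agrees with the convention 0^-1 = 0 at zero. *)
Lemma measurable_inv_sqrt d (T : measurableType d) (f : T -> R) :
  measurable_fun setT f -> (forall x, 0 <= f x) ->
  measurable_fun setT (fun x => (Num.sqrt (f x))^-1).
Proof.
move=> mf f0; rewrite (_ : (fun x => _) = (fun x => f x `^ (- 2^-1))).
  exact: (measurableT_comp (measurable_powR _) mf).
by apply/funext => x; rewrite powRN powR12_sqrt.
Qed.

Lemma unitv_le1 D (x : 'I_D -> R) j : `|unitv x j| <= 1.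
Proof.
have := dotp_unitv_le1 x; rewrite /dotp (bigD1 j)//= -expr2 => H.
rewrite -(@ler_pXn2r _ 2)// ?nnegrE// expr1n real_normK ?num_real//.
apply: le_trans H; rewrite lerDl; apply: sumr_ge0 => i _.
by rewrite -expr2 sqr_ge0.
Qed.

(** Coordinates of a direction are bounded by 1, so measurability of [X] suffices, whatever the
    growth. *)
Lemma tame_unitv d (T : measurableType d) (w : T -> R) D (X : T -> 'I_D -> R) j :
  (forall j, measurable_fun setT (fun z => X z j)) ->
  tame w (fun z => unitv (X z) j).
Proof.
move=> mX; apply: (@tame_bound _ _ _ w _ (fun=> 1)) => [||z].
- apply: measurable_funM => //; apply: measurable_inv_sqrt => [|z]; last exact: dotp_ge0.
  by apply: measurable_sum => i; exact: measurable_funM.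
- exact: tame_cst.
- by rewrite normr1 unitv_le1.
Qed.

Lemma normr_dotp_le D (x y : 'I_D -> R) : 2 * `|dotp x y| <= dotp x x + dotp y y.
Proof.
have H (c : R) : c ^+ 2 = 1 -> 2 * (c * dotp x y) <= dotp x x + dotp y y.
  move=> c2; rewrite /dotp !mulr_sumr -big_split; apply: ler_sum => j _ /=.
  by have := sqr_ge0 (x j - c * y j); nra.
have := H 1 (expr1n _ _); have := H (-1) ltac:(by rewrite sqrrN expr1n).
by case: (ger0P (dotp x y)) => _; rewrite ?mulN1r ?mul1r.
Qed.

(** The upper bound on a b is AM-GM. The lower one uses (1 - p - q)^2 <= (1 - p) (1 - q) with p =
    |P|, q = |Q|, in the case p + q < 1. *)
Lemma sqrt_mul_dev (P Q a b : R) : 0 <= a -> 0 <= b ->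
  a ^+ 2 = 1 + P -> b ^+ 2 = 1 + Q -> `|1 - a * b| <= `|P| + `|Q|.
Proof.
move=> a0 b0 aP bQ; have p0 := normr_ge0 P; have q0 := normr_ge0 Q.
have := ler_norm P; have := ler_norm Q; have := ler_norm (- P); have := ler_norm (- Q).
rewrite !normrN; move: (`|P|) (`|Q|) p0 q0 => p q p0 q0 hQ' hP' hQ hP.
rewrite ler_norml; apply/andP; split; first by have := sqr_ge0 (a - b); nra.
rewrite lerBlDr; have [h|h] := leP 1 (p + q).
  by rewrite (le_trans h)// lerDl mulr_ge0.
suff : 1 - (p + q) <= a * b by lra.
rewrite -(@ler_pXn2r _ 2)// ?nnegrE ?mulr_ge0//; last by lra.
rewrite exprMn aP bQ; apply: (@le_trans _ _ ((1 - p) * (1 - q))); first by nra.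
by rewrite ler_pM//; lra.
Qed.

Lemma le_amgm (l p : R) : 0 < l -> `|p| <= (l * p ^+ 2 + l^-1) / 2.
Proof.
move=> l0; rewrite -(real_normK (num_real p)); move: (`|p|) => y.
rewrite -subr_ge0 (_ : _ - _ = l * (y - l^-1) ^+ 2 / 2).
  by rewrite divr_ge0// mulr_ge0 ?sqr_ge0// ltW.
by field; rewrite gt_eqF.
Qed.

(** With a, b the norms of x, v scaled by 1 / sqrt D, c - rho = c (1 - a b) + (c a b - rho). The
    second term is linear in the Gram deviations, and |c| <= 1 in the first spares a division by a
    b, which may vanish. This gives 3 |P| + 2 |r| + |Pt|, made quadratic by [le_amgm] with l = sqrt
    D. *)
Lemma cos_dev (rho : R) D (x y : 'I_D -> R) : (0 < D)%N -> 0 <= rho <= 1 ->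
  `|dotp (unitv x) (unitv (combv rho (Num.sqrt (1 - rho ^+ 2)) x y)) - rho| <=
  3 / 2 * (Num.sqrt D%:R * gramdev x y) + 3 / Num.sqrt D%:R.
Proof.
move=> D0 /andP[r0 r1]; set sg := Num.sqrt (1 - rho ^+ 2).
have sg0 : 0 <= sg by exact: sqrtr_ge0.
have sg2 : sg ^+ 2 = 1 - rho ^+ 2.
  by rewrite sqr_sqrtr// subr_ge0 -[1](expr1n _ 2) lerXn2r ?nnegrE.
have d0 : 0 < D%:R :> R by rewrite ltr0n.
pose l := Num.sqrt D%:R : R; have l0 : 0 < l by rewrite sqrtr_gt0.
rewrite -/l; set v := combv rho sg x y; set c := dotp (unitv x) (unitv v).
pose P := dotp x x / D%:R - 1; pose Q := dotp v v / D%:R - 1.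
pose Pt := dotp y y / D%:R - 1; pose r := dotp x y / D%:R.
have QE : Q = rho ^+ 2 * P + 2 * rho * sg * r + sg ^+ 2 * Pt.
  rewrite /Q /v dotp_combl !dotp_combr (dotpC y x).
  set q := (X in X = _); have -> : q = rho ^+ 2 * P + 2 * rho * sg * r + sg ^+ 2 * Pt
      + (rho ^+ 2 + sg ^+ 2 - 1) by rewrite /q /P /Pt /r; field; rewrite gt_eqF.
  by rewrite sg2; ring.
have c1 : `|c| <= 1.
  have := normr_dotp_le (unitv x) (unitv v).
  have := dotp_unitv_le1 x; have := dotp_unitv_le1 v; rewrite -/c; lra.
pose a := Num.sqrt (dotp x x / D%:R); pose b := Num.sqrt (dotp v v / D%:R).
have sq_ge0 u : 0 <= dotp u u / D%:R :> R by rewrite divr_ge0 ?dotp_ge0// ltW.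
have a2 : a ^+ 2 = 1 + P by rewrite sqr_sqrtr ?sq_ge0// /P addrC subrK.
have b2 : b ^+ 2 = 1 + Q by rewrite sqr_sqrtr ?sq_ge0// /Q addrC subrK.
have cab : c * (a * b) = rho * (1 + P) + sg * r.
  have -> : rho * (1 + P) + sg * r = dotp x v / D%:R.
    by rewrite /v dotp_combr /P /r; field; rewrite gt_eqF.
  rewrite /c /a /b /unitv dotp_scalel dotp_scaler.
  rewrite !sqrtrM ?dotp_ge0//.
  (* If either vector vanishes, both sides are zero. *)
  have [X0|X0] := eqVneq (dotp x x) 0.
    have x0 j : x j = 0.
      apply/eqP; rewrite -sqrf_eq0 eq_le sqr_ge0 andbT -X0.
      by rewrite /dotp (bigD1 j)//= -expr2 lerDl sumr_ge0// => i _; rewrite -expr2 sqr_ge0.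
    have -> : dotp x v = 0 by apply: big1 => j _; rewrite x0 mul0r.
    by rewrite !mulr0 !mul0r.
  have [V0|V0] := eqVneq (dotp v v) 0.
    have v0 j : v j = 0.
      apply/eqP; rewrite -sqrf_eq0 eq_le sqr_ge0 andbT -V0.
      by rewrite /dotp (bigD1 j)//= -expr2 lerDl sumr_ge0// => i _; rewrite -expr2 sqr_ge0.
    have -> : dotp x v = 0 by apply: big1 => j _; rewrite v0 mulr0.
    by rewrite !mulr0 !mul0r.
  have sx : Num.sqrt (dotp x x) != 0 by rewrite sqrtr_eq0 -ltNge lt_neqAle eq_sym X0 dotp_ge0.
  have sv : Num.sqrt (dotp v v) != 0 by rewrite sqrtr_eq0 -ltNge lt_neqAle eq_sym V0 dotp_ge0.
  set e := Num.sqrt D%:R^-1.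
  have -> : D%:R^-1 = e ^+ 2 :> R by rewrite sqr_sqrtr// invr_ge0 ltW.
  by field; rewrite sx sv.
have ab := sqrt_mul_dev (sqrtr_ge0 _) (sqrtr_ge0 _) a2 b2.
have -> : c - rho = c * (1 - a * b) + (rho * P + sg * r).
  by rewrite mulrBr cab; ring.
have rP : `|rho * P| <= `|P| by rewrite normrM ger0_norm// ler_piMl.
have s1 : sg <= 1 by rewrite -(@ler_pXn2r _ 2)// ?nnegrE// sg2 expr1n; nra.
have sr : `|sg * r| <= `|r| by rewrite normrM ger0_norm// ler_piMl.
have rr : `|rho ^+ 2 * P| <= `|P| by rewrite normrM ger0_norm ?sqr_ge0// ler_piMl//; nra.
have ss : `|sg ^+ 2 * Pt| <= `|Pt| by rewrite normrM ger0_norm ?sqr_ge0// ler_piMl//; nra.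
(* 2 rho sg <= rho^2 + sg^2 = 1. *)
have rs : `|2 * rho * sg * r| <= `|r|.
  rewrite normrM ger0_norm ?mulr_ge0// ler_piMl//.
  by have := sqr_ge0 (rho - sg); nra.
have Qb : `|Q| <= `|P| + `|r| + `|Pt|.
  rewrite QE (le_trans (ler_normD _ _))// lerD//.
  by rewrite (le_trans (ler_normD _ _))// lerD.
have B : `|c * (1 - a * b)| <= `|P| + `|Q|.
  by rewrite normrM (le_trans _ ab)// ler_piMl.
have C : `|rho * P + sg * r| <= `|P| + `|r|.
  by rewrite (le_trans (ler_normD _ _))// lerD.
apply: le_trans (le_trans (ler_normD _ _) (lerD B C)) _.
have m1 := le_amgm P l0; have m2 := le_amgm Pt l0; have m3 := le_amgm r l0.
rewrite /gramdev -/P -/Pt -/r.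
have e1 : 0 <= l * Pt ^+ 2 by rewrite mulr_ge0 ?sqr_ge0// ltW.
have e2 : 0 <= l * P ^+ 2 by rewrite mulr_ge0 ?sqr_ge0// ltW.
have e3 : 0 <= l * r ^+ 2 by rewrite mulr_ge0 ?sqr_ge0// ltW.
rewrite !mulrDr [l * (2 * _)]mulrCA.
move: m1 m2 m3 e1 e2 e3 Qb.
move: (l * P ^+ 2) (l * Pt ^+ 2) (l * r ^+ 2) l^-1 => *; lra.
Qed.

End UnitVectors.

Section RowcorrMean.
Variables (R : realType) (D : nat).
Hypothesis D0 : (0 < D)%N.
Notation W := (gpairn R D).
Notation wW := (wpow (@gpairw R) D).
Let wWP : weight W wW := weight_gpairn R D.
Let wWW := weight_prod wWP wWP.
Let dp : 0 < D%:R :> R. Proof. by rewrite ltr0n. Qed.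

Let sqrtD : Num.sqrt D%:R ^+ 2 = D%:R :> R. Proof. by rewrite sqr_sqrtr// ltW. Qed.
Let sD0 : 0 < Num.sqrt D%:R :> R. Proof. by rewrite sqrtr_gt0. Qed.
Let sD1 : 1 <= Num.sqrt D%:R :> R.
Proof.
by have s0 := ltW sD0; rewrite -(@ler_pXn2r _ 2)// ?nnegrE// expr1n sqrtD ler1n.
Qed.

Definition rowcorr2 (zz : gpairs R D * gpairs R D) : R :=
  rowcorr (fstv zz.1) (sndv zz.1) (fstv zz.2) (sndv zz.2).

Lemma tame_prod1 f : tame wW f -> tame (wprod wW wW) (fun zz => f zz.1).
Proof. exact: (tame_fst wWP wWP). Qed.

Lemma tame_prod2 f : tame wW f -> tame (wprod wW wW) (fun zz => f zz.2).
Proof. exact: (tame_snd wWP wWP). Qed.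

Let w1 := weight_ge1 wWW.

Ltac tame_tac := repeat first [ exact: tame_cst | exact: w1 | assumption
  | apply: tameX | apply: tameB | apply: tameD | apply: tameM
  | apply: tame_sum => [|? ?] ].

Let tcross (F G : measurableTypeR R * measurableTypeR R -> R) :
  tame (@gpairw R) F -> tame (@gpairw R) G ->
  tame (wprod wW wW) (fun zz : gpairs R D * gpairs R D =>
    dotp (fun j => F (tnth zz.1 j)) (fun j => G (tnth zz.2 j)) ^+ 2).
Proof.
move=> tF tG; apply: tameX; apply: tame_sum => [|j _]; first exact: w1.
apply: tameM.
  exact: (tame_prod1 (tame_tnth (weight_gpair R) j tF)).
exact: (tame_prod2 (tame_tnth (weight_gpair R) j tG)).
Qed.

Let mcross (F G : measurableTypeR R * measurableTypeR R -> R) :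
  tame (@gpairw R) F -> tame (@gpairw R) G -> mean (gpair R) G = 0 ->
  mean (gpair R) (fun z => F z ^+ 2) = 1 -> mean (gpair R) (fun z => G z ^+ 2) = 1 ->
  mean (W \x W)%E (fun zz : gpairs R D * gpairs R D =>
    dotp (fun j => F (tnth zz.1 j)) (fun j => G (tnth zz.2 j)) ^+ 2) = D%:R.
Proof.
move=> tF tG G0 F2 G2; rewrite (mean_prod wWP wWP (tcross tF tG)).
rewrite -(@mean_cross R D G F tG tF G0 G2 F2); congr mean; apply/funext => z.
by congr mean; apply/funext => z'; rewrite dotpC.
Qed.

Let t1 := tame_gpair1 R.
Let t2 := tame_gpair2 R.
Let tX n := @tame_gaussX R n.
Let m1 : mean (gpair R) (fun z => z.1 : R) = 0.
Proof. by rewrite (mean_gpair_fst (tame_gauss_id R)); exact: (@gauss_moment_odd R 1). Qed.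
Let m2 : mean (gpair R) (fun z => z.2 : R) = 0.
Proof. by rewrite (mean_gpair_snd (tame_gauss_id R)); exact: (@gauss_moment_odd R 1). Qed.
Let m11 : mean (gpair R) (fun z => (z.1 : R) ^+ 2) = 1.
Proof. by rewrite (mean_gpair_fst (tX 2)) gauss_moment2. Qed.
Let m22 : mean (gpair R) (fun z => (z.2 : R) ^+ 2) = 1.
Proof. by rewrite (mean_gpair_snd (tX 2)) gauss_moment2. Qed.

Lemma tame_rowcorr2 : tame (wprod wW wW) rowcorr2.
Proof.
have tg := tame_gramdev R D.
have g1 := tame_prod1 tg; have g2 := tame_prod2 tg.
have c11 := tcross t1 t1; have c12 := tcross t1 t2.
have c21 := tcross t2 t1; have c22 := tcross t2 t2.
by rewrite /rowcorr2 /rowcorr /crossdev; tame_tac.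
Qed.

(** With l = sqrt D: the four cross terms give 8 / l, the constant 2 / l, and the two Gram
    deviations 48 / D, which is at most 48 / l. *)
Lemma mean_rowcorr2 : mean (W \x W)%E rowcorr2 <= 58 / Num.sqrt D%:R.
Proof.
have tg := tame_gramdev R D.
have g1 := tame_prod1 tg; have g2 := tame_prod2 tg.
have c11 := tcross t1 t1; have c12 := tcross t1 t2.
have c21 := tcross t2 t1; have c22 := tcross t2 t2.
pose G1 (zz : gpairs R D * gpairs R D) := gramdev (fstv zz.1) (sndv zz.1).
pose G2 (zz : gpairs R D * gpairs R D) := gramdev (fstv zz.2) (sndv zz.2).
have E : rowcorr2 = fun zz =>
   2 * Num.sqrt D%:R / D%:R ^+ 2 *
     (dotp (fstv zz.1) (fstv zz.2) ^+ 2 + dotp (fstv zz.1) (sndv zz.2) ^+ 2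
      + dotp (sndv zz.1) (fstv zz.2) ^+ 2 + dotp (sndv zz.1) (sndv zz.2) ^+ 2)
   + 2 / Num.sqrt D%:R + 4 * G1 zz + 4 * G2 zz.
  by apply/funext => zz; rewrite /rowcorr2 /rowcorr /crossdev /G1 /G2; ring.
have mG1 : mean (W \x W)%E G1 = 6 / D%:R.
  rewrite (mean_prod wWP wWP g1) /= -(mean_gramdev R D0); congr mean.
  by apply/funext => z; rewrite (mean_cst W).
have mG2 : mean (W \x W)%E G2 = 6 / D%:R.
  by rewrite (mean_prod wWP wWP g2) /= (mean_cst W) (mean_gramdev R D0).
have {g1} tG1 : tame (wprod wW wW) G1 by []; have {g2} tG2 : tame (wprod wW wW) G2 by [].
rewrite E; clearbody G1 G2; clear E.
rewrite !(meanD wWW); [|by tame_tac..].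
rewrite !(meanZ wWW); [|by tame_tac..].
rewrite !(meanD wWW); [|by tame_tac..].
rewrite (mcross t1 t1 m1 m11 m11) (mcross t1 t2 m2 m11 m22).
rewrite (mcross t2 t1 m1 m22 m11) (mcross t2 t2 m2 m22 m22).
rewrite (mean_cst (W \x W)%E) mG1 mG2.
have := sD0; have := sD1; have := sqrtD.
move: (Num.sqrt D%:R) => l <- l1 l0.
have -> : 2 * l / (l ^+ 2) ^+ 2 * (l ^+ 2 + l ^+ 2 + l ^+ 2 + l ^+ 2) = 8 / l.
  by field; rewrite gt_eqF.
have -> : 6 / l ^+ 2 = 6 / l * l^-1 by field; rewrite gt_eqF.
have : 0 <= l^-1 by rewrite invr_ge0 ltW.
have : l^-1 <= 1 by rewrite invf_le1.
move: (l^-1) => i; nra.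
Qed.

Definition cosv (rho : R) (z : gpairs R D) : R :=
  dotp (unitv (fstv z)) (unitv (combv rho (Num.sqrt (1 - rho ^+ 2)) (fstv z) (sndv z))).

Lemma measurable_rotv (rho sg : R) j :
  measurable_fun setT (fun z : gpairs R D => combv rho sg (fstv z) (sndv z) j).
Proof.
by have [] := tameD (weight_ge1 wWP) (tameZ rho (@tame_fstv R D j))
  (tameZ sg (@tame_sndv R D j)).
Qed.

Lemma tame_cosv rho : tame wW (cosv rho).
Proof.
apply: tame_sum => [|j _]; first exact: (weight_ge1 wWP).
apply: tameM; apply: tame_unitv => i; first by have [] := @tame_fstv R D i.
exact: measurable_rotv.
Qed.

(** 12 = (3/2) * 6 + 3, from [cos_dev] and [mean_gramdev]. *)
Lemma mean_cosv_dev rho : 0 <= rho <= 1 ->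
  mean W (fun z => `|cosv rho z - rho|) <= 12 / Num.sqrt D%:R.
Proof.
move=> r01; have tg := tame_gramdev R D.
have ww1 := weight_ge1 wWP.
pose g (z : gpairs R D) := 3 / 2 * Num.sqrt D%:R * gramdev (fstv z) (sndv z).
have tg' : tame wW g by exact: tameZ.
have tc : tame wW (fun=> 3 / Num.sqrt D%:R) by exact: tame_cst.
have tcos : tame wW (fun z => `|cosv rho z - rho|).
  by apply: tame_norm; apply: tameB => //; [exact: tame_cosv|exact: tame_cst].
apply: (@le_trans _ _ (mean W (fun z => g z + 3 / Num.sqrt D%:R))).
  apply: (mean_le wWP) => // [|z]; first exact: tameD.
  by rewrite /g -mulrA; exact: cos_dev.
rewrite (meanD wWP tg' tc) (meanZ wWP _ tg) (mean_cst W) (mean_gramdev R D0).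
have := sD0; have := sqrtD; move: (Num.sqrt D%:R) => l <- l0.
by rewrite le_eqVlt; apply/orP; left; apply/eqP; field; rewrite gt_eqF.
Qed.

End RowcorrMean.

(** * Multiaffine polynomials and Bonami's inequality *)

Section SubsetSums.
Variable R : realType.

(** A subset of the n + 1 indices is either [up S] or [ord0 |: up S]; this splits a multiaffine
    polynomial by its first variable. *)
Definition up n (S : {set 'I_n}) : {set 'I_n.+1} := lift ord0 @: S.

Lemma ord0_up n (S : {set 'I_n}) : ord0 \notin up S.
Proof. by apply/imsetP => -[i _]. Qed.

Lemma mem_up n (S : {set 'I_n}) i : (lift ord0 i \in up S) = (i \in S).
Proof. by rewrite mem_imset//; exact: lift_inj. Qed.

Lemma card_up n (S : {set 'I_n}) : #|up S| = #|S|.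
Proof. by rewrite card_imset//; exact: lift_inj. Qed.

Lemma card_up1 n (S : {set 'I_n}) : #|ord0 |: up S| = #|S|.+1.
Proof. by rewrite cardsU1 ord0_up card_up. Qed.

Lemma prod_up n (S : {set 'I_n}) (x : 'I_n.+1 -> R) :
  \prod_(i in up S) x i = \prod_(i in S) x (lift ord0 i).
Proof. by rewrite big_imset//= => i j _ _; exact: lift_inj. Qed.

Lemma prod_up1 n (S : {set 'I_n}) (x : 'I_n.+1 -> R) :
  \prod_(i in ord0 |: up S) x i = x ord0 * \prod_(i in S) x (lift ord0 i).
Proof. by rewrite big_setU1 ?ord0_up//= prod_up. Qed.

Lemma sum_set_recl n (F : {set 'I_n.+1} -> R) :
  \sum_S F S = \sum_(S : {set 'I_n}) F (up S) + \sum_(S : {set 'I_n}) F (ord0 |: up S).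
Proof.
pose g (S : {set 'I_n.+1}) : {set 'I_n} :=
    finset (fun i => lift ord0 i \in S).
have gup S : g (up S) = S by apply/setP => i; rewrite inE mem_up.
have gup1 S : g (ord0 |: up S) = S.
  by apply/setP => i; rewrite !inE mem_up.
have upg (S : {set 'I_n.+1}) : ord0 \notin S -> up (g S) = S.
  move=> S0; apply/setP => i; case: (unliftP ord0 i) => [j ->|->].
    by rewrite mem_up inE.
  by rewrite (negPf (ord0_up _)) (negPf S0).
have up1g (S : {set 'I_n.+1}) : ord0 \in S -> ord0 |: up (g S) = S.
  move=> S0; apply/setP => i; rewrite in_setU1; case: (unliftP ord0 i) => [j ->|->].
    by rewrite mem_up inE.
  by rewrite eqxx S0.
rewrite (bigID (fun S : {set 'I_n.+1} => ord0 \in S)) /= addrC; congr (_ + _).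
  rewrite (reindex_onto (@up n) g) /= => [|S]; last exact: upg.
  by apply: eq_bigl => S; rewrite ord0_up gup eqxx.
rewrite (reindex_onto (fun S => ord0 |: @up n S) g) /= => [|S]; last exact: up1g.
by apply: eq_bigl => S; rewrite setU11 gup1 eqxx.
Qed.

End SubsetSums.

Section Multiaffine.
Variable R : realType.

Definition multiaff n (c : {set 'I_n} -> R) (x : 'I_n -> R) : R :=
  \sum_(S : {set 'I_n}) c S * \prod_(i in S) x i.

Lemma multiaff_recl n (c : {set 'I_n.+1} -> R) x :
  multiaff c x = multiaff (fun S => c (up S)) (x \o lift ord0)
    + x ord0 * multiaff (fun S => c (ord0 |: up S)) (x \o lift ord0).
Proof.
rewrite /multiaff sum_set_recl mulr_sumr; congr (_ + _).
  by apply: eq_bigr => S _; rewrite prod_up.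
by apply: eq_bigr => S _; rewrite prod_up1 mulrCA.
Qed.

Variable K : finType.

(** The [c k] are the components of one vector-valued polynomial; matrices enter through their real
    coordinates. *)
Definition sqnorm n (c : K -> {set 'I_n} -> R) (x : 'I_n -> R) : R :=
  \sum_k multiaff (c k) x ^+ 2.

Lemma polar_gram n (c : K -> {set 'I_n} -> R) x y :
  polar (fun S S' => \sum_k c k S * c k S') x y =
  \sum_k multiaff (c k) x * multiaff (c k) y.
Proof.
rewrite /polar; under [RHS]eq_bigr => k _.
  rewrite /multiaff mulr_suml.
  under eq_bigr do rewrite mulr_sumr.
  over.
rewrite [RHS]exchange_big; apply: eq_bigr => S _ /=.
rewrite [RHS]exchange_big; apply: eq_bigr => S' _ /=.
by rewrite mulr_suml; apply: eq_bigr => k _; ring.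
Qed.

Lemma sqnorm_polar n (c : K -> {set 'I_n} -> R) x :
  sqnorm c x = polar (fun S S' => \sum_k c k S * c k S') x x.
Proof. by rewrite polar_gram; apply: eq_bigr => k _; rewrite expr2. Qed.

Lemma sqnorm_ge0 n (c : K -> {set 'I_n} -> R) x : 0 <= sqnorm c x.
Proof. by apply: sumr_ge0 => k _; exact: sqr_ge0. Qed.

Lemma sqr_sum_mul_le (a b : K -> R) :
  (\sum_k a k * b k) ^+ 2 <= (\sum_k a k ^+ 2) * (\sum_k b k ^+ 2).
Proof.
rewrite -subr_ge0.
set A := \sum_k a k ^+ 2; set B := \sum_k b k ^+ 2; set C := \sum_k a k * b k.
have A0 : 0 <= A by apply: sumr_ge0 => k _; exact: sqr_ge0.
have B0 : 0 <= B by apply: sumr_ge0 => k _; exact: sqr_ge0.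
have key s t : 0 <= s ^+ 2 * A + 2 * s * t * C + t ^+ 2 * B.
  rewrite /A /B /C !mulr_sumr -!big_split; apply: sumr_ge0 => k _ /=.
  by have := sqr_ge0 (s * a k + t * b k); lra.
have [b0|bN0] := eqVneq B 0.
  have C0 : C = 0.
    apply: big1 => k _; apply/eqP; rewrite mulf_eq0 orbC -sqrf_eq0.
    move/eqP: b0; rewrite psumr_eq0 => [/allP/(_ k)|i _]; last exact: sqr_ge0.
    by rewrite mem_index_enum => /(_ erefl) /= ->.
  by rewrite b0 C0 expr0n mulr0 subr0.
have Bp : 0 < B by rewrite lt_neqAle eq_sym bN0.
have := key B (- C) => H.
have : 0 <= B * (A * B - C ^+ 2) by nra.
by rewrite pmulr_rge0.
Qed.

End Multiaffine.

Section ProductMeans.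
Context d (T : measurableType d) (R : realType).
Variables (P : probability T R) (w : T -> R).
Hypothesis wP : weight P w.
Let w1 := weight_ge1 wP.

(** For distinct sets some row occurs in just one of the two monomials, and its centred factor makes
    the mean vanish; only the diagonal of [B] is left. *)
Lemma mean_polar n (B : {set 'I_n} -> {set 'I_n} -> R) (X Y : T -> R) (c : R) :
  tame w X -> tame w Y -> mean P X = 0 -> mean P Y = 0 ->
  mean P (fun x => X x * Y x) = c ->
  mean (prob_pow P n) (fun t => polar B (rowf X t) (rowf Y t)) =
  \sum_(S : {set 'I_n}) B S S * c ^+ #|S|.
Proof.
move=> tX tY X0 Y0 XY.
have wn := weight_pow wP n; have wn1 := weight_ge1 wn.
pose phi (S S' : {set 'I_n}) i x := (if i \in S then X x else 1) * (if i \in S' then Y x else 1).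
have tphi S S' i : tame w (phi S S' i).
  by rewrite /phi; case: (i \in S); case: (i \in S'); apply: tameM => //; exact: tame_cst.
have E (S S' : {set 'I_n}) (t : n.-tuple T) :
    \prod_(i in S) rowf X t i * \prod_(i in S') rowf Y t i = \prod_i phi S S' i (tnth t i).
  by rewrite (big_split _ _ _ (fun i => if i \in S then X (tnth t i) else 1)) -!big_mkcond.
have tE (S S' : {set 'I_n}) : tame (wpow w n) (fun t : n.-tuple T =>
    \prod_(i in S) rowf X t i * \prod_(i in S') rowf Y t i).
  under eq_fun do rewrite E.
  by apply: tame_prod => i _; exact: (tame_tnth wP i (tphi S S' i)).
rewrite /polar (mean_sum wn) => [|S _]; last first.
  by apply: tame_sum => // S' _; exact: tameZ.
apply: eq_bigr => S _; rewrite (mean_sum wn) => [|S' _]; last exact: tameZ.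
have mphi (S' : {set 'I_n}) : mean (prob_pow P n) (fun t => \prod_(i in S) rowf X t i *
    \prod_(i in S') rowf Y t i) = if S == S' then c ^+ #|S| else 0.
  under eq_fun do rewrite E.
  rewrite (mean_pow_prod wP (tphi S S')); case: eqP => [<-|SS'].
    rewrite -prodr_const [RHS]big_mkcond; apply: eq_bigr => i _.
    rewrite /phi; case: (i \in S) => //.
    by under eq_fun do rewrite mulr1; exact: (mean_cst P).
  have [i iSS'] : exists i, (i \in S) != (i \in S').
    apply/existsP; apply: contra_notT SS' => /existsPn H; apply/setP => i.
    by apply/eqP; have := H i; rewrite negbK.
  rewrite (bigD1 i)//= (_ : mean P (phi S S' i) = 0) ?mul0r//.
  move: iSS'; rewrite /phi; case: (i \in S); case: (i \in S') => // _.
    by under eq_fun do rewrite mulr1.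
  by under eq_fun do rewrite mul1r.
rewrite (bigD1 S)//= (meanZ wn _ (tE S S)) mphi eqxx big1 ?addr0// => S' S'S.
by rewrite (meanZ wn _ (tE S S')) mphi eq_sym (negPf S'S) mulr0.
Qed.

Section Hypercontractivity.
Variables (X : T -> R) (k : R).
Hypotheses (tX : tame w X) (k01 : 0 <= k <= 1).
Hypotheses (X1 : mean P X = 0) (X2 : mean P (fun x => X x ^+ 2) = k)
  (X3 : mean P (fun x => X x ^+ 3) = 0) (X4 : mean P (fun x => X x ^+ 4) = 3 * k ^+ 2).

(** [X] has the first four moments of a centred Gaussian of variance k. The value k = 0 must be
    allowed, since a direction may be the zero vector. *)
Let mean_poly4 (c0 c1 c2 c3 c4 : R) :
  mean P (fun x => c0 + c1 * X x + c2 * X x ^+ 2 + c3 * X x ^+ 3 + c4 * X x ^+ 4) =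
  c0 + c2 * k + c4 * (3 * k ^+ 2).
Proof.
have -> : (fun x => c0 + c1 * X x + c2 * X x ^+ 2 + c3 * X x ^+ 3 + c4 * X x ^+ 4) =
  (fun x => \sum_(i < 5) [:: c0; c1; c2; c3; c4]`_i * X x ^+ i).
  by apply/funext => x; rewrite !big_ord_recr big_ord0 /=; ring.
rewrite (mean_sum wP) => [|i _]; last by apply: tameZ; exact: tameX.
under eq_bigr => i _ do rewrite (meanZ wP _ (tameX _ tX)).
rewrite !big_ord_recr big_ord0 /= X2 X3 X4.
rewrite (_ : mean P (fun x => X x ^+ 0) = 1); last exact: (mean_cst P 1).
rewrite (_ : mean P (fun x => X x ^+ 1) = 0); last exact: X1.
by ring.
Qed.

Lemma tame_sqnorm (K : finType) n (c : K -> {set 'I_n} -> R) :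
  tame (wpow w n) (fun t => sqnorm c (rowf X t)).
Proof.
have wn1 := weight_ge1 (weight_pow wP n).
apply: tame_sum => // j _; apply: tameX; apply: tame_sum => // S _.
by apply: tameZ; apply: tame_prod => i _; exact: (tame_tnth wP i tX).
Qed.

(* Bonami's inequality, for the fourth moment and vector-valued coefficients. *)
Lemma mean_sqnorm_sqr_le (K : finType) n (c : K -> {set 'I_n} -> R) :
  mean (prob_pow P n) (fun t => sqnorm c (rowf X t) ^+ 2) <=
  (\sum_(S : {set 'I_n}) 3 ^+ #|S| * \sum_j c j S ^+ 2) ^+ 2.
Proof.
elim: n c => [|n IH] c.
  rewrite (mean_pow0 P); last by have [] := tameX 2 (tame_sqnorm c).
  rewrite le_eqVlt; apply/orP; left; apply/eqP; congr (_ ^+ 2).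
  have S0 (S : {set 'I_0}) : S = finset.set0 by apply/setP => -[].
  have sum0 (F : {set 'I_0} -> R) : \sum_S F S = F finset.set0.
    rewrite (bigD1 finset.set0)//= big1 ?addr0// => S.
    by rewrite (S0 S) eqxx.
  rewrite sum0 cards0 expr0 mul1r; apply: eq_bigr => j _.
  by rewrite /multiaff sum0 big_set0 mulr1.
have wn := weight_pow wP n; have wn1 := weight_ge1 wn.
pose cA j S := c j (up S); pose cB j S := c j (ord0 |: up S).
pose al := \sum_(S : {set 'I_n}) 3 ^+ #|S| * \sum_j cA j S ^+ 2.
pose be := \sum_(S : {set 'I_n}) 3 ^+ #|S| * \sum_j cB j S ^+ 2.
have sge0 (e : K -> {set 'I_n} -> R) : 0 <= \sum_(S : {set 'I_n}) 3 ^+ #|S| * \sum_j e j S ^+ 2.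
  apply: sumr_ge0 => S _; rewrite mulr_ge0 ?exprn_ge0//.
  by apply: sumr_ge0 => j _; exact: sqr_ge0.
have -> : \sum_(S : {set 'I_n.+1}) 3 ^+ #|S| * \sum_j c j S ^+ 2 = al + 3 * be.
  rewrite sum_set_recl; congr (_ + _); first by apply: eq_bigr => S _; rewrite card_up.
  by rewrite mulr_sumr; apply: eq_bigr => S _; rewrite card_up1 exprS mulrA.
have tS2 := tameX 2 (tame_sqnorm c).
rewrite (mean_powS wP tS2) (mean_swap wP wn (tame_cons tS2)).
pose a (t : n.-tuple T) := sqnorm cA (rowf X t).
pose e (t : n.-tuple T) := sqnorm cB (rowf X t).
have ta : tame (wpow w n) a by exact: tame_sqnorm.
have te : tame (wpow w n) e by exact: tame_sqnorm.
(* As b^2 <= a e, the mean over the first row is at most a^2 + 6 a e + 3 e^2; the last coefficient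
   is raised to 9 to match the square of al + 3 be. *)
have bound t : mean P (fun x => sqnorm c (rowf X (cons_pair (x, t))) ^+ 2) <=
    a t ^+ 2 + 6 * (a t * e t) + 9 * e t ^+ 2.
  pose b := \sum_j multiaff (cA j) (rowf X t) * multiaff (cB j) (rowf X t).
  have -> : (fun x => sqnorm c (rowf X (cons_pair (x, t))) ^+ 2) =
    (fun x => a t ^+ 2 + (4 * a t * b) * X x + (4 * b ^+ 2 + 2 * a t * e t) * X x ^+ 2
       + (4 * b * e t) * X x ^+ 3 + e t ^+ 2 * X x ^+ 4).
    apply/funext => x.
    have -> : sqnorm c (rowf X (cons_pair (x, t))) = a t + 2 * X x * b + X x ^+ 2 * e t.
      rewrite /a /e /b /sqnorm !mulr_sumr -!big_split; apply: eq_bigr => j _ /=.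
      by rewrite multiaff_recl rowf_consS rowf_cons0 /=; ring.
    by ring.
  rewrite mean_poly4; have b2 : b ^+ 2 <= a t * e t by exact: sqr_sum_mul_le.
  have a0 : 0 <= a t by exact: sqnorm_ge0.
  have e0 : 0 <= e t by exact: sqnorm_ge0.
  case/andP: k01 => k0 k1.
  have ae : 0 <= a t * e t by exact: mulr_ge0.
  have e2 : 0 <= e t ^+ 2 by exact: sqr_ge0.
  have h1 : b ^+ 2 * k <= a t * e t by rewrite (le_trans _ b2)// ler_piMr// sqr_ge0.
  have h2 : a t * e t * k <= a t * e t by rewrite ler_piMr.
  have h3 : e t ^+ 2 * k ^+ 2 <= e t ^+ 2 by rewrite ler_piMr// exprn_ile1.
  lra.
have ta2 := tameX 2 ta; have te2 := tameX 2 te; have tae := tameM ta te.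
have t6 := tameZ 6 tae; have t9 := tameZ 9 te2.
apply: (@le_trans _ _ (mean (prob_pow P n) (fun t =>
    a t ^+ 2 + 6 * (a t * e t) + 9 * e t ^+ 2))).
  apply: (mean_le wn) => //; first exact: (tame_mean1 wP wn (tame_cons tS2)).
  by apply: tameD => //; exact: tameD.
rewrite (meanD wn (tameD wn1 ta2 t6) t9) (meanD wn ta2 t6) (meanZ wn _ tae) (meanZ wn _ te2).
have Ha : mean (prob_pow P n) (fun t => a t ^+ 2) <= al ^+ 2 by exact: IH.
have He : mean (prob_pow P n) (fun t => e t ^+ 2) <= be ^+ 2 by exact: IH.
have al0 : 0 <= al by exact: sge0.
have be0 : 0 <= be by exact: sge0.
(* Cauchy-Schwarz in [t], then the induction hypothesis on both halves. *)
have Hae : mean (prob_pow P n) (fun t => a t * e t) <= al * be.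
  have := mean_cauchy_schwarz wn ta te.
  set m := mean _ (fun t => a t * e t) => H.
  have : m ^+ 2 <= (al * be) ^+ 2.
    rewrite (le_trans H)// exprMn ler_pM//; apply: mean_ge0 => t; exact: sqr_ge0.
  have [m0|m0] := leP 0 m; last by move=> _; rewrite (le_trans (ltW m0))// mulr_ge0.
  by rewrite ler_pXn2r// nnegrE mulr_ge0.
move: Ha He Hae; move: (mean _ _) (mean _ _) (mean _ _) => x y z; nra.
Qed.

(** The weights 3^|S| are at most 3^dg on the support, and the sum is squared. *)
Lemma mean_sqnorm_sqr_le_deg (K : finType) n (c : K -> {set 'I_n} -> R) dg :
  (forall j (S : {set 'I_n}), (dg < #|S|)%N -> c j S = 0) ->
  mean (prob_pow P n) (fun t => sqnorm c (rowf X t) ^+ 2) <=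
  9 ^+ dg * (\sum_(S : {set 'I_n}) \sum_j c j S ^+ 2) ^+ 2.
Proof.
move=> c0; apply: le_trans (mean_sqnorm_sqr_le c) _.
have -> : 9 ^+ dg = (3 ^+ dg) ^+ 2 :> R by rewrite -exprM mulnC exprM; congr (_ ^+ _); ring.
rewrite -exprMn lerXn2r ?nnegrE//.
- apply: sumr_ge0 => S _; rewrite mulr_ge0 ?exprn_ge0//.
  by apply: sumr_ge0 => j _; exact: sqr_ge0.
- rewrite mulr_ge0 ?exprn_ge0//; apply: sumr_ge0 => S _.
  by apply: sumr_ge0 => j _; exact: sqr_ge0.
rewrite mulr_sumr; apply: ler_sum => S _.
have [Sd|Sd] := leqP #|S| dg.
  rewrite ler_wpM2r ?ler_weXn2l ?ler1n//.
  by apply: sumr_ge0 => j _; exact: sqr_ge0.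
by rewrite big1 ?mulr0// => j _; rewrite c0// expr0n.
Qed.

End Hypercontractivity.
End ProductMeans.

(** * Mean and variance of the sketched form *)

Section VarianceOfMean.
Context d1 d2 (T1 : measurableType d1) (T2 : measurableType d2) (R : realType).
Variables (P : probability T1 R) (Q : probability T2 R) (w1 : T1 -> R) (w2 : T2 -> R).
Hypotheses (wP : weight P w1) (wQ : weight Q w2).

Lemma tame_comp d3 d4 (T3 : measurableType d3) (T4 : measurableType d4)
    (w3 : T3 -> R) (w4 : T4 -> R) (phi : T4 -> T3) f :
  (forall x, 1 <= w3 x) -> measurable_fun setT phi -> (forall x, w3 (phi x) <= w4 x) ->
  tame w3 f -> tame w4 (fun x => f (phi x)).
Proof.
move=> w3_1 mphi le34 [mf [C [k [C0 fC]]]]; split; first exact: (measurableT_comp mf).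
exists C, k; split=> // x; rewrite (le_trans (fC _))// ler_wpM2l// lerXn2r//.
- by rewrite nnegrE (le_trans _ (w3_1 _)).
- by rewrite nnegrE (le_trans _ (le_trans (w3_1 _) (le34 _))).
Qed.

(** The square of a mean over Q is a mean over Q x Q, and Fubini moves the mean over P inside. *)
Lemma cov_mean_le (Phi : T1 * T2 -> R) (s : T2 * T2 -> R) (V : R) :
  tame (wprod w1 w2) Phi -> tame (wprod w2 w2) s ->
  (forall z z', cov P (fun x => Phi (x, z)) (fun x => Phi (x, z')) <= s (z, z') * V) ->
  cov P (fun x => mean Q (fun z => Phi (x, z))) (fun x => mean Q (fun z => Phi (x, z)))
  <= mean (Q \x Q)%E s * V.
Proof.
move=> tPhi ts H; have wQQ := weight_prod wQ wQ; have wPQQ := weight_prod wP wQQ.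
have w12 := wprod_ge1 wP wQ; have w2_1 := weight_ge1 wQ; have w1_1 := weight_ge1 wP.
have w1_0 x : 0 <= w1 x := le_trans ler01 (w1_1 x).
have w2_0 x : 0 <= w2 x := le_trans ler01 (w2_1 x).
pose Phi2 (u : T1 * (T2 * T2)) := Phi (u.1, u.2.1) * Phi (u.1, u.2.2).
have tPhi2 : tame (wprod w1 (wprod w2 w2)) Phi2.
  apply: tameM.
    apply: (tame_comp (phi := fun u : T1 * (T2 * T2) => (u.1, u.2.1)) w12 _ _ tPhi) => [|u].
      by apply: measurable_fun_pair => //; exact: measurableT_comp.
    by rewrite /wprod /= ler_wpM2l// ler_peMr.
  apply: (tame_comp (phi := fun u : T1 * (T2 * T2) => (u.1, u.2.2)) w12 _ _ tPhi) => [|u].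
    by apply: measurable_fun_pair => //; exact: measurableT_comp.
  by rewrite /wprod /= ler_wpM2l// ler_peMl.
pose F x := mean Q (fun z => Phi (x, z)).
pose mu z := mean P (fun x => Phi (x, z)).
have tF : tame w1 F by exact: (tame_mean2 wP wQ tPhi).
have tmu : tame w2 mu by exact: (tame_mean1 wP wQ tPhi).
have sec x : tame w2 (fun z => Phi (x, z)) by exact: (tame_section2 wP x tPhi).
have tmm : tame (wprod w2 w2) (fun zz => mu zz.1 * mu zz.2).
  by apply: tameM; [exact: (tame_fst wQ wQ tmu)|exact: (tame_snd wQ wQ tmu)].
have E1 : mean P (fun x => F x * F x) =
    mean (Q \x Q)%E (fun zz => mean P (fun x => Phi2 (x, zz))).
  rewrite -(mean_swap wP wQQ tPhi2); congr mean; apply/funext => x.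
  rewrite (mean_prod wQ wQ (tame_section2 wP x tPhi2)) /Phi2 /=.
  by under eq_fun do rewrite (meanZ wQ _ (sec x)); rewrite (meanZr wQ _ (sec x)).
have E2 : mean P F * mean P F = mean (Q \x Q)%E (fun zz => mu zz.1 * mu zz.2).
  rewrite (mean_prod wQ wQ tmm) /=.
  under eq_fun do rewrite (meanZ wQ _ tmu); rewrite (meanZr wQ _ tmu).
  by rewrite /F (mean_swap wP wQ tPhi).
have tP2 := tame_mean1 wP wQQ tPhi2.
rewrite /cov -/F E1 E2 -(meanB wQQ tP2 tmm) -(meanZr wQQ V ts).
apply: (mean_le wQQ).
- exact: (tameB (weight_ge1 wQQ) tP2 tmm).
- by apply: tameM => //; exact: tame_cst.
- by move=> [z z']; exact: H.
Qed.

Lemma chebyshev_cov (F : T1 -> R) (e : R) : tame w1 F -> 0 < e ->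
  let A := [set x | e < `|F x - mean P F|] in
  measurable A /\ (P A <= (cov P F F / e ^+ 2)%:E)%E.
Proof.
move=> tF e0 /=; set m := mean P F; set A := [set x | _].
have w1_1 := weight_ge1 wP.
have tm : tame w1 (fun=> m) by exact: tame_cst.
have tFm : tame w1 (fun x => F x - m) by exact: tameB.
have mA : measurable A.
  rewrite [A](_ : _ = (fun x => e < `|F x - m|) @^-1` [set true]); last first.
    by apply/seteqP; split => x /=; [move=> ->|].
  rewrite -[X in measurable X]setTI.
  apply: measurable_fun_ltr => //; by have [] := tame_norm tFm.
split=> //.
have tI : tame w1 (\1_A : T1 -> R).
  split; first exact: measurable_indic.
  exists 1, 0%N; split=> // x; rewrite expr0 mulr1 indicE.
  by case: (_ \in _); rewrite ?normr1 ?normr0.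
have -> : P A = (mean P (\1_A : T1 -> R))%:E.
  by rewrite -(tame_meanE wP tI) integral_indic// setIT.
have -> : cov P F F = mean P (fun x => (F x - m) ^+ 2).
  have tFF := tameM tF tF; have t2 := tameZ (2 * m) tF.
  have -> : (fun x => (F x - m) ^+ 2) = (fun x => F x * F x - 2 * m * F x + m * m).
    by apply/funext => x; ring.
  have tmm : tame w1 (fun=> m * m) by exact: tame_cst.
  rewrite (meanD wP (tameB w1_1 tFF t2) tmm) (meanB wP tFF t2) (meanZ wP _ tF) (mean_cst P).
  by rewrite /cov -/m; ring.
have e2 : 0 < e ^+ 2 by rewrite exprn_gt0.
rewrite lee_fin ler_pdivlMr// -(meanZr wP _ tI).
apply: (mean_le wP); [by apply: tameM => //; exact: tame_cst|exact: tameX|].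
move=> x; rewrite indicE; case: (boolP (x \in A)) => [|_]; last by rewrite mul0r sqr_ge0.
rewrite inE /A /= mul1r => h; rewrite -(real_normK (num_real (F x - m))).
by rewrite lerXn2r ?nnegrE// ltW.
Qed.

End VarianceOfMean.

Section Sketch.
Variables (R : realType) (n D : nat).
Hypothesis D0 : (0 < D)%N.
Notation gn := (gaussn R D).
Notation wg := (wpow (@gweight R) D).
Notation PG := (prob_pow gn n).
Notation wG := (wpow wg n).
Notation W := (gpairn R D).
Notation wW := (wpow (@gpairw R) D).
Let wgn : weight gn wg := weight_gaussn R D.
Let wPG : weight PG wG := weight_pow wgn n.
Let wWP : weight W wW := weight_gpairn R D.
Let wPW := weight_prod wPG wWP.

Variable rho : R.
Hypothesis rho01 : 0 <= rho <= 1.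

(* A pair of law G_rho is [(x, rho x + sqrt (1 - rho^2) x')] with [x] and [x']
   independent; [u] and [v] are the directions of its two entries. *)
Definition udir (z : gpairs R D) : 'I_D -> R := unitv (fstv z).
Definition vdir (z : gpairs R D) : 'I_D -> R :=
  unitv (combv rho (Num.sqrt (1 - rho ^+ 2)) (fstv z) (sndv z)).

Let tame_dir (U : gpairs R D -> 'I_D -> R) (i : 'I_n) :
  (forall j, tame wW (fun z => U z j)) ->
  tame (wprod wG wW) (fun u => rowf (lin (U u.2)) u.1 i).
Proof.
move=> tU; apply: tame_sum => [|j _]; first exact: (weight_ge1 wPW).
apply: tameM; last exact: (tame_snd wPG wWP (tU j)).
apply: (tame_fst wPG wWP (f := fun G : gmat R n D => gcoord (tnth G i) j)).
apply: (tame_tnth wgn i (f := fun g => gcoord g j)).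
exact: (tame_tnth (weight_gauss R) j (tame_gauss_id R)).
Qed.

Lemma tame_udir j : tame wW (fun z => udir z j).
Proof. by apply: tame_unitv => i; have [] := @tame_fstv R D i. Qed.

Lemma tame_vdir j : tame wW (fun z => vdir z j).
Proof. by apply: tame_unitv => i; exact: measurable_rotv. Qed.

Variable B : {set 'I_n} -> {set 'I_n} -> R.

Definition sketchform (u : gmat R n D * gpairs R D) : R :=
  polar B (rowf (lin (udir u.2)) u.1) (rowf (lin (vdir u.2)) u.1).

Lemma tame_sketchform : tame (wprod wG wW) sketchform.
Proof.
have w1 := weight_ge1 wPW.
apply: tame_sum => // S _; apply: tame_sum => // S' _; apply: tameZ; apply: tameM.
  by apply: tame_prod => i _; apply: tame_dir => j; exact: tame_udir.
by apply: tame_prod => i _; apply: tame_dir => j; exact: tame_vdir.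
Qed.

Definition sketchmean (G : gmat R n D) : R := mean W (fun z => sketchform (G, z)).

Lemma tame_sketchmean : tame wG sketchmean.
Proof. exact: (tame_mean2 wPG wWP tame_sketchform). Qed.

Variables (K K' : finType) (cM : K -> {set 'I_n} -> R) (cN : K' -> {set 'I_n} -> R).
Variable dg : nat.
Hypothesis cM0 : forall j (S : {set 'I_n}), (dg < #|S|)%N -> cM j S = 0.
Hypothesis cN0 : forall j (S : {set 'I_n}), (dg < #|S|)%N -> cN j S = 0.

Definition coefnorm (L : finType) (c : L -> {set 'I_n} -> R) : R :=
  \sum_(S : {set 'I_n}) \sum_j c j S ^+ 2.

Lemma coefnorm_ge0 (L : finType) (c : L -> {set 'I_n} -> R) : 0 <= coefnorm c.
Proof. by apply: sumr_ge0 => S _; apply: sumr_ge0 => j _; exact: sqr_ge0. Qed.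

Lemma mean_lin_sqnorm_sqr (L : finType) (c : L -> {set 'I_n} -> R) u :
  dotp u u <= 1 -> (forall j (S : {set 'I_n}), (dg < #|S|)%N -> c j S = 0) ->
  mean PG (fun G => sqnorm c (rowf (lin u) G) ^+ 2) <= 9 ^+ dg * coefnorm c ^+ 2.
Proof.
move=> u1 c0.
apply: (@mean_sqnorm_sqr_le_deg _ _ _ gn wg wgn (lin u) (dotp u u)) => //.
- exact: tame_lin.
- by rewrite dotp_ge0.
- exact: mean_lin.
- by under eq_fun do rewrite expr2; exact: mean_lin2.
- by under eq_fun do rewrite exprSr expr2; exact: mean_lin3.
- under eq_fun do rewrite (exprD _ 2 2) expr2.
  by rewrite mean_lin4; ring.
Qed.

Hypothesis BMN : forall x y, polar B x y ^+ 2 <= sqnorm cM x * sqnorm cN y.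

(** [BMN] replaces the square by a product of two squared norms; Cauchy-Schwarz over G separates
    them, and Bonami's inequality bounds each second moment. *)
Lemma mean_sketchform_sqr z :
  mean PG (fun G => sketchform (G, z) ^+ 2) <= 9 ^+ dg * (coefnorm cM * coefnorm cN).
Proof.
pose a G := sqnorm cM (rowf (lin (udir z)) G); pose b G := sqnorm cN (rowf (lin (vdir z)) G).
have ta : tame wG a by apply: (tame_sqnorm wgn); exact: tame_lin.
have tb : tame wG b by apply: (tame_sqnorm wgn); exact: tame_lin.
apply: (@le_trans _ _ (mean PG (fun G => a G * b G))).
  apply: (mean_le wPG); last by move=> G; exact: BMN.
    by apply: tameX; exact: (tame_section1 wWP _ tame_sketchform).
  exact: tameM.
have Ha : mean PG (fun G => a G ^+ 2) <= 9 ^+ dg * coefnorm cM ^+ 2.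
  by apply: mean_lin_sqnorm_sqr => //; exact: dotp_unitv_le1.
have Hb : mean PG (fun G => b G ^+ 2) <= 9 ^+ dg * coefnorm cN ^+ 2.
  by apply: mean_lin_sqnorm_sqr => //; exact: dotp_unitv_le1.
have := mean_cauchy_schwarz wPG ta tb; set m := mean _ (fun G => a G * b G) => H.
have V0 : 0 <= 9 ^+ dg * (coefnorm cM * coefnorm cN).
  by rewrite mulr_ge0 ?exprn_ge0// mulr_ge0 ?coefnorm_ge0.
have : m ^+ 2 <= (9 ^+ dg * (coefnorm cM * coefnorm cN)) ^+ 2.
  apply: le_trans H _.
  rewrite [leRHS](_ : _ = (9 ^+ dg * coefnorm cM ^+ 2) * (9 ^+ dg * coefnorm cN ^+ 2)).
    by apply: ler_pM => //; apply: mean_ge0 => G; exact: sqr_ge0.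
  by ring.
have m0 : 0 <= m by apply: mean_ge0 => G; rewrite mulr_ge0// sqnorm_ge0.
by rewrite ler_pXn2r// nnegrE.
Qed.

(** Tensorizing [row_cov_rowcorr] leaves the two variances, each at most the second moment just
    bounded. *)
Lemma cov_sketchform z z' :
  cov PG (fun G => sketchform (G, z)) (fun G => sketchform (G, z')) <=
  rowcorr2 (z, z') * (9 ^+ dg * (coefnorm cM * coefnorm cN)).
Proof.
have tl u : tame wg (lin u) by exact: tame_lin.
have s0 := rowcorr_ge0 (fstv z) (sndv z) (fstv z') (sndv z').
have H := tensor_cov wgn (tl (udir z)) (tl (vdir z)) (tl (udir z')) (tl (vdir z'))
  s0 (row_cov_rowcorr _ _ _ _ D0 rho01) (biaffine_polar B) (biaffine_polar B).
move: H; cbv zeta => H.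
have covle z0 : cov PG (fun G => sketchform (G, z0)) (fun G => sketchform (G, z0)) <=
    9 ^+ dg * (coefnorm cM * coefnorm cN).
  apply: le_trans (mean_sketchform_sqr z0); rewrite /cov.
  have -> : (fun G => sketchform (G, z0) * sketchform (G, z0)) =
            (fun G => sketchform (G, z0) ^+ 2) by apply/funext => G; rewrite expr2.
  by rewrite -expr2 gerBl sqr_ge0.
have := covle z; have := covle z'.
set V := 9 ^+ dg * _; rewrite /rowcorr2 /=.
move: H; rewrite -/(sketchform _).
set c := cov PG _ _; set c1 := cov PG _ _; set c2 := cov PG _ _.
set s := rowcorr _ _ _ _ in s0 *.
move=> H h2 h1.
have : s * (c1 + c2) <= s * (2 * V) by rewrite ler_wpM2l//; lra.
rewrite /sketchform /= -/c; lra.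
Qed.

Theorem cov_sketchmean :
  cov PG sketchmean sketchmean <=
  58 / Num.sqrt D%:R * (9 ^+ dg * (coefnorm cM * coefnorm cN)).
Proof.
apply: le_trans (cov_mean_le wPG wWP tame_sketchform (tame_rowcorr2 R D) cov_sketchform) _.
rewrite ler_wpM2r ?mean_rowcorr2// mulr_ge0 ?exprn_ge0// mulr_ge0 ?coefnorm_ge0//.
Qed.

End Sketch.

Section SketchMean.
Variables (R : realType) (n D : nat).
Hypothesis D0 : (0 < D)%N.
Notation gn := (gaussn R D).
Notation PG := (prob_pow gn n).
Notation W := (gpairn R D).
Notation wW := (wpow (@gpairw R) D).
Let wWP : weight W wW := weight_gpairn R D.
Variables (rho : R) (B : {set 'I_n} -> {set 'I_n} -> R).

Lemma mean_sketchmean :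
  mean PG (sketchmean rho B (D:=D)) =
  \sum_(S : {set 'I_n}) B S S * mean W (fun z => cosv rho z ^+ #|S|).
Proof.
rewrite /sketchmean (mean_swap (weight_pow (weight_gaussn R D) n) wWP (tame_sketchform D rho B)).
have E z : mean PG (fun G => sketchform rho B (G, z)) =
    \sum_(S : {set 'I_n}) B S S * cosv rho z ^+ #|S|.
  exact: (@mean_polar _ _ _ gn _ (weight_gaussn R D) n B (lin (udir z)) (lin (vdir rho z))
    (cosv rho z) (tame_lin _) (tame_lin _) (mean_lin _) (mean_lin _) (mean_lin2 _ _)).
under eq_fun do rewrite E.
have tc (S : {set 'I_n}) : tame wW (fun z => cosv rho z ^+ #|S|).
  by apply: tameX; exact: tame_cosv.
rewrite (mean_sum wWP) => [|S _]; last exact: tameZ.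
by apply: eq_bigr => S _; rewrite (meanZ wWP _ (tc S)).
Qed.

Lemma expr_dist_le (a b : R) m : `|a| <= 1 -> `|b| <= 1 ->
  `|a ^+ m - b ^+ m| <= m%:R * `|a - b|.
Proof.
move=> a1 b1; elim: m => [|m IH]; first by rewrite !expr0 subrr normr0 mul0r.
rewrite (_ : a ^+ m.+1 - b ^+ m.+1 = a * (a ^+ m - b ^+ m) + (a - b) * b ^+ m); last first.
  by rewrite !exprS; ring.
rewrite (le_trans (ler_normD _ _))// !normrM -natr1 mulrDl mul1r lerD//.
  by rewrite (le_trans _ IH)// ler_piMl.
by rewrite ler_piMr// normrX exprn_ile1.
Qed.

(** Only the diagonal of [B] contributes to the mean, and powers of two numbers in [-1, 1] differ by
    at most |S| times their distance, where |S| <= dg on the support of [m]. *)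
Lemma mean_sketchmean_dev dg (m : {set 'I_n} -> R) : 0 <= rho <= 1 ->
  (forall S, `|B S S| <= m S) -> (forall S : {set 'I_n}, (dg < #|S|)%N -> m S = 0) ->
  `|mean PG (sketchmean rho B (D:=D)) - (\sum_(S : {set 'I_n}) B S S * rho ^+ #|S|) | <=
  (\sum_S m S) * (dg%:R * (12 / Num.sqrt D%:R)).
Proof.
move=> r01 Bm m0; rewrite mean_sketchmean -sumrB.
apply: le_trans (ler_norm_sum _ _ _) _; rewrite mulr_suml; apply: ler_sum => S _.
rewrite -mulrBr normrM.
have mS : 0 <= m S by apply: le_trans (Bm S).
have [Sd|Sd] := leqP #|S| dg; last first.
  by have := Bm S; rewrite m0// ; rewrite normr_le0 => /eqP ->; rewrite normr0 !mul0r.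
apply: ler_pM => //.
have ww1 := weight_ge1 wWP.
have tcos := tame_cosv D rho.
have tc : tame wW (fun=> rho ^+ #|S|) by exact: tame_cst.
have tcr : tame wW (fun z => cosv rho z - rho).
  by apply: tameB => //; exact: tame_cst.
rewrite -[X in _ - X](mean_cst W) -(meanB wWP (tameX _ tcos) tc).
apply: le_trans (mean_norm wWP _) _; first exact: (tameB ww1 (tameX _ tcos) tc).
apply: (@le_trans _ _ (mean W (fun z => dg%:R * `|cosv rho z - rho|))).
  apply: (mean_le wWP); [|by apply: tameZ; exact: tame_norm|move=> z].
    by apply: tame_norm; exact: (tameB ww1 (tameX _ tcos) tc).
  have c1 : `|cosv rho z| <= 1.
    have := normr_dotp_le (unitv (fstv z)) (unitv (combv rho (Num.sqrt (1 - rho ^+ 2)) (fstv z) (sndv z))).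
    have := dotp_unitv_le1 (fstv z).
    have := dotp_unitv_le1 (combv rho (Num.sqrt (1 - rho ^+ 2)) (fstv z) (sndv z)).
    rewrite -/(cosv rho z); lra.
  have r1 : `|rho| <= 1 by case/andP: r01 => r0 r1; rewrite ger0_norm.
  by rewrite (le_trans (expr_dist_le _ c1 r1))// ler_wpM2r// ler_nat.
rewrite (meanZ wWP); last exact: tame_norm.
by rewrite ler_wpM2l// mean_cosv_dev.
Qed.

End SketchMean.

(** * Hermitian matrices and states *)

Section ComplexParts.
Variable R : realType.
Local Notation C := R[i].
Local Open Scope complex_scope.
Notation Rec := (@complex.Re R).
Notation Imc := (@complex.Im R).

Lemma RecD (x y : C) : Rec (x + y) = Rec x + Rec y.
Proof. by case: x; case: y. Qed.

Lemma ImcD (x y : C) : Imc (x + y) = Imc x + Imc y.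
Proof. by case: x; case: y. Qed.

Lemma Rec_sum I (r : seq I) (F : I -> C) :
  Rec (\sum_(i <- r) F i) = \sum_(i <- r) Rec (F i).
Proof. by apply: (big_morph Rec RecD). Qed.

Lemma Imc_sum I (r : seq I) (F : I -> C) :
  Imc (\sum_(i <- r) F i) = \sum_(i <- r) Imc (F i).
Proof. by apply: (big_morph Imc ImcD). Qed.

Lemma RecZ (a : R) (z : C) : Rec (a%:C * z) = a * Rec z.
Proof. by case: z => x y /=; rewrite mul0r subr0. Qed.

Lemma ImcZ (a : R) (z : C) : Imc (a%:C * z) = a * Imc z.
Proof. by case: z => x y /=; rewrite mul0r addr0. Qed.

Lemma RecM (x y : C) : Rec (x * y) = Rec x * Rec y - Imc x * Imc y.
Proof. by case: x; case: y. Qed.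

Lemma ImcM (x y : C) : Imc (x * y) = Rec x * Imc y + Imc x * Rec y.
Proof. by case: x => a b; case: y. Qed.

Lemma natC (m : nat) : (m%:R : C) = (m%:R : R)%:C.
Proof. by rewrite rmorph_nat. Qed.

Lemma invC (a : R) : (a%:C)^-1 = (a^-1)%:C :> C.
Proof. by rewrite fmorphV. Qed.

Lemma conjCE (z : C) : Num.conj z = (Rec z) -i* (Imc z).
Proof. by case: z. Qed.

Lemma conjC_real (a : R) : Num.conj a%:C = a%:C :> C.
Proof. by rewrite conjCE /= oppr0. Qed.

End ComplexParts.

Section Hermitian.
Variable R : realType.
Local Notation C := R[i].
Local Open Scope complex_scope.
Local Open Scope sesquilinear_scope.
Notation Rec := (@complex.Re R).
Notation Imc := (@complex.Im R).

Lemma hermE m (H : 'M[C]_m) : H \is hermsymmx -> H ^t* = H.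
Proof. by move/is_hermitianmxP; rewrite expr0 scale1r => {1}->; rewrite trmxCK. Qed.

Lemma hermP m (H : 'M[C]_m) : H ^t* = H -> H \is hermsymmx.
Proof. by move=> h; apply/is_hermitianmxP; rewrite expr0 scale1r h. Qed.

Lemma herm_entry m (H : 'M[C]_m) i j : H \is hermsymmx -> H j i = Num.conj (H i j).
Proof. by move/hermE => {1}<-; rewrite !mxE. Qed.

(** Real coordinates of a complex matrix. On Hermitian matrices the trace pairing becomes the real
    dot product, so that the inequalities for real vectors apply. *)
Definition flat m (H : 'M[C]_m) (k : 'I_m * 'I_m * bool) : R :=
  if k.2 then Rec (H k.1.1 k.1.2) else Imc (H k.1.1 k.1.2).

Lemma sum_flat m (F : 'I_m * 'I_m * bool -> R) :
  \sum_k F k = \sum_i \sum_j (F (i, j, true) + F (i, j, false)).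
Proof.
rewrite pair_big /=.
rewrite (eq_bigr (fun p : 'I_m * 'I_m => \sum_b F (p, b))) => [|[i j] _]; last first.
  by rewrite big_bool.
by rewrite pair_big; apply: eq_bigr => -[[i j] b].
Qed.

Lemma Rec_tr_herm m (X Y : 'M[C]_m) : Y \is hermsymmx ->
  Rec (\tr (X *m Y)) = \sum_k flat X k * flat Y k.
Proof.
move=> hY; rewrite sum_flat /mxtrace Rec_sum; apply: eq_bigr => i _.
rewrite mxE Rec_sum; apply: eq_bigr => j _.
by rewrite (herm_entry i j hY) conjCE /flat /= RecM /= mulrN opprK.
Qed.

Lemma Imc_tr_herm m (X Y : 'M[C]_m) : X \is hermsymmx -> Y \is hermsymmx ->
  Imc (\tr (X *m Y)) = 0.
Proof.
move=> hX hY.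
have : Num.conj (\tr (X *m Y)) = \tr (X *m Y).
  rewrite -[in RHS](hermE hX) -[in RHS](hermE hY) -map_mxM -trmx_mul mxtrace_mulC.
  by rewrite /mxtrace rmorph_sum; apply: eq_bigr => i _; rewrite !mxE.
by rewrite conjCE; case: (\tr _) => a b /= [] /eqP; rewrite eqNr => /eqP ->.
Qed.

Lemma hnorm2_sqr m (H : 'M[C]_m) : H \is hermsymmx ->
  hnorm2 H ^+ 2 = m%:R^-1 * \sum_k flat H k ^+ 2.
Proof.
move=> hH; rewrite /hnorm2 /hdot natC invC RecZ Rec_tr_herm//.
rewrite sqr_sqrtr; last first.
  rewrite mulr_ge0 ?invr_ge0//; apply: sumr_ge0 => k _.
  by rewrite -expr2 sqr_ge0.
by congr (_ * _); apply: eq_bigr => k _; rewrite expr2.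
Qed.

Lemma herm_sum I (r : seq I) m (c : I -> R) (F : I -> 'M[C]_m) :
  (forall i, F i \is hermsymmx) -> \sum_(i <- r) (c i)%:C *: F i \is hermsymmx.
Proof.
move=> hF; apply: hermP; elim: r => [|i r IH].
  by rewrite big_nil trmx0 map_mx0.
rewrite big_cons linearD /= map_mxD IH; congr (_ + _).
rewrite linearZ /= map_mxZ (hermE (hF i)); congr (_ *: _).
exact: conjC_real.
Qed.

Lemma herm_tens m n (X : 'M[C]_m) (Y : 'M[C]_n) :
  X \is hermsymmx -> Y \is hermsymmx -> X *t Y \is hermsymmx.
Proof.
move=> hX hY; apply: hermP; rewrite trmx_tens.
apply/matrixP => i j; rewrite !mxE rmorphM.
by congr (_ * _); apply/esym; exact: herm_entry.
Qed.

Lemma herm_scale m (c : R) (X : 'M[C]_m) : X \is hermsymmx -> c%:C *: X \is hermsymmx.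
Proof.
move=> hX; apply: hermP; rewrite linearZ /= map_mxZ (hermE hX); congr (_ *: _).
exact: conjC_real.
Qed.

Lemma herm_add m (X Y : 'M[C]_m) :
  X \is hermsymmx -> Y \is hermsymmx -> X + Y \is hermsymmx.
Proof.
by move=> hX hY; apply: hermP; rewrite linearD /= map_mxD (hermE hX) (hermE hY).
Qed.

Lemma sum_tens m n (F : 'I_(m * n) -> C) :
  \sum_k F k = \sum_i \sum_j F (mxtens_index (i, j)).
Proof.
rewrite pair_big /= (reindex (@mxtens_index m n)) /=; last first.
  by exists (@mxtens_unindex m n) => k _; [exact: mxtens_indexK|exact: mxtens_unindexK].
by apply: eq_bigr => -[i j].
Qed.

Lemma tr_tens m n (X : 'M[C]_m) (Y : 'M[C]_n) : \tr (X *t Y) = \tr X * \tr Y.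
Proof.
rewrite /mxtrace sum_tens mulr_suml; apply: eq_bigr => i _.
by rewrite mulr_sumr; apply: eq_bigr => j _; rewrite tensmxE.
Qed.

Lemma tr_tens1 m n (X : 'M[C]_m) (D : 'M[C]_(m * n)) :
  \tr ((X *t 1%:M) *m D) = \tr (X *m marginal1 D).
Proof.
rewrite /mxtrace sum_tens; apply: eq_bigr => i _.
under eq_bigr do rewrite mxE sum_tens.
rewrite mxE exchange_big; apply: eq_bigr => i' _ /=.
rewrite mxE mulr_sumr; apply: eq_bigr => j _.
rewrite (bigD1 j)//= tensmxE mxE eqxx mulr1 big1 ?addr0// => j' j'j.
by rewrite tensmxE mxE eq_sym (negPf j'j) mulr0 mul0r.
Qed.

Lemma tr_tens2 m n (Y : 'M[C]_n) (D : 'M[C]_(m * n)) :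
  \tr ((1%:M *t Y) *m D) = \tr (Y *m marginal2 D).
Proof.
rewrite /mxtrace sum_tens exchange_big; apply: eq_bigr => j _ /=.
under eq_bigr do rewrite mxE sum_tens exchange_big.
rewrite mxE exchange_big; apply: eq_bigr => j' _ /=.
rewrite mxE mulr_sumr; apply: eq_bigr => i _.
rewrite (bigD1 i)//= tensmxE mxE eqxx mul1r big1 ?addr0// => i' i'i.
by rewrite tensmxE mxE eq_sym (negPf i'i) mul0r mul0r.
Qed.

Definition psdmx m (D : 'M[C]_m) : Prop := forall v : 'cV[C]_m, 0 <= (v ^t* *m D *m v) 0 0.

Lemma psd_tr m k (D : 'M[C]_m) (A : 'M[C]_(k, m)) : psdmx D -> 0 <= \tr (A *m D *m A ^t*).
Proof.
move=> pD; apply: sumr_ge0 => i _; have := pD ((row i A) ^t*).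
suff -> : ((row i A) ^t* ^t* *m D *m (row i A) ^t*) 0 0 = (A *m D *m A ^t*) i i by [].
rewrite trmxCK -row_mul mxE [RHS]mxE; apply: eq_bigr => j _.
by rewrite !mxE.
Qed.

Lemma quad_discr_le (a b c : R) : 0 <= c ->
  (forall x y, 0 <= x ^+ 2 * a + 2 * x * y * b + y ^+ 2 * c) -> b ^+ 2 <= a * c.
Proof.
move=> c0 key; have [c00|cN0] := eqVneq c 0.
  have [->|b0] := eqVneq b 0; first by rewrite c00 expr0n mulr0.
  have := key 1 (- (a + 1) / b); rewrite c00 mulr0 addr0 expr1n mul1r mulr1.
  by rewrite -!mulrA mulVf// mulr1; have := key 1 0; lra.
have cp : 0 < c by rewrite lt_neqAle eq_sym cN0.
have := key c (- b) => H.
have : 0 <= c * (a * c - b ^+ 2) by nra.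
by rewrite pmulr_rge0// subr_ge0.
Qed.

Lemma Rec_tr_quad m (x y : R) (U V D : 'M[C]_m) :
  Rec (\tr ((x%:C *: U + y%:C *: V) *m (x%:C *: U + y%:C *: V) *m D)) =
  x ^+ 2 * Rec (\tr (U *m U *m D)) + x * y * Rec (\tr (U *m V *m D))
  + x * y * Rec (\tr (V *m U *m D)) + y ^+ 2 * Rec (\tr (V *m V *m D)).
Proof.
have RtD (X Y Z : 'M[C]_m) :
    Rec (\tr ((X + Y) *m Z)) = Rec (\tr (X *m Z)) + Rec (\tr (Y *m Z)).
  by rewrite mulmxDl mxtraceD RecD.
have RtZ (a : R) (X Z : 'M[C]_m) :
    Rec (\tr ((a%:C *: X) *m Z)) = a * Rec (\tr (X *m Z)).
  by rewrite -scalemxAl mxtraceZ RecZ.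
have half (X : 'M[C]_m) : Rec (\tr (X *m (x%:C *: U + y%:C *: V) *m D)) =
    x * Rec (\tr (X *m U *m D)) + y * Rec (\tr (X *m V *m D)).
  have rot (Y : 'M[C]_m) : \tr (X *m Y *m D) = \tr (Y *m (D *m X)).
    by rewrite -mulmxA mxtrace_mulC mulmxA.
  by rewrite !rot RtD !RtZ.
rewrite -mulmxA RtD !RtZ !mulmxA !half.
set a := Rec _; set b := Rec _; set c := Rec _; set d := Rec _.
by clearbody a b c d; ring.
Qed.

(* Cauchy-Schwarz for the semi-inner product Tr(A* B D) and the commuting
   operators M (x) 1 and 1 (x) N. *)
Lemma tr_tens_sqr_le m n (M : 'M[C]_m) (N : 'M[C]_n) (D : 'M[C]_(m * n)) :
  M \is hermsymmx -> N \is hermsymmx -> psdmx D ->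
  marginal1 D = (m%:R^-1)%:M -> marginal2 D = (n%:R^-1)%:M ->
  Rec (\tr ((M *t N) *m D)) ^+ 2 <= hnorm2 M ^+ 2 * hnorm2 N ^+ 2.
Proof.
move=> hM hN pD m1 m2.
have h1 k : (1%:M : 'M[C]_k) \is hermsymmx.
  by apply: hermP; rewrite trmx1 map_mx1.
have nE k (X : 'M[C]_k) : X \is hermsymmx -> hnorm2 X ^+ 2 = Rec (k%:R^-1 * \tr (X *m X)).
  by move=> hX; rewrite hnorm2_sqr// natC invC RecZ Rec_tr_herm.
have t1 : Rec (\tr (((M *m M) *t 1%:M) *m D)) = hnorm2 M ^+ 2.
  by rewrite tr_tens1 m1 nE// mul_mx_scalar mxtraceZ.
have t2 : Rec (\tr ((1%:M *t (N *m N)) *m D)) = hnorm2 N ^+ 2.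
  by rewrite tr_tens2 m2 nE// mul_mx_scalar mxtraceZ.
apply: quad_discr_le; first exact: sqr_ge0.
move=> x y; rewrite -t1 -t2.
pose A := x%:C *: (M *t 1%:M) + y%:C *: (1%:M *t N).
have hA : A \is hermsymmx.
  by apply: herm_add; apply: herm_scale; apply: herm_tens.
have := psd_tr A pD; rewrite (hermE hA) mxtrace_mulC mulmxA.
rewrite lecE => /andP[_]; rewrite Rec_tr_quad !tensmx_mul !mulmx1 !mul1mx.
set a := Rec _; set b := Rec _; set c := Rec _; clearbody a b c.
by move=> H; rewrite (le_trans H)// le_eqVlt; apply/orP; left; apply/eqP => /=; ring.
Qed.
End Hermitian.

(** * Quantum states, their tensor powers and the joint state *)

Section States.
Variable R : realType.
Local Notation C := R[i].
Local Open Scope complex_scope.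
Local Open Scope sesquilinear_scope.
Notation Rec := (@complex.Re R).
Notation Imc := (@complex.Im R).

Lemma psd_spectral m (D : 'M[C]_m) : D \is hermsymmx -> psdmx D ->
  exists (U : 'M[C]_m) (e : 'I_m -> R),
    [/\ U *m U ^t* = 1%:M, forall l, 0 <= e l
      & D = U ^t* *m diag_mx (\row_l (e l)%:C) *m U].
Proof.
move=> hD pD; pose U := spectralmx D; pose e l := Rec (spectral_diag D 0 l).
have uU : U \is unitarymx := spectral_unitarymx D.
have eE l : spectral_diag D 0 l = (e l)%:C.
  have := hermitian_spectral_diag_real hD => /mxOverP /(_ 0 l) /RRe_real <- //.
have DE : D = U ^t* *m diag_mx (\row_l (e l)%:C) *m U.
  have /orthomx_spectralP {1}-> := hermitian_normalmx hD.
  rewrite invmx_unitary//; congr (_ *m diag_mx _ *m _).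
  by apply/rowP => l; rewrite mxE eE.
exists U, e; split=> //; first exact/unitarymxP.
move=> l; have := pD ((row l U) ^t*).
rewrite trmxCK DE -!mulmxA -row_mul.
have -> : U *m (U ^t* *m (diag_mx (\row_l (e l)%:C) *m (U *m (row l U) ^t*))) =
   diag_mx (\row_l (e l)%:C) *m (U *m (row l U) ^t*).
  by rewrite mulmxA (unitarymxP uU) mul1mx.
have -> : U *m (row l U) ^t* = (row l (1%:M : 'M[C]_m)) ^t*.
  rewrite -(unitarymxP uU) row_mul.
  by rewrite trmx_mul map_mxM trmxCK.
rewrite !mxE (bigD1 l)//= big1 => [|k kl]; last first.
  by rewrite !mxE eq_sym (negPf kl) conjC0 mulr0.
by rewrite !mxE !eqxx mulr1n conjC1 mulr1 addr0 lecR.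
Qed.

Lemma psd_entry m (D U : 'M[C]_m) (e : 'I_m -> R) i j :
  D = U ^t* *m diag_mx (\row_l (e l)%:C) *m U ->
  D i j = \sum_l (e l)%:C * (Num.conj (U l i) * U l j).
Proof.
move=> ->; rewrite mxE; apply: eq_bigr => l _.
by rewrite mul_mx_diag !mxE mulrA [_ * (e l)%:C]mulrC.
Qed.

(** Tr D^2 <= (Tr D)^2, the eigenvalues being nonnegative. *)
Lemma state_flat_le1 m (D : 'M[C]_m) : quantum_state D -> \sum_k flat D k ^+ 2 <= 1.
Proof.
move=> [hD pD tD].
have -> : \sum_k flat D k ^+ 2 = Rec (\tr (D *m D)).
  by rewrite Rec_tr_herm//; apply: eq_bigr => k _; rewrite expr2.
have [U [e [uU e0 DE]]] := psd_spectral hD pD.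
pose E := diag_mx (\row_l (e l)%:C).
have tE : \tr D = \tr E by rewrite DE mxtrace_mulC mulmxA uU mul1mx.
have -> : \tr (D *m D) = \tr (E *m E).
  rewrite DE -/E !mulmxA -(mulmxA _ U) uU mulmx1 -(mulmxA _ E E).
  by rewrite mxtrace_mulC (mulmxA U) uU mul1mx.
have sE : \sum_l e l = 1.
  have : Rec (\tr D) = 1 by rewrite tD.
  by rewrite tE mxtrace_diag Rec_sum; under eq_bigr do rewrite mxE.
have -> : Rec (\tr (E *m E)) = \sum_l e l ^+ 2.
  rewrite /mxtrace Rec_sum; apply: eq_bigr => l _.
  by rewrite mul_diag_mx !mxE eqxx mulr1n -rmorphM /= expr2.
rewrite -[leRHS](expr1n _ 2) -sE expr2 mulr_suml; apply: ler_sum => l _.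
by rewrite expr2 ler_wpM2l// (bigD1 l)//= lerDl sumr_ge0.
Qed.

(** Cauchy-Schwarz against a state of Frobenius norm at most 1. *)
Lemma Rec_tr_state_sqr_le m (X D : 'M[C]_m) : X \is hermsymmx -> quantum_state D ->
  Rec (\tr (X *m D)) ^+ 2 <= Rec (\tr (X *m X)).
Proof.
move=> hX sD; have [hD _ _] := sD; rewrite !Rec_tr_herm//.
apply: le_trans (sqr_sum_mul_le _ _) _.
under [leRHS]eq_bigr do rewrite -expr2.
rewrite ler_piMr//; first by apply: sumr_ge0 => k _; exact: sqr_ge0.
exact: state_flat_le1.
Qed.

Section StatePow.
Variables (s t h : nat) (psi : 'M[C]_(s * t)).

Definition pow_pair (i : 'I_(pow_dim s h)) (j : 'I_(pow_dim t h)) (k : 'I_h) : 'I_(s * t) :=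
  mxtens_index (pow_label i k, pow_label j k).

Lemma state_powE i i' j j' :
  state_pow h psi (mxtens_index (i, i')) (mxtens_index (j, j')) =
  \prod_(k < h) psi (pow_pair i i' k) (pow_pair j j' k).
Proof.
by rewrite mxE; case: mxtens_unindex (mxtens_indexK (i, i')) => _ _ [-> ->];
  case: mxtens_unindex (mxtens_indexK (j, j')) => _ _ [-> ->].
Qed.

Lemma sum_pow_label m (F : {ffun 'I_h -> 'I_m} -> C) :
  \sum_(i < pow_dim m h) F (pow_label i) = \sum_f F f.
Proof.
rewrite [RHS](reindex (@pow_label m h)) //=.
by exists enum_rank => f _; [exact: enum_valK|exact: enum_rankK].
Qed.

(** Expanding each factor spectrally turns the quadratic form into a sum, over choices [f] of one
    eigenvector per factor, of products of eigenvalues times |g f|^2. *)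
Lemma state_pow_psd : psi \is hermsymmx -> psdmx psi -> psdmx (state_pow h psi).
Proof.
move=> hpsi ppsi v; have [U [e [_ e0 psiE]]] := psd_spectral hpsi ppsi.
pose lab (i : 'I_(pow_dim s h * pow_dim t h)) k :=
  pow_pair (mxtens_unindex i).1 (mxtens_unindex i).2 k.
have E i j : state_pow h psi i j = \sum_(f : {ffun 'I_h -> 'I_(s * t)})
    (\prod_k e (f k))%:C * (Num.conj (\prod_k U (f k) (lab i k)) * \prod_k U (f k) (lab j k)).
  rewrite -(mxtens_unindexK i) -(mxtens_unindexK j).
  case: (mxtens_unindex i) (mxtens_unindex j) => i1 i2 [j1 j2].
  rewrite state_powE /lab !mxtens_indexK /=.
  under eq_bigr do rewrite (psd_entry _ _ psiE).
  rewrite bigA_distr_bigA /=; apply: eq_bigr => f _.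
  by rewrite big_split big_split /= rmorph_prod rmorph_prod.
pose g (f : {ffun 'I_h -> 'I_(s * t)}) := \sum_j (\prod_k U (f k) (lab j k)) * v j 0.
have -> : (v ^t* *m state_pow h psi *m v) 0 0 =
    \sum_(f : {ffun 'I_h -> 'I_(s * t)}) (\prod_k e (f k))%:C * (Num.conj (g f) * g f).
  rewrite mxE; under eq_bigr => j _.
    rewrite mxE; under eq_bigr do rewrite E mulr_sumr.
    rewrite exchange_big mulr_suml; over.
  rewrite exchange_big; apply: eq_bigr => f _.
  rewrite /g [in RHS]mulr_sumr mulr_sumr; apply: eq_bigr => j _.
  rewrite rmorph_sum !mulr_suml mulr_sumr; apply: eq_bigr => i _.
  by rewrite !mxE rmorphM; ring.
apply: sumr_ge0 => f _; rewrite mulr_ge0 ?ler0c ?prodr_ge0//.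
by rewrite mulrC mul_conjC_ge0.
Qed.

(** The partial trace of a product is a product of partial traces; distinct labels differ in some
    coordinate, whose factor is zero. *)
Lemma state_pow_marginal1 : marginal1 psi = (s%:R^-1)%:M ->
  marginal1 (state_pow h psi) = ((pow_dim s h)%:R^-1)%:M.
Proof.
move=> m1; apply/matrixP => i j; rewrite mxE.
under eq_bigr do rewrite state_powE.
transitivity (\prod_(k < h) \sum_(l < t)
   psi (mxtens_index (pow_label i k, l)) (mxtens_index (pow_label j k, l))).
  rewrite bigA_distr_bigA /= -(sum_pow_label (fun f => \prod_k
    psi (mxtens_index (pow_label i k, f k)) (mxtens_index (pow_label j k, f k)))).
  by apply: eq_bigr => l _.
under eq_bigr => k _.
  rewrite (_ : \sum_l _ = marginal1 psi (pow_label i k) (pow_label j k)); last by rewrite mxE.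
  rewrite m1 mxE; over.
rewrite mxE; have [<-|ij] := eqVneq i j.
  under eq_bigr do rewrite eqxx mulr1n.
  rewrite prodr_const card_ord mulr1n /pow_dim card_ffun !card_ord.
  by rewrite natrX exprVn.
have [k nk] : exists k, pow_label i k != pow_label j k.
  apply/existsP; apply: contra_neqT ij => /existsPn H.
  apply: enum_val_inj; apply/ffunP => k; apply/eqP; have := H k; rewrite negbK.
  by [].
by rewrite (bigD1 k)//= (negPf nk) mulr0n mul0r.
Qed.

Lemma state_pow_marginal2 : marginal2 psi = (t%:R^-1)%:M ->
  marginal2 (state_pow h psi) = ((pow_dim t h)%:R^-1)%:M.
Proof.
move=> m1; apply/matrixP => i j; rewrite mxE.
under eq_bigr do rewrite state_powE.
transitivity (\prod_(k < h) \sum_(l < s)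
   psi (mxtens_index (l, pow_label i k)) (mxtens_index (l, pow_label j k))).
  rewrite bigA_distr_bigA /= -(sum_pow_label (fun f => \prod_k
    psi (mxtens_index (f k, pow_label i k)) (mxtens_index (f k, pow_label j k)))).
  by apply: eq_bigr => l _.
under eq_bigr => k _.
  rewrite (_ : \sum_l _ = marginal2 psi (pow_label i k) (pow_label j k)); last by rewrite mxE.
  rewrite m1 mxE; over.
rewrite mxE; have [<-|ij] := eqVneq i j.
  under eq_bigr do rewrite eqxx mulr1n.
  rewrite prodr_const card_ord mulr1n /pow_dim card_ffun !card_ord.
  by rewrite natrX exprVn.
have [k nk] : exists k, pow_label i k != pow_label j k.
  apply/existsP; apply: contra_neqT ij => /existsPn H.
  apply: enum_val_inj; apply/ffunP => k; apply/eqP; have := H k; rewrite negbK.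
  by [].
by rewrite (bigD1 k)//= (negPf nk) mulr0n mul0r.
Qed.

Lemma state_pow_herm : psi \is hermsymmx -> state_pow h psi \is hermsymmx.
Proof.
move=> hpsi; apply: hermP; apply/matrixP => i j; rewrite !mxE.
case: (mxtens_unindex i) => i1 i2; case: (mxtens_unindex j) => j1 j2.
rewrite rmorph_prod; apply: eq_bigr => k _.
by apply/esym; exact: herm_entry.
Qed.

End StatePow.

Lemma joint_stateE s t p q r (phi : 'M[C]_(p * q * r)) (chi : 'M[C]_(s * t))
    iS iT iP iQ iR jS jT jP jQ jR :
  joint_state phi chi
    (mxtens_index (mxtens_index (mxtens_index (iS, iP), mxtens_index (iT, iQ)), iR))
    (mxtens_index (mxtens_index (mxtens_index (jS, jP), mxtens_index (jT, jQ)), jR)) =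
  phi (mxtens_index (mxtens_index (iP, iQ), iR)) (mxtens_index (mxtens_index (jP, jQ), jR))
  * chi (mxtens_index (iS, iT)) (mxtens_index (jS, jT)).
Proof.
by rewrite mxE !mxtens_indexK.
Qed.

Lemma sum_tens2 m n (F : 'I_(m * n) -> C) :
  \sum_k F k = \sum_(x : 'I_m * 'I_n) F (mxtens_index x).
Proof.
rewrite (reindex (@mxtens_index m n)) //=.
by exists (@mxtens_unindex m n) => k _; [exact: mxtens_indexK|exact: mxtens_unindexK].
Qed.

Lemma sum_tens3 p q r (F : 'I_(p * q * r) -> C) :
  \sum_k F k = \sum_(x : 'I_p * 'I_q * 'I_r) F (mxtens_index (mxtens_index x.1, x.2)).
Proof.
by rewrite sum_tens sum_tens2 pair_big.
Qed.

(** Groups the indices by state, ST and PQR, while the matrix orders them (SP)(TQ)R. *)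
Definition joint_index s t p q r (x : 'I_s * 'I_t) (y : 'I_p * 'I_q * 'I_r) :
    'I_((s * p) * (t * q) * r) :=
  mxtens_index (mxtens_index (mxtens_index (x.1, y.1.1), mxtens_index (x.2, y.1.2)), y.2).

Lemma sum_joint s t p q r (F : 'I_((s * p) * (t * q) * r) -> C) :
  \sum_k F k = \sum_(x : 'I_s * 'I_t) \sum_(y : 'I_p * 'I_q * 'I_r) F (joint_index x y).
Proof.
pose g (k : 'I_((s * p) * (t * q) * r)) :=
  (((mxtens_unindex (mxtens_unindex (mxtens_unindex k).1).1).1,
    (mxtens_unindex (mxtens_unindex (mxtens_unindex k).1).2).1),
   (((mxtens_unindex (mxtens_unindex (mxtens_unindex k).1).1).2,
     (mxtens_unindex (mxtens_unindex (mxtens_unindex k).1).2).2),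
    (mxtens_unindex k).2)).
rewrite pair_big /= (reindex (fun z : ('I_s * 'I_t) * ('I_p * 'I_q * 'I_r) =>
  joint_index z.1 z.2)) //=.
exists g => [[[xS xT] [[yP yQ] yR]] _|k _].
  by rewrite /g /joint_index; cbn [fst snd]; do ! (rewrite mxtens_indexK; cbn [fst snd]).
rewrite /g /joint_index; cbn [fst snd].
by do ! rewrite -surjective_pairing mxtens_unindexK.
Qed.

Lemma tr_joint s t p q r (M : 'M[C]_s) (N : 'M[C]_t) (X : 'M[C]_p) (Y : 'M[C]_q)
    (Z : 'M[C]_r) (phi : 'M[C]_(p * q * r)) (chi : 'M[C]_(s * t)) :
  \tr (((M *t X) *t (N *t Y) *t Z) *m joint_state phi chi) =
  \tr ((X *t Y *t Z) *m phi) * \tr ((M *t N) *m chi).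
Proof.
rewrite {1}/mxtrace sum_joint.
have E x y : (((M *t X) *t (N *t Y) *t Z) *m joint_state phi chi)
    (joint_index x y) (joint_index x y) =
  (\sum_y' (X *t Y *t Z) (mxtens_index (mxtens_index y.1, y.2)) (mxtens_index (mxtens_index y'.1, y'.2))
     * phi (mxtens_index (mxtens_index y'.1, y'.2)) (mxtens_index (mxtens_index y.1, y.2)))
  * \sum_x' (M *t N) (mxtens_index x) (mxtens_index x') * chi (mxtens_index x') (mxtens_index x).
  rewrite mxE sum_joint mulr_sumr; apply: eq_bigr => -[xS xT] _.
  rewrite mulr_suml; apply: eq_bigr => -[[yP yQ] yR] _.
  case: x y => [uS uT] [[vP vQ] vR].
  by rewrite /joint_index /= joint_stateE !tensmxE; ring.
under eq_bigr do under eq_bigr do rewrite E.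
under eq_bigr do rewrite -mulr_suml.
rewrite -mulr_sumr; congr (_ * _).
  rewrite /mxtrace sum_tens3; apply: eq_bigr => y _.
  by rewrite mxE sum_tens3.
rewrite /mxtrace sum_tens2; apply: eq_bigr => x _.
by rewrite mxE sum_tens2.
Qed.

End States.

(** * Multilinear operators and their sketches *)

Section OperatorPolynomials.
Variable R : realType.
Local Notation C := R[i].
Local Open Scope complex_scope.
Local Open Scope sesquilinear_scope.
Notation Rec := (@complex.Re R).

Definition lincomb n m (A : {set 'I_n} -> 'M[C]_m) (w : 'I_n -> R) : 'M[C]_m :=
  \sum_(S : {set 'I_n}) (\prod_(i in S) w i)%:C *: A S.

(** Scaled so that the squares sum to the normalized norm [hnorm2] squared. *)
Definition coefflat n m (A : {set 'I_n} -> 'M[C]_m) (k : 'I_m * 'I_m * bool)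
    (S : {set 'I_n}) : R := (Num.sqrt m%:R)^-1 * flat (A S) k.

Lemma lincomb_entry n m (A : {set 'I_n} -> 'M[C]_m) w i j :
  lincomb A w i j = \sum_(S : {set 'I_n}) (\prod_(i in S) w i)%:C * A S i j.
Proof. by rewrite /lincomb summxE; apply: eq_bigr => S _; rewrite mxE. Qed.

Lemma flat_lincomb n m (A : {set 'I_n} -> 'M[C]_m) w k :
  flat (lincomb A w) k = multiaff (fun S => flat (A S) k) w.
Proof.
rewrite /flat /multiaff; case: k => [[i j] []] /=; rewrite lincomb_entry.
  by rewrite Rec_sum; apply: eq_bigr => S _; rewrite RecZ mulrC.
by rewrite Imc_sum; apply: eq_bigr => S _; rewrite ImcZ mulrC.
Qed.

Lemma herm_lincomb n m (A : {set 'I_n} -> 'M[C]_m) w :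
  (forall S, A S \is hermsymmx) -> lincomb A w \is hermsymmx.
Proof.
move=> hA; exact: (@herm_sum R _ (index_enum _) m
  (fun S : {set 'I_n} => \prod_(i in S) w i) A hA).
Qed.

Lemma hnorm2_coefflat n m (A : {set 'I_n} -> 'M[C]_m) S : A S \is hermsymmx ->
  hnorm2 (A S) ^+ 2 = \sum_k coefflat A k S ^+ 2.
Proof.
move=> hA; rewrite hnorm2_sqr// mulr_sumr; apply: eq_bigr => k _.
by rewrite exprMn exprVn sqr_sqrtr.
Qed.

Lemma hnorm2_lincomb n m (A : {set 'I_n} -> 'M[C]_m) w :
  (forall S, A S \is hermsymmx) -> hnorm2 (lincomb A w) ^+ 2 = sqnorm (coefflat A) w.
Proof.
move=> hA; rewrite hnorm2_sqr ?herm_lincomb// mulr_sumr; apply: eq_bigr => k _.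
rewrite flat_lincomb -[m%:R in LHS]sqr_sqrtr// -exprVn -exprMn; congr (_ ^+ 2).
by rewrite /multiaff mulr_sumr; apply: eq_bigr => S _; rewrite mulrA.
Qed.

Definition traceform n m k (A : {set 'I_n} -> 'M[C]_m) (A' : {set 'I_n} -> 'M[C]_k)
    (D : 'M[C]_(m * k)) (S S' : {set 'I_n}) : R := Rec (\tr ((A S *t A' S') *m D)).

Lemma tensDl m k (X Y : 'M[C]_m) (Z : 'M[C]_k) : (X + Y) *t Z = X *t Z + Y *t Z.
Proof. by apply/matrixP => i j; rewrite !mxE mulrDl. Qed.

Lemma tensDr m k (X Y : 'M[C]_m) (Z : 'M[C]_k) : Z *t (X + Y) = Z *t X + Z *t Y.
Proof. by apply/matrixP => i j; rewrite !mxE mulrDr. Qed.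

Lemma tensZl m k c (X : 'M[C]_m) (Z : 'M[C]_k) : (c *: X) *t Z = c *: (X *t Z).
Proof. by apply/matrixP => i j; rewrite !mxE mulrA. Qed.

Lemma tensZr m k c (X : 'M[C]_m) (Z : 'M[C]_k) : Z *t (c *: X) = c *: (Z *t X).
Proof. by apply/matrixP => i j; rewrite !mxE mulrCA. Qed.

Lemma tens_suml I (r : seq I) m k (F : I -> 'M[C]_m) (Z : 'M[C]_k) :
  (\sum_(i <- r) F i) *t Z = \sum_(i <- r) F i *t Z.
Proof.
by apply: (big_morph (fun X : 'M[C]_m => X *t Z)) => [X Y|];
  [exact: tensDl|exact: tens0mx].
Qed.

Lemma tens_sumr I (r : seq I) m k (F : I -> 'M[C]_m) (Z : 'M[C]_k) :
  Z *t (\sum_(i <- r) F i) = \sum_(i <- r) Z *t F i.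
Proof.
by apply: (big_morph (fun X : 'M[C]_m => Z *t X)) => [X Y|];
  [exact: tensDr|exact: tensmx0].
Qed.

Lemma trsum I (r : seq I) m (F : I -> 'M[C]_m) :
  \tr (\sum_(i <- r) F i) = \sum_(i <- r) \tr (F i).
Proof. exact: raddf_sum. Qed.

Lemma Rec_tr_lincomb n m k (A : {set 'I_n} -> 'M[C]_m) (A' : {set 'I_n} -> 'M[C]_k) D w w' :
  Rec (\tr ((lincomb A w *t lincomb A' w') *m D)) = polar (traceform A A' D) w w'.
Proof.
rewrite /polar /lincomb tens_suml mulmx_suml trsum Rec_sum; apply: eq_bigr => S _.
rewrite tens_sumr mulmx_suml trsum Rec_sum; apply: eq_bigr => S' _ /=.
rewrite tensZl tensZr -!scalemxAl !mxtraceZ !RecZ /traceform; ring.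
Qed.

Section Degree.
Variables (n s p a : nat).
Hypotheses (p0 : (0 < p)%N) (a0 : (0 < a)%N).
Variables (bP : 'I_(p ^ 2)%N -> 'M[C]_p) (bA : 'I_(a ^ 2)%N -> 'M[C]_a).
Hypotheses (hbP : orthonormal_basis bP) (hbA : orthonormal_basis bA).
Variable MS : {set 'I_n} -> 'I_(p ^ 2)%N -> 'I_(a ^ 2)%N -> 'M[C]_s.
Hypothesis hMS : forall S jp ja, MS S jp ja \is hermsymmx.

Definition opcoef (S : {set 'I_n}) : 'M[C]_(s * p * a) :=
  \sum_ja (\sum_jp MS S jp ja *t tilde (bP jp)) *t tilde (bA ja).

Lemma op_lincomb w : op bP bA MS w = lincomb opcoef w.
Proof.
rewrite /op /lincomb /opcoef.
under [RHS]eq_bigr do rewrite scaler_sumr.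
rewrite exchange_big; apply: eq_bigr => ja _ /=.
rewrite /op_a tens_suml.
under [RHS]eq_bigr do rewrite tens_suml scaler_sumr.
rewrite exchange_big; apply: eq_bigr => jp _ /=.
rewrite /op_pa tens_suml tens_suml; apply: eq_bigr => S _.
by rewrite !tensZl.
Qed.

Lemma herm_tilde m (H : 'M[C]_m) : H \is hermsymmx -> tilde H \is hermsymmx.
Proof. exact: herm_scale. Qed.

Lemma herm_sum1 I (r : seq I) m (F : I -> 'M[C]_m) :
  (forall i, F i \is hermsymmx) -> \sum_(i <- r) F i \is hermsymmx.
Proof.
move=> hF; rewrite (eq_bigr (fun i => (1 : R)%:C *: F i)) ?herm_sum// => i _.
by rewrite scale1r.
Qed.

Lemma herm_opcoef S : opcoef S \is hermsymmx.
Proof.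
case: hbP => hP _ _; case: hbA => hA _ _.
apply: herm_sum1 => ja; apply: herm_tens; last exact: herm_tilde.
by apply: herm_sum1 => jp; apply: herm_tens => //; exact: herm_tilde.
Qed.

(** Setting the first variable to 0 and then to 1 kills the two halves of the polynomial in turn. *)
Lemma multiaff_eq0 m (c : {set 'I_m} -> R) : (forall x, multiaff c x = 0) -> forall S, c S = 0.
Proof.
elim: m c => [|m IH] c c0 S.
  have S0 (S' : {set 'I_0}) : S' = finset.set0 by apply/setP => -[].
  have := c0 (fun=> 0); rewrite /multiaff (bigD1 finset.set0)//= [X in _ + X]big1 => [|S']; last first.
    by rewrite (S0 S') eqxx.
  by rewrite big_set0 mulr1 addr0 (S0 S).
pose ext (b : R) (y : 'I_m -> R) (i : 'I_m.+1) := if unlift ord0 i is Some j then y j else b.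
have ext0 b y : ext b y ord0 = b by rewrite /ext unlift_none.
have extS b y : ext b y \o lift ord0 = y by apply/funext => j; rewrite /= /ext liftK.
have cu : forall S', c (up S') = 0.
  apply: (IH (fun S' => c (up S'))) => y.
  by have := c0 (ext 0 y); rewrite multiaff_recl ext0 extS mul0r addr0.
have cu1 : forall S', c (ord0 |: up S') = 0.
  apply: (IH (fun S' => c (ord0 |: up S'))) => y.
  have := c0 (ext 1 y); rewrite multiaff_recl ext0 extS mul1r.
  by rewrite [X in X + _](big1) ?add0r// => S' _; rewrite cu mul0r.
pose g := finset (fun i => lift ord0 i \in S).
have [S0|S0] := boolP (ord0 \in S).
  suff -> : S = ord0 |: up g by exact: cu1.
  apply/setP => i; rewrite in_setU1; case: (unliftP ord0 i) => [j ->|->].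
    by rewrite mem_up inE.
  by rewrite eqxx S0.
suff -> : S = up g by exact: cu.
apply/setP => i; case: (unliftP ord0 i) => [j ->|->].
  by rewrite mem_up inE.
by rewrite (negPf S0) (negPf (ord0_up _)).
Qed.

(** Pairing with B_j is complex-linear, so orthonormality of a real basis yields independence with
    complex coefficients. These occur because the lemma is applied to matrix entries. *)
Lemma basis_tilde_indep m (B : 'I_(m ^ 2)%N -> 'M[C]_m) (z : 'I_(m ^ 2)%N -> C) :
  (0 < m)%N -> orthonormal_basis B -> \sum_i z i *: tilde (B i) = 0 -> forall i, z i = 0.
Proof.
move=> m0 [hB oB _] z0 j.
have : hdot (B j) (\sum_i z i *: tilde (B i)) = 0.
  by rewrite z0 /hdot mulmx0 mxtrace0 mulr0.
rewrite /hdot mulmx_sumr trsum mulr_sumr (bigD1 j)//= big1 => [|i ij].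
  rewrite addr0 /tilde -!scalemxAr !mxtraceZ mulrCA [_%:R^-1 * _]mulrCA -/(hdot _ _).
  rewrite oB eqxx mulr1 => /eqP; rewrite mulf_eq0 => /orP[/eqP //|].
  by rewrite fmorph_eq0 invr_eq0 sqrtr_eq0 leNgt ltr0n m0.
rewrite /tilde -!scalemxAr !mxtraceZ mulrCA [_%:R^-1 * _]mulrCA -/(hdot _ _).
by rewrite oB eq_sym (negPf ij) !mulr0.
Qed.

Lemma opcoef_eq0 S : opcoef S = 0 -> forall jp ja, MS S jp ja = 0.
Proof.
move=> S0 jp ja; apply/matrixP => i i'; rewrite mxE.
have H1 u u' ja' : (\sum_jp MS S jp ja' *t tilde (bP jp)) u u' = 0.
  apply: (basis_tilde_indep (z := fun ja => (\sum_jp MS S jp ja *t tilde (bP jp)) u u') a0 hbA).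
  apply/matrixP => v v'; rewrite mxE.
  have := congr1 (fun X : 'M[C]_(s * p * a) => X (mxtens_index (u, v)) (mxtens_index (u', v'))) S0.
  rewrite /opcoef summxE [in X in _ = X -> _]mxE => <-.
  by rewrite summxE; apply: eq_bigr => ja'' _; rewrite tensmxE mxE.
apply: (basis_tilde_indep (z := fun jp => MS S jp ja i i') p0 hbP).
apply/matrixP => v v'; rewrite [RHS]mxE -(H1 (mxtens_index (i, v)) (mxtens_index (i', v')) ja).
by rewrite !summxE; apply: eq_bigr => jp' _; rewrite tensmxE mxE.
Qed.

(** The degree hypothesis concerns the coordinates of [M] in some basis, whereas the estimates need
    it for [MS]. Uniqueness of multiaffine coefficients makes every coordinate of [opcoef] vanish
    beyond degree d, and independence of the bases carries this to [MS]. *)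
Lemma degree_coef0 d (M : gvec R n -> 'M[C]_(s * p * a)) :
  multilinear_operator d M -> (forall g, M g = op bP bA MS (gcoord g)) ->
  forall (S : {set 'I_n}) jp ja, (d < #|S|)%N -> MS S jp ja = 0.
Proof.
move=> [B hB polyB] ME S jp ja dS; apply: opcoef_eq0; have [_ oB spanB] := hB.
have [r rE] := spanB _ (herm_opcoef S).
have hdot_r i : r i = Rec (hdot (B i) (opcoef S)).
  rewrite rE /hdot mulmx_sumr trsum mulr_sumr Rec_sum (bigD1 i)//=.
  rewrite big1 => [|j ji]; rewrite -scalemxAr mxtraceZ mulrCA -/(hdot _ _) RecZ oB.
    by rewrite eqxx mulr1 addr0.
  by rewrite eq_sym (negPf ji) mulr0.
rewrite rE big1 // => i _; suff -> : r i = 0 by rewrite scale0r.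
have [c [c0 cE]] := polyB i.
suff : c S - Rec (hdot (B i) (opcoef S)) = 0 by rewrite c0// hdot_r; lra.
move: S {dS rE hdot_r r}; apply: (multiaff_eq0 (c := fun S => c S - Rec (hdot (B i) (opcoef S)))) => x.
pose g : gvec R n := [tuple x j | j < n].
have gx : gcoord g = x by apply/funext => j; rewrite /gcoord tnth_mktuple.
have -> : multiaff (fun S => c S - Rec (hdot (B i) (opcoef S))) x =
   \sum_(S : {set 'I_n}) c S * \prod_(j in S) gcoord g j - coeff B M i g.
  rewrite /coeff ME op_lincomb gx /hdot mulmx_sumr trsum mulr_sumr Rec_sum -sumrB.
  apply: eq_bigr => S _; rewrite mulrBl; congr (_ - _).
  by rewrite -scalemxAr mxtraceZ mulrCA -/(hdot _ _) RecZ mulrC.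
by rewrite cE subrr.
Qed.

End Degree.
End OperatorPolynomials.

Section SketchLaws.
Variable R : realType.
Local Notation C := R[i].
Local Open Scope complex_scope.
Local Open Scope sesquilinear_scope.
Notation gauss := (gauss_prob R).
Notation gw := (@gweight R).
Let wg : weight gauss gw := weight_gauss R.
Notation Rec := (@complex.Re R).

Lemma sketchE n D (G : gmat R n D) (x : gvec R D) :
  sketch G x = rowf (lin (unitv (gcoord x))) G.
Proof.
apply/funext => i; rewrite /sketch /rowf /lin /unitv /scalev mulr_suml /dotp.
under [in Num.sqrt _]eq_bigr do rewrite expr2.
by apply: eq_bigr => j _; rewrite mulrA.
Qed.

Lemma gcoord_rowf n (g : gvec R n) : gcoord g = rowf (fun x : measurableTypeR R => x : R) g.
Proof. by []. Qed.

Lemma tame_gcoord n i : tame (wpow gw n) (fun g : gvec R n => gcoord g i).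
Proof. exact: (tame_tnth wg i (tame_gauss_id R)). Qed.

Lemma tame_sketch n D (G : gmat R n D) i :
  tame (wpow gw D) (fun x => sketch G x i).
Proof.
under eq_fun do rewrite sketchE.
apply: tame_sum => [|j _]; first exact: (weight_ge1 (weight_gaussn R D)).
apply: tameM; first exact: tame_cst.
by apply: tame_unitv => k; have [] := @tame_gcoord D k.
Qed.

Lemma tame_multiaff d (T : measurableType d) (w : T -> R) n (c : {set 'I_n} -> R)
    (X : T -> 'I_n -> R) :
  (forall x, 1 <= w x) -> (forall i, tame w (fun t => X t i)) ->
  tame w (fun t => multiaff c (X t)).
Proof.
move=> w1 tX; apply: tame_sum => // S _; apply: tameZ; exact: tame_prod.
Qed.

Lemma tame_Lfun2 d (T : measurableType d) (P : probability T R) (w f : T -> R) :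
  weight P w -> tame w f -> f \in Lfun P 2%:E.
Proof.
move=> wP tf; have [mf _] := tf.
rewrite inE; apply/andP; split; rewrite inE//= /finite_norm unlock /Lnorm.
rewrite poweR_lty//.
rewrite (eq_integral (fun x => (f x ^+ 2)%:E)).
  by rewrite (tame_meanE wP (tameX 2 tf)) ltry.
move=> x _; rewrite /= -[2%R]/(2%:R) powR_mulrn//.
by rewrite real_normK// num_real.
Qed.

Lemma L2_sketch n D s p a (bP : 'I_(p ^ 2)%N -> 'M[C]_p) (bA : 'I_(a ^ 2)%N -> 'M[C]_a)
    (MS : {set 'I_n} -> 'I_(p ^ 2)%N -> 'I_(a ^ 2)%N -> 'M[C]_s) (G : gmat R n D) :
  orthonormal_basis bP -> orthonormal_basis bA ->
  (forall S jp ja, MS S jp ja \is hermsymmx) ->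
  L2_random_operator (fun x : gvec R D => op bP bA MS (sketch G x)).
Proof.
move=> hbP hbA hMS; split=> [g|B hB i].
  by rewrite op_lincomb; apply: herm_lincomb => S; exact: herm_opcoef.
apply: (tame_Lfun2 (weight_gaussn R D)).
rewrite /coeff.
have -> : (fun g => Rec (hdot (B i) (op bP bA MS (sketch G g)))) =
   fun g => multiaff (fun S => Rec (hdot (B i) (opcoef bP bA MS S))) (sketch G g).
  apply/funext => g; rewrite op_lincomb /hdot mulmx_sumr trsum mulr_sumr Rec_sum.
  apply: eq_bigr => S _.
  by rewrite -scalemxAr mxtraceZ mulrCA -/(hdot _ _) RecZ mulrC.
apply: tame_multiaff; first exact: (weight_ge1 (weight_gaussn R D)).
by move=> j; exact: tame_sketch.
Qed.

Lemma law_corr_gaussn rho D :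
  has_law (gpairn R D) (fun z : gpairs R D => map_tuple (correlate rho) z) (corr_gaussn rho D).
Proof. by apply: has_law_pow; split; first exact: measurable_correlate. Qed.

Lemma law_fst : has_law (gpair R)
  (fun z : measurableTypeR R * measurableTypeR R => z.1) gauss.
Proof.
suff : has_law (gauss \x gauss)%E
    (fun z : measurableTypeR R * measurableTypeR R => z.1) gauss by [].
apply: has_lawP; first exact: measurable_fst.
move=> f mf f0; rewrite fubini_tonelli1 /fubini_F /=; last 2 first.
- by apply/measurable_EFinP; exact: measurableT_comp.
- by move=> z; rewrite lee_fin.
by apply: eq_integral => x _; rewrite integral_prob_cst.
Qed.

Lemma law_fstn D : has_law (gpairn R D)
  (fun z : gpairs R D => map_tuple (fun z => z.1) z) (gaussn R D).
Proof. exact: has_law_pow law_fst. Qed.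

Lemma gcoord_fstn D (z : gpairs R D) :
  gcoord (map_tuple (fun z => z.1) z : gvec R D) = fstv z.
Proof. by apply/funext => j; rewrite /gcoord tnth_map. Qed.

Lemma gcoord_fsts rho D (z : gpairs R D) :
  gcoord (fsts (map_tuple (correlate rho) z)) = fstv z.
Proof. by apply/funext => j; rewrite /gcoord !tnth_map. Qed.

Lemma gcoord_snds rho D (z : gpairs R D) :
  gcoord (snds (map_tuple (correlate rho) z)) =
  combv rho (Num.sqrt (1 - rho ^+ 2)) (fstv z) (sndv z).
Proof. by apply/funext => j; rewrite /gcoord !tnth_map. Qed.

Section Norms.
Variables (n D : nat) (K : finType) (c : K -> {set 'I_n} -> R).
Let B S S' := \sum_j c j S * c j S'.

(** For rho = 1 the two directions coincide, which makes the norms of item 1 an instance of the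
    correlated form. *)
Lemma vdir1 (z : gpairs R D) : vdir 1 z = udir z.
Proof.
rewrite /vdir expr1n subrr sqrtr0; congr unitv; apply/funext => j.
by rewrite /combv mul1r mul0r addr0.
Qed.

Lemma integral_sqnorm_sketch (G : gmat R n D) :
  (\int[gaussn R D]_x (sqnorm c (sketch G x))%:E = (sketchmean 1 B G)%:E)%E.
Proof.
have wgn := weight_gaussn R D.
have tS : tame (wpow gw D) (fun x => sqnorm c (sketch G x)).
  apply: tame_sum => [|j _]; first exact: (weight_ge1 wgn).
  apply: tameX; apply: tame_multiaff; first exact: (weight_ge1 wgn).
  by move=> i; exact: tame_sketch.
rewrite (tame_meanE wgn tS); congr EFin.
have E (z : gpairs R D) : sqnorm c (sketch G (map_tuple (fun z => z.1) z : gvec R D)) =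
    sketchform 1 B (G, z).
  by rewrite sketchE gcoord_fstn sqnorm_polar /sketchform /= vdir1.
have [mS _] := tS.
rewrite -(has_law_mean (law_fstn D) (weight_gpairn R D) mS).
  by congr mean; apply/funext => z; rewrite E.
under eq_fun do rewrite E.
exact: (tame_section2 (weight_pow wgn n) G (tame_sketchform D 1 B)).
Qed.

Lemma mean_gauss1 : mean gauss (fun x : measurableTypeR R => x : R) = 0.
Proof. exact: (@gauss_moment_odd R 1). Qed.

Lemma integral_sqnorm_gauss :
  (\int[gaussn R n]_g (sqnorm c (gcoord g))%:E = (coefnorm c)%:E)%E.
Proof.
have wgn := weight_gaussn R n.
have tS : tame (wpow gw n) (fun g => sqnorm c (gcoord g)).
  apply: tame_sum => [|j _]; first exact: (weight_ge1 wgn).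
  apply: tameX; apply: tame_multiaff; first exact: (weight_ge1 wgn).
  by move=> i; exact: tame_gcoord.
rewrite (tame_meanE wgn tS); congr EFin.
under eq_fun do rewrite sqnorm_polar gcoord_rowf.
have id2 : mean gauss (fun x : measurableTypeR R => (x : R) * (x : R)) = 1.
  by rewrite -[RHS]gauss_moment2; congr mean; apply/funext => x; rewrite expr2.
rewrite (mean_polar wg B (tame_gauss_id R) (tame_gauss_id R) mean_gauss1 mean_gauss1 id2).
apply: eq_bigr => S _; rewrite expr1n mulr1; apply: eq_bigr => j _.
by rewrite expr2.
Qed.

End Norms.

Lemma measurable_prod_cond d (T : measurableType d) (I : eqType) (r : seq I)
    (Q : pred I) (F : I -> T -> R) : (forall i, measurable_fun setT (F i)) ->
  measurable_fun setT (fun x => \prod_(i <- r | Q i) F i x).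
Proof.
move=> mF; under eq_fun do rewrite -big_filter.
by apply: measurable_prod => i _; exact: mF.
Qed.

Section Correlated.
Variables (n D : nat) (rho : R) (rho01 : 0 <= rho <= 1).
Variable B : {set 'I_n} -> {set 'I_n} -> R.

Lemma mean_corr_polar :
  mean (corr_gaussn rho n) (fun z => polar B (gcoord (fsts z)) (gcoord (snds z))) =
  \sum_(S : {set 'I_n}) B S S * rho ^+ #|S|.
Proof.
have wp := weight_gpair R; have wpn := weight_gpairn R n.
have wp1 := weight_ge1 wp; have wpn1 := weight_ge1 wpn.
pose sg := Num.sqrt (1 - rho ^+ 2).
pose X (z : measurableTypeR R * measurableTypeR R) : R := z.1.
pose Y (z : measurableTypeR R * measurableTypeR R) : R := rho * (z.1 : R) + sg * (z.2 : R).
have tX : tame (@gpairw R) X by exact: tame_gpair1.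
have t2 : tame (@gpairw R) (fun z => z.2 : R) by exact: tame_gpair2.
have tY : tame (@gpairw R) Y by exact: (tameD wp1 (tameZ rho tX) (tameZ sg t2)).
have m1 : mean (gpair R) X = 0 by rewrite (mean_gpair_fst (tame_gauss_id R)) mean_gauss1.
have m2 : mean (gpair R) (fun z => z.2 : R) = 0.
  by rewrite (mean_gpair_snd (tame_gauss_id R)) mean_gauss1.
have mY : mean (gpair R) Y = 0.
  rewrite (meanD wp (tameZ rho tX) (tameZ sg t2)) (meanZ wp _ tX) (meanZ wp _ t2).
  by rewrite m1 m2 !mulr0 addr0.
have mXY : mean (gpair R) (fun z => X z * Y z) = rho.
  have -> : (fun z => X z * Y z) = (fun z => rho * X z ^+ 2 + sg * ((z.1 : R) * (z.2 : R))).
    by apply/funext => z; rewrite /X /Y; ring.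
  have tXX := tameX 2 tX; have t12 := tameM tX t2.
  rewrite (meanD wp (tameZ rho tXX) (tameZ sg t12)) (meanZ wp _ tXX) (meanZ wp _ t12).
  rewrite (mean_gpair_mul (tame_gauss_id R) (tame_gauss_id R)) mean_gauss1 mulr0 mulr0.
  rewrite (mean_gpair_fst (f := fun x => (x : R) ^+ 2) (tame_gaussX R 2)) gauss_moment2.
  by rewrite mulr1 addr0.
rewrite -(mean_polar wp B tX tY m1 mY mXY).
have E (z : gpairs R n) : polar B (gcoord (fsts (map_tuple (correlate rho) z)))
    (gcoord (snds (map_tuple (correlate rho) z))) = polar B (rowf X z) (rowf Y z).
  by rewrite gcoord_fsts gcoord_snds.
have tE : tame (wpow (@gpairw R) n) (fun z : gpairs R n => polar B (rowf X z) (rowf Y z)).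
  exact: (tame_biaffine wp tX tY (biaffine_polar B)).
have mP : measurable_fun setT (fun z : gpairs R n => polar B (gcoord (fsts z)) (gcoord (snds z))).
  apply: measurable_sum => S; apply: measurable_sum => S'; apply: measurable_funM => //.
  apply: measurable_funM; apply: measurable_prod_cond => i; rewrite /gcoord;
    under eq_fun do rewrite tnth_map.
    by apply: measurableT_comp => //; exact: measurable_tnth.
  by apply: measurableT_comp => //; exact: measurable_tnth.
rewrite -(has_law_mean (law_corr_gaussn rho n) wpn mP).
  by congr mean; apply/funext => z; rewrite E.
by under eq_fun do rewrite E.
Qed.

Lemma mean_corr_sketch (G : gmat R n D) :
  mean (corr_gaussn rho D) (fun z => polar B (sketch G (fsts z)) (sketch G (snds z))) =
  sketchmean rho B G.
Proof.
have wpn := weight_gpairn R D; have wgn := weight_gaussn R D.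
have E (z : gpairs R D) : polar B (sketch G (fsts (map_tuple (correlate rho) z)))
    (sketch G (snds (map_tuple (correlate rho) z))) = sketchform rho B (G, z).
  by rewrite !sketchE gcoord_fsts gcoord_snds.
have mP : measurable_fun setT (fun z : gpairs R D => polar B (sketch G (fsts z)) (sketch G (snds z))).
  have mfst : measurable_fun setT (fun z : gpairs R D => fsts z).
    apply/measurable_fun_tnthP => i; rewrite (_ : _ \o _ = fst \o (fun z => tnth z i)).
      by apply: measurableT_comp => //; exact: measurable_tnth.
    by apply/funext => z /=; rewrite tnth_map.
  have msnd : measurable_fun setT (fun z : gpairs R D => snds z).
    apply/measurable_fun_tnthP => i; rewrite (_ : _ \o _ = snd \o (fun z => tnth z i)).
      by apply: measurableT_comp => //; exact: measurable_tnth.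
    by apply/funext => z /=; rewrite tnth_map.
  have ms i : measurable_fun setT (fun x : gvec R D => sketch G x i).
    by have [] := tame_sketch G i.
  apply: measurable_sum => S; apply: measurable_sum => S'; apply: measurable_funM => //.
  apply: measurable_funM; apply: measurable_prod_cond => i.
    exact: (measurableT_comp (ms i) mfst).
  exact: (measurableT_comp (ms i) msnd).
rewrite -(has_law_mean (law_corr_gaussn rho D) wpn mP).
  by congr mean; apply/funext => z; rewrite E.
under eq_fun do rewrite E.
exact: (tame_section2 (weight_pow wgn n) G (tame_sketchform D rho B)).
Qed.

End Correlated.
End SketchLaws.

(** * Measurability of the trace of zeta *)

Section TrZeta.
Variable R : realType.
Local Notation C := R[i].
Local Open Scope complex_scope.
Local Open Scope sesquilinear_scope.
Notation Rec := (@complex.Re R).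
Notation Imc := (@complex.Im R).

Definition frob2 m (X : 'M[C]_m) : R := \sum_k flat X k ^+ 2.

Lemma frob2_tr m (X : 'M[C]_m) : X \is hermsymmx -> frob2 X = Rec (\tr (X *m X)).
Proof. by move=> hX; rewrite Rec_tr_herm//; apply: eq_bigr => k _; rewrite expr2. Qed.

Lemma zeta_ge0 (x : R) : 0 <= zeta x.
Proof. by rewrite /zeta; case: ifP => // _; exact: sqr_ge0. Qed.

Lemma zeta_le (x b : R) : 0 <= b -> zeta x <= (x - b) ^+ 2.
Proof.
by move=> b0; rewrite /zeta; case: ifP => [x0|_]; [nra|exact: sqr_ge0].
Qed.

Lemma herm_gram m (Y : 'M[C]_m) : Y ^t* *m Y \is hermsymmx.
Proof. by apply: hermP; rewrite trmx_mul map_mxM trmxCK. Qed.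

Section Spectral.
Variables (m : nat) (A : 'M[C]_m).
Hypothesis hA : A \is hermsymmx.
Let U := spectralmx A.
Let e l := Rec (spectral_diag A 0 l).

Lemma tr_zeta_sum : tr_zeta A = \sum_l zeta (e l).
Proof.
rewrite /tr_zeta /func_calc mxtrace_mulC mulmxA mulmxV ?spectral_unit// mul1mx.
by rewrite mxtrace_diag Rec_sum; apply: eq_bigr => l _; rewrite !mxE.
Qed.

Let uU : U *m U ^t* = 1%:M.
Proof. exact/unitarymxP/spectral_unitarymx. Qed.

Let vU : U ^t* *m U = 1%:M.
Proof. by move: uU => /mulmx1C. Qed.

Let invU : invmx U = U ^t*.
Proof. exact: invmx_unitary (spectral_unitarymx A). Qed.

Let AE : A = U ^t* *m diag_mx (\row_l (e l)%:C) *m U.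
Proof.
have -> : \row_l (e l)%:C = spectral_diag A.
  apply/rowP => l; rewrite mxE.
  by have := hermitian_spectral_diag_real hA => /mxOverP /(_ 0 l) /RRe_real <-.
by rewrite -invU; exact/orthomx_spectralP/hermitian_normalmx.
Qed.

(* [tr_zeta A] is the squared Frobenius distance from [A] to the matrices [Y^* Y];
   restricting to rational [Y] makes it an infimum of countably many polynomials
   in the entries of [A], hence measurable. *)
Lemma tr_zeta_le (Y : 'M[C]_m) : tr_zeta A <= frob2 (A - Y ^t* *m Y).
Proof.
rewrite tr_zeta_sum; set B := Y ^t* *m Y.
have hB : B \is hermsymmx by exact: herm_gram.
have hAB : A - B \is hermsymmx.
  by apply: hermP; rewrite linearB /= map_mxB (hermE hA) (hermE hB).
(* In an eigenbasis of [A] the diagonal entries of the positive matrix are nonnegative, so each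
   costs at least zeta of the eigenvalue; the off-diagonal entries only add. *)
pose Z := U *m (A - B) *m U ^t*.
have hZ : Z \is hermsymmx.
  by apply: hermP; rewrite !trmx_mul !map_mxM trmxCK (hermE hAB) mulmxA.
have -> : frob2 (A - B) = frob2 Z.
  rewrite (frob2_tr hAB) (frob2_tr hZ); congr Rec; rewrite /Z; move: (A - B) => X.
  rewrite (mulmxA (U *m X *m U ^t*) (U *m X)) (mulmxA (U *m X *m U ^t*) U).
  rewrite -(mulmxA (U *m X) (U ^t*) U) vU mulmx1 [RHS]mxtrace_mulC.
  by rewrite (mulmxA (U ^t*) _ X) (mulmxA (U ^t*) U X) vU mul1mx.
have ZE l : Z l l = (e l)%:C - (U *m B *m U ^t*) l l.
  rewrite /Z mulmxBr mulmxBl mxE [X in _ + X]mxE; congr (_ - _).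
  rewrite {1}AE !mulmxA uU mul1mx -mulmxA uU mulmx1.
  by rewrite !mxE eqxx mulr1n.
have b0 l : 0 <= Rec ((U *m B *m U ^t*) l l).
  have -> : U *m B *m U ^t* = (Y *m U ^t*) ^t* *m (Y *m U ^t*).
    by rewrite /B trmx_mul map_mxM trmxCK !mulmxA.
  rewrite mxE Rec_sum; apply: sumr_ge0 => k _; rewrite !mxE conjCE RecM /=.
  by rewrite mulNr opprK addr_ge0// -expr2 sqr_ge0.
rewrite /frob2 sum_flat; apply: ler_sum => l _.
rewrite (bigD1 l)//= -[leLHS]addr0 -addrA lerD//.
  rewrite /flat /= ZE RecD /=.
  have -> : Rec (- (U *m B *m U ^t*) l l) = - Rec ((U *m B *m U ^t*) l l).
    by case: (_ l l).
  exact: zeta_le.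
rewrite addr_ge0 ?sqr_ge0//; apply: sumr_ge0 => j _.
by rewrite addr_ge0 ?sqr_ge0.
Qed.

(** The nearest positive matrix is the positive part of [A], and [Y] is the square root of its
    eigenvalues times [U]. *)
Lemma tr_zeta_attained : exists Y : 'M[C]_m, frob2 (A - Y ^t* *m Y) = tr_zeta A.
Proof.
pose f l := Num.max (e l) 0.
have f0 l : 0 <= f l by rewrite /f le_max lexx orbT.
pose Q := diag_mx (\row_l (Num.sqrt (f l))%:C) : 'M[C]_m.
have QQ : Q ^t* *m Q = diag_mx (\row_l (f l)%:C).
  apply/matrixP => i j; rewrite /Q tr_diag_mx map_diag_mx mul_diag_mx !mxE.
  case: eqP => [->|_]; last by rewrite !mulr0n mulr0.
  rewrite !mulr1n -[X in X * _]/(Num.conj (Num.sqrt (f j))%:C) conjC_real.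
  by rewrite -rmorphM /= -expr2 sqr_sqrtr.
exists (Q *m U).
have -> : (Q *m U) ^t* *m (Q *m U) = U ^t* *m diag_mx (\row_l (f l)%:C) *m U.
  by rewrite trmx_mul map_mxM -QQ (mulmxA (U ^t*)) (mulmxA (U ^t* *m Q ^t*)).
have -> : A - U ^t* *m diag_mx (\row_l (f l)%:C) *m U =
    U ^t* *m diag_mx (\row_l (e l - f l)%:C) *m U.
  have -> : diag_mx (\row_l (e l - f l)%:C) =
      diag_mx (\row_l (e l)%:C) - diag_mx (\row_l (f l)%:C) :> 'M[C]_m.
    apply/matrixP => i j; rewrite !mxE; case: eqP => _; last by rewrite !mulr0n subr0.
    by rewrite !mulr1n rmorphB.
  by rewrite mulmxBr mulmxBl -AE.
pose E := diag_mx (\row_l (e l - f l)%:C) : 'M[C]_m.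
have hE : U ^t* *m E *m U \is hermsymmx.
  apply: hermP; rewrite !trmx_mul !map_mxM trmxCK -mulmxA; congr (_ *m (_ *m _)).
  rewrite /E tr_diag_mx map_diag_mx; congr diag_mx; apply/rowP => l; rewrite !mxE.
  exact: conjC_real.
rewrite (frob2_tr hE) (mulmxA (U ^t* *m E *m U)) (mulmxA (U ^t* *m E *m U) (U ^t*)).
rewrite -(mulmxA (U ^t* *m E)) uU mulmx1 mxtrace_mulC (mulmxA U).
rewrite (mulmxA U) uU mul1mx tr_zeta_sum.
rewrite /mxtrace Rec_sum; apply: eq_bigr => l _.
rewrite /E mul_diag_mx !mxE eqxx mulr1n -rmorphM /= /f /zeta.
by case: (leP (e l) 0) => h; rewrite ?subr0 ?subrr ?mulr0// -expr2.
Qed.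

End Spectral.

Lemma tr_zeta_ge0 m (A : 'M[C]_m) : 0 <= tr_zeta A.
Proof. by rewrite tr_zeta_sum; apply: sumr_ge0 => l _; exact: zeta_ge0. Qed.

Section Rational.
Variable m : nat.
Notation idx := ('I_m * 'I_m * bool)%type.

Definition cmx (y : idx -> R) : 'M[C]_m := \matrix_(i, j) (y (i, j, true) +i* y (i, j, false)).

Lemma cmx_flat (Y : 'M[C]_m) : cmx (flat Y) = Y.
Proof. by apply/matrixP => i j; rewrite mxE /flat /=; case: (Y i j). Qed.

Lemma flat_gram (A : 'M[C]_m) y i j :
  (flat (A - (cmx y) ^t* *m cmx y) (i, j, true) =
     Rec (A i j) - \sum_k (y (k, i, true) * y (k, j, true) + y (k, i, false) * y (k, j, false)))
  * (flat (A - (cmx y) ^t* *m cmx y) (i, j, false) =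
     Imc (A i j) - \sum_k (y (k, i, true) * y (k, j, false) - y (k, i, false) * y (k, j, true))).
Proof.
have RecN (z : C) : Rec (- z) = - Rec z by case: z.
have ImcN (z : C) : Imc (- z) = - Imc z by case: z.
rewrite /flat /= !mxE !RecD !ImcD !RecN !ImcN !Rec_sum !Imc_sum; split; congr (_ - _);
  apply: eq_bigr => k _; rewrite !mxE conjCE.
  by rewrite RecM /=; ring.
by rewrite ImcM /=; ring.
Qed.

(** The squared Frobenius distance written out in real coordinates, where continuity in [y] and
    measurability in [A] are visible. *)
Definition gramdist (A : 'M[C]_m) (y : idx -> R) : R := \sum_i \sum_j
   ((Rec (A i j) - \sum_k (y (k, i, true) * y (k, j, true) + y (k, i, false) * y (k, j, false))) ^+ 2
   + (Imc (A i j) - \sum_k (y (k, i, true) * y (k, j, false) - y (k, i, false) * y (k, j, true))) ^+ 2).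

Lemma frob2_gram (A : 'M[C]_m) y : frob2 (A - (cmx y) ^t* *m cmx y) = gramdist A y.
Proof.
rewrite /frob2 sum_flat; apply: eq_bigr => i _; apply: eq_bigr => j _.
by rewrite !flat_gram.
Qed.

Lemma rat_seq (r : R) : exists u : nat -> rat, (fun n => ratr (u n) : R) @ \oo --> r.
Proof.
have approx (x : R) : 0 < x -> exists q : rat, `|r - ratr q| < x.
  move=> x0; have [|q] := @rat_in_itvoo R (r - x) (r + x); first lra.
  by rewrite in_itv /= => /andP[h1 h2]; exists q; rewrite ltr_norml; apply/andP; split; lra.
have H n : exists q : rat, `|r - ratr q| < n.+1%:R^-1 by apply: approx; rewrite invr_gt0.
have [u uP] := choice H; exists u.
apply/cvgrPdist_lt => e e0; near=> n; apply: lt_trans (uP n) _.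
near: n; exact: near_infty_natSinv_lt (PosNum e0).
Unshelve. all: by end_near. Qed.

Lemma cvg_sumr (I : Type) (r : seq I) (F : I -> nat -> R) (l : I -> R) :
  (forall i, F i @ \oo --> l i) ->
  (fun n => \sum_(i <- r) F i n) @ \oo --> \sum_(i <- r) l i.
Proof.
move=> Fl; elim: r => [|i r IHr].
  by rewrite big_nil; under eq_fun do rewrite big_nil; exact: cvg_cst.
rewrite big_cons; under eq_fun do rewrite big_cons.
exact: cvgD (Fl i) IHr.
Qed.

(** Continuity along rational sequences converging to [y] entry by entry. *)
Lemma gramdist_dense (A : 'M[C]_m) (y : idx -> R) (c : R) : gramdist A y < c ->
  exists q : {ffun idx -> rat}, gramdist A (fun k => ratr (q k)) < c.
Proof.
move=> yc; have [u uP] := choice (fun k : idx => rat_seq (y k)).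
have cu k : (fun n => ratr (u k n) : R) @ \oo --> y k by exact: uP.
have cv2 (f : nat -> R) (l : R) : f @ \oo --> l -> (fun n => f n ^+ 2) @ \oo --> l ^+ 2.
  by move=> fl; rewrite expr2; under eq_fun do rewrite expr2; exact: cvgM.
have H : (fun n => gramdist A (fun k => ratr (u k n))) @ \oo --> gramdist A y.
  apply: cvg_sumr => i; apply: cvg_sumr => j.
  by apply: cvgD; apply: cv2; apply: cvgB; [exact: cvg_cst| |exact: cvg_cst|];
    apply: cvg_sumr => k; [apply: cvgD|apply: cvgB]; apply: cvgM; exact: cu.
have [n nc] : exists n, gramdist A (fun k => ratr (u k n)) < c.
  move/cvgrPdist_lt : H => /(_ (c - gramdist A y)) [|N _ HN].
    by rewrite subr_gt0.
  exists N; have := HN N (leqnn N); rewrite /= ltr_norml => /andP[h _]; lra.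
exists [ffun k => u k n]; move: nc; congr (gramdist A _ < c).
by apply/funext => k; rewrite ffunE.
Qed.

End Rational.

Lemma measurable_tr_zeta d (T : measurableType d) m (A : T -> 'M[C]_m) :
  (forall t, A t \is hermsymmx) -> (forall k, measurable_fun setT (fun t => flat (A t) k)) ->
  measurable_fun setT (fun t => tr_zeta (A t)).
Proof.
move=> hA mA.
pose N (q : {ffun 'I_m * 'I_m * bool -> rat}) t := gramdist (A t) (fun k => ratr (q k)).
have mN q : measurable_fun setT (N q).
  apply: measurable_sum => i; apply: measurable_sum => j.
  apply: measurable_funD; apply: measurable_funX; apply: measurable_funB => //.
    exact: (mA (i, j, true)).
  exact: (mA (i, j, false)).
move=> _; apply: (measurability _ (RGenInftyO.measurableE R)) => // _ [_ [c ->] <-].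
rewrite setTI.
rewrite (_ : _ @^-1` _ = \bigcup_n
   (if unpickle n is Some q then [set t | N q t < c] else set0)).
  apply: bigcupT_measurable => n; case: (unpickle n) => [q|]; last exact: measurable0.
  rewrite (_ : [set t | _] = N q @^-1` `]-oo, c[); last first.
    by apply/seteqP; split => t /=; rewrite in_itv.
  rewrite -[X in measurable X]setTI; apply: mN => //.
apply/seteqP; split => t /=.
  rewrite in_itv /= => tc; have [Y YE] := tr_zeta_attained (hA t).
  have [|q qc] := @gramdist_dense m (A t) (flat Y) c.
    by rewrite -frob2_gram cmx_flat YE.
  by exists (pickle q) => //; rewrite pickleK.
move=> [n _]; case: (unpickle n) => [q|//] /= qc; rewrite in_itv /=.
apply: le_lt_trans (tr_zeta_le (hA t) (cmx (fun k => ratr (q k)))) _.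
by rewrite frob2_gram.
Qed.

End TrZeta.

(** * Markov's inequality for the sketched operators *)

Section Markov.
Context d (T : measurableType d) (R : realType) (P : probability T R).

Lemma prob_setC_ge (A : set T) (c : R) : measurable A ->
  (P A <= c%:E)%E -> ((1 - c)%:E <= P (~` A))%E.
Proof.
move=> mA PA; rewrite probability_setC// EFinB; exact: leeB.
Qed.

(** The threshold is the integral itself over alpha, so two values need care: if infinite, the event
    is everything; if zero, [J] vanishes almost everywhere. *)
Lemma markov_event (J : T -> \bar R) (alpha : R) : 0 < alpha ->
  measurable_fun setT J -> (forall x, 0 <= J x)%E ->
  let E := [set x | (J x <= alpha^-1%:E * \int[P]_y J y)%E] in
  measurable E /\ ((1 - alpha)%:E <= P E)%E.
Proof.
move=> a0 mJ J0 E.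
have mE : measurable E.
  rewrite -[E]setTI; exact: emeasurable_fun_infty_c.
split=> //.
have I0 : (0 <= \int[P]_y J y)%E by exact: integral_ge0.
have absJ : (fun x => `|J x|%E) = J by apply/funext => x; rewrite gee0_abs.
have [Ioo|Ifin] := eqVneq (\int[P]_y J y)%E +oo%E.
  rewrite (_ : E = setT) ?probability_setT; first by rewrite lee_fin; lra.
  apply/seteqP; split => // x _; rewrite /E /= Ioo gt0_muley ?leey//.
  by rewrite lte_fin invr_gt0.
have {Ifin} : (\int[P]_y J y)%E \is a fin_num by rewrite ge0_fin_numE// lt_neqAle Ifin leey.
move: I0 mE; rewrite /E; case EI : (\int[P]_y J y)%E => [I| |]//; rewrite lee_fin => I0 mE _.
rewrite -[X in P X]setCK; apply: prob_setC_ge; first exact: measurableC.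
have [I00|I_gt0] := eqVneq I 0.
  rewrite I00 mule0 in mE *.
  have : (\int[P]_x `|J x| = 0)%E by rewrite absJ EI I00.
  move/(ae_eq_integral_abs P measurableT mJ) => [N [mN N0 sub]].
  apply: (@le_trans _ _ (P N)); last by rewrite N0 lee_fin ltW.
  apply: le_measure; rewrite ?inE//; first exact: measurableC.
  move=> x /= Jx; apply: sub => /= H; apply: Jx; by rewrite H.
have {}I_gt0 : 0 < I by rewrite lt_neqAle eq_sym I_gt0.
have c0 : 0 < alpha^-1 * I by rewrite mulr_gt0// invr_gt0.
have := le_integral_abse P measurableT mJ c0; rewrite absJ EI setTI => H.
have {}H : ((alpha^-1 * I)%:E * P (~` [set x | J x <= alpha^-1%:E * I%:E]) <= I%:E)%E.
  apply: le_trans H; rewrite lee_pmul2l ?lte_fin//.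
  apply: le_measure; rewrite ?inE.
  - exact: measurableC.
  - by rewrite -[X in measurable X]setTI; apply: emeasurable_fun_c_infty => //; rewrite absJ.
  by move=> x /= /negP; rewrite -ltNge -EFinM gee0_abs// => /ltW.
rewrite -(@lee_pmul2l _ (alpha^-1 * I)%:E)// ?lte_fin//.
by apply: le_trans H _; rewrite -EFinM lee_fin mulrAC mulVf ?mul1r// gt_eqF.
Qed.

End Markov.

Section SketchMarkov.
Variable R : realType.

Lemma gauss_prob_set1 (r : R) : gauss_prob R [set r] = 0%E.
Proof. exact: integral_set1. Qed.

(** The zero vector has first coordinate zero, an event of probability zero. *)
Lemma gaussn_dotp_gt0 D : (0 < D)%N ->
  {ae gaussn R D, forall x, 0 < dotp (gcoord x) (gcoord x)}.
Proof.
case: D => // D _.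
pose u : 'I_D.+1 -> R := fun j => (j == ord0)%:R.
have linu (x : gvec R D.+1) : lin u x = gcoord x ord0.
  rewrite /lin (bigD1 ord0)//= big1 ?addr0 /u ?eqxx ?mulr1// => j /negPf ->.
  by rewrite mulr0.
have uu : dotp u u = 1.
  rewrite /dotp (bigD1 ord0)//= big1 ?addr0 /u ?eqxx ?mulr1// => j /negPf ->.
  by rewrite mulr0.
pose f : measurableTypeR R -> R := \1_[set 0 : measurableTypeR R].
have m1 : measurable [set 0 : measurableTypeR R] by exact: measurable_set1.
have mlin : measurable_fun setT (lin u : gvec R D.+1 -> measurableTypeR R).
  by have [] := tame_lin u.
exists (lin u @^-1` [set 0 : measurableTypeR R]); split.
- by rewrite -[X in measurable X]setTI; exact: mlin.
- have mf : measurable_fun setT f by exact: measurable_indic.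
  have := ge0_integral_lin u mf (fun x => ler0n _ _).
  rewrite uu sqrtr1; under [in RHS]eq_integral do rewrite mul1r.
  have -> : (\int[gauss_prob R]_x (f x)%:E = 0)%E.
    by rewrite integral_indic// setIT; exact: gauss_prob_set1.
  move=> <-; rewrite /f.
  rewrite -[X in gaussn _ _ X]setIT -integral_indic//.
  by rewrite -[X in measurable X]setTI; exact: mlin.
- move=> x /= /negP; rewrite -leNgt linu => x0.
  have : dotp (gcoord x) (gcoord x) = 0 by apply/eqP; rewrite eq_le x0 dotp_ge0.
  move/eqP; rewrite psumr_eq0 => [|j _]; last by rewrite -expr2 sqr_ge0.
  by move/allP/(_ ord0 (mem_index_enum _)); rewrite mulf_eq0 orbb => /eqP.
Qed.

Section Event.
Variables (n D : nat) (D0 : (0 < D)%N) (f : ('I_n -> R) -> R).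
Hypotheses (f0 : forall w, 0 <= f w)
  (mf : measurable_fun setT (fun g : gvec R n => f (gcoord g))).

Lemma gcoord_mktuple (w : 'I_n -> R) : gcoord ([tuple w i | i < n] : gvec R n) = w.
Proof. by apply/funext => i; rewrite /gcoord tnth_mktuple. Qed.

Lemma measurable_coord_comp d (T : measurableType d) (X : T -> 'I_n -> R) :
  (forall i, measurable_fun setT (fun t => X t i)) -> measurable_fun setT (fun t => f (X t)).
Proof.
move=> mX.
rewrite (_ : (fun t => _) = (fun g : gvec R n => f (gcoord g)) \o
   (fun t => [tuple (X t i : measurableTypeR R) | i < n])); last first.
  by apply/funext => t /=; rewrite gcoord_mktuple.
apply: measurableT_comp => //; apply/measurable_fun_tnthP => i.
apply: (@eq_measurable_fun _ _ _ (measurableTypeR R) _ (fun t => X t i)); last exact: mX.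
by move=> t _ /=; rewrite tnth_mktuple.
Qed.

Lemma law_rotation (u : 'I_D -> R) : dotp u u = 1 ->
  has_law (gaussmx R n D) (fun G => map_tuple (lin u : gvec R D -> measurableTypeR R) G)
    (gaussn R n).
Proof.
move=> uu; apply: has_law_pow; apply: has_lawP; first by have [] := tame_lin u.
move=> g mg g0; rewrite (@ge0_integral_lin R D u g mg g0) uu sqrtr1.
by under eq_integral do rewrite mul1r.
Qed.

Lemma measurable_sketch_pair :
  measurable_fun setT (fun z : gmat R n D * gvec R D => f (sketch z.1 z.2)).
Proof.
apply: measurable_coord_comp => i.
under eq_fun do rewrite sketchE.
apply: measurable_sum => j; apply: measurable_funM.
  have mi : measurable_fun setT (fun z : gmat R n D * gvec R D => tnth z.1 i).
    exact: (measurableT_comp (measurable_tnth i) measurable_fst).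
  exact: (measurableT_comp (measurable_tnth j) mi).
have mX k : measurable_fun setT (fun z : gmat R n D * gvec R D => gcoord z.2 k).
  exact: (measurableT_comp (measurable_tnth k) measurable_snd).
by have [] := @tame_unitv R _ _ (fun=> 1) D (fun z : gmat R n D * gvec R D => gcoord z.2) j mX.
Qed.

(** After Tonelli, the inner integral over G has the stated value for every x other than 0, hence
    for almost every x. *)
Lemma integral_sketch :
  (\int[gaussmx R n D]_G \int[gaussn R D]_x (f (sketch G x))%:E =
   \int[gaussn R n]_g (f (gcoord g))%:E)%E.
Proof.
have mE : measurable_fun setT (fun z : gmat R n D * gvec R D => (f (sketch z.1 z.2))%:E).
  by apply/measurable_EFinP; exact: measurable_sketch_pair.
have f0E (z : gmat R n D * gvec R D) : (0 <= (f (sketch z.1 z.2))%:E)%E by rewrite lee_fin.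
have := @fubini_tonelli _ _ _ _ _ (gaussmx R n D) (gaussn R D) _ mE f0E => /= ->.
rewrite (@ge0_ae_eq_integral _ _ _ (gaussn R D) setT _
   (fun=> \int[gaussn R n]_g (f (gcoord g))%:E)%E).
- by rewrite integral_cst// -[RHS]mule1; congr (_ * _)%E; exact: probability_setT.
- by [].
- exact: (@measurable_fun_fubini_tonelli_G _ _ _ _ _ (gaussmx R n D)
    (fun z : gmat R n D * gvec R D => (f (sketch z.1 z.2))%:E) mE f0E).
- exact: measurable_cst.
- by move=> x _; apply: integral_ge0 => G _; rewrite lee_fin.
- by move=> x _; apply: integral_ge0 => g _; rewrite lee_fin.
have := gaussn_dotp_gt0 D0; apply: filterS => x x0 _.
have law := law_rotation (dotp_unitv x0).
have mfE : measurable_fun setT (fun g : gvec R n => (f (gcoord g))%:E) by exact/measurable_EFinP.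
rewrite -(has_law_ge0_integral law mfE) => [|g]; last by rewrite lee_fin.
apply: eq_integral => G _; congr (f _)%:E; rewrite sketchE; apply/funext => i.
by rewrite /gcoord tnth_map.
Qed.

Lemma sketch_markov (alpha : R) : 0 < alpha ->
  let E := [set G : gmat R n D | (\int[gaussn R D]_x (f (sketch G x))%:E
      <= alpha^-1%:E * \int[gaussn R n]_g (f (gcoord g))%:E)%E] in
  measurable E /\ ((1 - alpha)%:E <= gaussmx R n D E)%E.
Proof.
move=> a0; rewrite -integral_sketch.
apply: (@markov_event _ _ _ (gaussmx R n D)
  (fun G => \int[gaussn R D]_x (f (sketch G x))%:E)%E) => //.
  have mE : measurable_fun setT (fun z : gmat R n D * gvec R D => (f (sketch z.1 z.2))%:E).
    by apply/measurable_EFinP; exact: measurable_sketch_pair.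
  have f0E (z : gmat R n D * gvec R D) : (0 <= (f (sketch z.1 z.2))%:E)%E by rewrite lee_fin.
  exact: (@measurable_fun_fubini_tonelli_F _ _ _ _ _ (gaussn R D) _ mE f0E).
by move=> G; apply: integral_ge0 => x _; rewrite lee_fin.
Qed.

End Event.

Lemma sketch_tr_zeta n D s p a (bP : 'I_(p ^ 2)%N -> 'M[R[i]]_p) (bA : 'I_(a ^ 2)%N -> 'M[R[i]]_a)
    (MS : {set 'I_n} -> 'I_(p ^ 2)%N -> 'I_(a ^ 2)%N -> 'M[R[i]]_s) (alpha : R) :
  (0 < D)%N -> orthonormal_basis bP -> orthonormal_basis bA ->
  (forall S jp ja, MS S jp ja \is hermsymmx) -> 0 < alpha ->
  let E := [set G : gmat R n D | (\int[gaussn R D]_x (tr_zeta (op bP bA MS (sketch G x)))%:E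
      <= alpha^-1%:E * \int[gaussn R n]_g (tr_zeta (op bP bA MS (gcoord g)))%:E)%E] in
  measurable E /\ ((1 - alpha)%:E <= gaussmx R n D E)%E.
Proof.
move=> D0 hbP hbA hMS a0.
apply: (@sketch_markov n D D0 (fun w => tr_zeta (op bP bA MS w))) => // [w|].
  exact: tr_zeta_ge0.
apply: measurable_tr_zeta => [g|k].
  by rewrite op_lincomb; apply: herm_lincomb => S; exact: herm_opcoef.
under eq_fun do rewrite op_lincomb flat_lincomb.
have tM : tame (wpow (@gweight R) n) (fun g : gvec R n =>
    multiaff (fun S => flat (opcoef bP bA MS S) k) (gcoord g)).
  apply: tame_multiaff; first exact: (weight_ge1 (weight_gaussn R n)).
  by move=> i; exact: tame_gcoord.
by have [] := tM.
Qed.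

End SketchMarkov.

(** * Failure probabilities *)

Section FailureProbability.
Context d (T : measurableType d) (R : realType) (P : probability T R).

(* [A] itself need not be measurable. *)
Definition fails_le (A : set T) (e : R) : Prop :=
  exists N : set T, [/\ measurable N, ~` A `<=` N & (P N <= e%:E)%E].

Lemma fails_le_sub (A B : set T) (e e' : R) : A `<=` B -> e <= e' ->
  fails_le A e -> fails_le B e'.
Proof.
move=> AB ee [N [mN NA PN]]; exists N; split => //.
  by apply: subset_trans NA; exact: subsetC.
by rewrite (le_trans PN)// lee_fin.
Qed.

Lemma fails_le_setT (e : R) : 0 <= e -> fails_le setT e.
Proof. by move=> e0; exists set0; split; rewrite ?setCT ?measure0 ?lee_fin. Qed.

Lemma fails_leI (A B : set T) (e e' : R) :
  fails_le A e -> fails_le B e' -> fails_le (A `&` B) (e + e').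
Proof.
move=> [N [mN NA PN]] [N' [mN' NB PN']]; exists (N `|` N'); split.
- exact: measurableU.
- by rewrite setCI; exact: setUSS.
- by rewrite EFinD; apply: le_trans (measureU2 _ mN mN') _; exact: leeD.
Qed.

Lemma fails_le_forall (I : finType) (A : I -> set T) (e : R) :
  (forall i, fails_le (A i) e) -> fails_le [set x | forall i, A i x] (#|I|%:R * e).
Proof.
move=> Ae.
suff H (s : seq I) : fails_le [set x | forall i, i \in s -> A i x] ((size s)%:R * e).
  by have := H (enum I); rewrite -cardE; apply: fails_le_sub => // x h i; exact/h/mem_enum.
elim: s => [|i s IH].
  by rewrite mul0r; apply: fails_le_sub (fails_le_setT (lexx 0)) => // x _ i.
rewrite /= -natr1 mulrDl mul1r addrC; apply: fails_le_sub (fails_leI (Ae i) IH) => //.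
by move=> x [Aix As] j; rewrite inE => /orP[/eqP ->//|]; exact: As.
Qed.

Lemma fails_le_prob (A : set T) (e : R) : fails_le A e -> prob_at_least P A (1 - e).
Proof.
move=> [N [mN NA PN]]; exists (~` N); split.
- exact: measurableC.
- by rewrite -[A]setCK; exact: subsetC.
- exact: prob_setC_ge.
Qed.

Lemma event_fails_le (A : set T) (e : R) :
  measurable A -> ((1 - e)%:E <= P A)%E -> fails_le A e.
Proof.
move=> mA PA; exists (~` A); split; [exact: measurableC|by []|].
move: PA; rewrite probability_setC// -(fineK (fin_num_measure P A mA)).
by rewrite -EFinB !lee_fin; lra.
Qed.

End FailureProbability.

Section SketchEvents.
Variables (R : realType) (n D : nat).
Hypothesis D0 : (0 < D)%N.
Notation PG := (gaussmx R n D).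
Let wPG : weight PG (wpow (wpow (@gweight R) D) n) := weight_pow (weight_gaussn R D) n.

Lemma normr_cosv_le1 (rho : R) (z : gpairs R D) : `|cosv rho z| <= 1.
Proof.
have := normr_dotp_le (unitv (fstv z))
  (unitv (combv rho (Num.sqrt (1 - rho ^+ 2)) (fstv z) (sndv z))).
have := dotp_unitv_le1 (fstv z).
have := dotp_unitv_le1 (combv rho (Num.sqrt (1 - rho ^+ 2)) (fstv z) (sndv z)).
rewrite -/(cosv rho z); lra.
Qed.

Lemma mean_cosv_expr_le1 (rho : R) m : mean (gpairn R D) (fun z => cosv rho z ^+ m) <= 1.
Proof.
have tc := tameX m (tame_cosv D rho).
rewrite -[leRHS](mean_cst (gpairn R D)).
apply: (mean_le (weight_gpairn R D) tc); first exact: tame_cst.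
move=> z; rewrite (le_trans (ler_norm _))// normrX exprn_ile1//.
exact: normr_cosv_le1.
Qed.

(** The mean is at most [coefnorm c], because powers of cosines are at most 1. The allowed deviation
    is delta times this norm and the variance scales with its square, so the norm cancels; if it is
    zero, all coefficients vanish. *)
Lemma norm_fails_le (K : finType) (c : K -> {set 'I_n} -> R) (dg : nat) (delta : R) :
  0 < delta -> (forall k (S : {set 'I_n}), (dg < #|S|)%N -> c k S = 0) ->
  fails_le PG
    [set G | sketchmean 1 (fun S S' => \sum_k c k S * c k S') G <= (1 + delta) * coefnorm c]
    (58 / Num.sqrt D%:R * 9 ^+ dg / delta ^+ 2).
Proof.
move=> dl0 c0; set B := (X in sketchmean 1 X); set m := coefnorm c.
have m_ge0 : 0 <= m := coefnorm_ge0 c.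
have e0 : 0 <= 58 / Num.sqrt D%:R * 9 ^+ dg / delta ^+ 2 :> R.
  by rewrite divr_ge0 ?sqr_ge0// mulr_ge0 ?exprn_ge0// divr_ge0 ?sqrtr_ge0.
have [m0|mN0] := eqVneq m 0.
  have cz k S : c k S = 0.
    have h1 (S' : {set 'I_n}) (_ : true) : 0 <= \sum_k c k S' ^+ 2.
      by apply: sumr_ge0 => l _; exact: sqr_ge0.
    have /eqP : \sum_k c k S ^+ 2 = 0 by exact: (psumr_eq0P h1 m0).
    rewrite psumr_eq0 => [|l _]; last exact: sqr_ge0.
    by move/allP/(_ k (mem_index_enum _)); rewrite sqrf_eq0 => /eqP.
  apply: fails_le_sub (fails_le_setT PG e0) => // G _ /=.
  rewrite m0 mulr0 /sketchmean (_ : (fun z => _) = fun=> 0) ?mean_cst//.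
  apply/funext => z; rewrite /sketchform polar_gram big1// => k _.
  by rewrite /multiaff big1 ?mul0r// => S _; rewrite cz mul0r.
have m_gt0 : 0 < m by rewrite lt_neqAle eq_sym mN0.
have [mA PA] := chebyshev_cov wPG (tame_sketchmean D 1 B) (mulr_gt0 dl0 m_gt0).
have EF : mean PG (sketchmean 1 B (D:=D)) <= m.
  rewrite mean_sketchmean; apply: ler_sum => S _.
  have -> : \sum_k c k S ^+ 2 = B S S by apply: eq_bigr => k _; rewrite expr2.
  rewrite ler_piMr ?mean_cosv_expr_le1//; apply: sumr_ge0 => k _.
  by rewrite -expr2 sqr_ge0.
eexists; split; [exact: mA| |].
  by move=> G /= /negP; rewrite -ltNge => h; rewrite ltr_normr; apply/orP; left; lra.
have BMN x y : polar B x y ^+ 2 <= sqnorm c x * sqnorm c y.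
  by rewrite polar_gram; exact: sqr_sum_mul_le.
apply: le_trans PA _; rewrite lee_fin exprMn ler_pdivrMr ?mulr_gt0 ?exprn_gt0//.
have one01 : 0 <= (1 : R) <= 1 by rewrite ler01 lexx.
apply: le_trans (cov_sketchmean D0 one01 c0 c0 BMN) _; rewrite -/m.
by rewrite [leRHS]mulrA divfK ?gt_eqF ?exprn_gt0// expr2 !mulrA.
Qed.

(** Half of [eps] covers the distance of the mean from its target, the other half the fluctuation
    around the mean. *)
Lemma corr_fails_le (K K' : finType) (cM : K -> {set 'I_n} -> R) (cN : K' -> {set 'I_n} -> R)
    (dg : nat) (rho eps u v : R) (B : {set 'I_n} -> {set 'I_n} -> R) :
  0 <= rho <= 1 -> 0 < eps ->
  (forall k (S : {set 'I_n}), (dg < #|S|)%N -> cM k S = 0) ->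
  (forall k (S : {set 'I_n}), (dg < #|S|)%N -> cN k S = 0) ->
  (forall x y, polar B x y ^+ 2 <= sqnorm cM x * sqnorm cN y) ->
  (forall S, B S S ^+ 2 <= (\sum_k cM k S ^+ 2) * (\sum_k cN k S ^+ 2)) ->
  coefnorm cM <= u -> coefnorm cN <= v ->
  (u + v) / 2 * (dg%:R * (12 / Num.sqrt D%:R)) <= eps / 2 ->
  fails_le PG
    [set G | `|sketchmean rho B G - \sum_(S : {set 'I_n}) B S S * rho ^+ #|S| | <= eps]
    (58 / Num.sqrt D%:R * (9 ^+ dg * (u * v)) / (eps / 2) ^+ 2).
Proof.
move=> r01 e0 cM0 cN0 BMN BSS Mu Nv dev.
have e2 : 0 < eps / 2 by rewrite divr_gt0.
have [mA PA] := chebyshev_cov wPG (tame_sketchmean D rho B) e2.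
have u0 : 0 <= u := le_trans (coefnorm_ge0 cM) Mu.
eexists; split; [exact: mA| |].
  (* AM-GM applied to the bound on the diagonal entry; this majorant can be summed over [S]. *)
  pose m (S : {set 'I_n}) : R := (\sum_k cM k S ^+ 2 + \sum_k cN k S ^+ 2) / 2.
  have sqs (K1 : finType) (c : K1 -> {set 'I_n} -> R) S : 0 <= \sum_k c k S ^+ 2.
    by apply: sumr_ge0 => k _; exact: sqr_ge0.
  have Bm S : `|B S S| <= m S.
    have a0 := sqs _ cM S; have b0 := sqs _ cN S.
    rewrite -(ler_pXn2r (n := 2))// ?nnegrE ?divr_ge0 ?addr_ge0//.
    rewrite real_normK ?num_real//; apply: le_trans (BSS S) _; rewrite /m.
    by move: (\sum_k _) (\sum_k _) => a b; have := sqr_ge0 (a - b); rewrite exprMn; nra.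
  have m0 (S : {set 'I_n}) : (dg < #|S|)%N -> m S = 0.
    move=> dS; rewrite /m !big1 ?addr0 ?mul0r// => k _.
      by rewrite cN0// expr0n.
    by rewrite cM0// expr0n.
  have := mean_sketchmean_dev D0 r01 Bm m0.
  have t0 : 0 <= dg%:R * (12 / Num.sqrt D%:R) :> R by rewrite mulr_ge0// divr_ge0 ?sqrtr_ge0.
  have mE : \sum_S m S <= (u + v) / 2.
    by rewrite /m -mulr_suml big_split /= ler_wpM2r// lerD.
  move=> H G /= /negP; rewrite -ltNge => h.
  have {}H := le_trans (le_trans H (ler_wpM2r t0 mE)) dev.
  have := ler_normD (sketchmean rho B G - mean PG (sketchmean rho B (D:=D)))
    (mean PG (sketchmean rho B (D:=D)) - \sum_(S : {set 'I_n}) B S S * rho ^+ #|S|).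
  rewrite addrA subrK; move: H h; rewrite /gaussmx; lra.
apply: le_trans PA _; rewrite lee_fin ler_wpM2r ?invr_ge0 ?sqr_ge0//.
apply: le_trans (cov_sketchmean D0 r01 cM0 cN0 BMN) _.
rewrite ler_wpM2l ?divr_ge0 ?sqrtr_ge0// ler_wpM2l ?exprn_ge0//.
by rewrite ler_pM ?coefnorm_ge0.
Qed.

End SketchEvents.

(** * The trace against the joint state *)

Section Correlations.
Variable R : realType.
Local Notation C := R[i].
Local Open Scope complex_scope.
Local Open Scope sesquilinear_scope.
Notation Rec := (@complex.Re R).
Notation Imc := (@complex.Im R).

(** The values are moduli; an empty or unbounded set has supremum 0 by convention. *)
Lemma max_correlation_ge0 m n (psi : 'M[C]_(m * n)) : 0 <= max_correlation psi.
Proof.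
rewrite /max_correlation; set E := [set x | _].
have E0 x : E x -> 0 <= x.
  by move=> [P [Q [_ _ _ ->]]]; rewrite normc_def /= sqrtr_ge0.
have [hE|/sup_out ->//] := pselect (has_sup E).
by have [[x Ex] _] := hE; rewrite (le_trans (E0 _ Ex))//; exact: sup_upper_bound.
Qed.

Lemma tr_tilde_sqr m (P : 'M[C]_m) : \tr (tilde P *m tilde P) = hdot P P.
Proof.
rewrite /tilde -scalemxAl -scalemxAr scalerA mxtraceZ -rmorphM -expr2 exprVn.
by rewrite sqr_sqrtr// /hdot natC invC.
Qed.

Section Kappa.
Variables (p q r : nat) (phi : 'M[C]_(p * q * r)) (P : 'M[C]_p) (Q : 'M[C]_q) (Z : 'M[C]_r).
Hypotheses (sphi : quantum_state phi) (hP : P \is hermsymmx) (hQ : Q \is hermsymmx)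
  (hZ : Z \is hermsymmx).

Let herm3 : tilde P *t tilde Q *t tilde Z \is hermsymmx.
Proof. by apply: herm_tens; [apply: herm_tens|]; exact: herm_tilde. Qed.

(** The scaled basis elements have Frobenius norm 1, hence so has their tensor product. *)
Lemma state_pairing_sqr_le1 : hdot P P = 1 -> hdot Q Q = 1 -> hdot Z Z = 1 ->
  Rec (\tr ((tilde P *t tilde Q *t tilde Z) *m phi)) ^+ 2 <= 1.
Proof.
move=> P1 Q1 Z1; apply: le_trans (Rec_tr_state_sqr_le herm3 sphi) _.
by rewrite !tensmx_mul !tr_tens !tr_tilde_sqr P1 Q1 Z1 !mulr1.
Qed.

Lemma state_pairing_real :
  \tr ((tilde P *t tilde Q *t tilde Z) *m phi) =
  (Rec (\tr ((tilde P *t tilde Q *t tilde Z) *m phi)))%:C.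
Proof.
have [hphi _ _] := sphi.
have := Imc_tr_herm herm3 hphi; case: (\tr _) => x y /= ->; rewrite /real_complex_def//.
Qed.

End Kappa.

(** Cauchy-Schwarz over pairs: the weights contribute at most |I| |J|, and the remaining double sum
    factors. *)
Lemma sum_weighted_sqr_le (I J : finType) (kap b : I -> J -> R) (u : I -> R) (v : J -> R) :
  (forall i j, kap i j ^+ 2 <= 1) -> (forall i j, b i j ^+ 2 <= u i * v j) ->
  (\sum_i \sum_j kap i j * b i j) ^+ 2 <=
  (#|I|%:R * \sum_i u i) * (#|J|%:R * \sum_j v j).
Proof.
move=> k1 bu.
rewrite pair_big /=; apply: le_trans (sqr_sum_mul_le _ _) _.
apply: (@le_trans _ _ ((#|I|%:R * #|J|%:R) * ((\sum_i u i) * (\sum_j v j)))); last first.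
  by rewrite mulrACA.
apply: ler_pM.
- by apply: sumr_ge0 => x _; exact: sqr_ge0.
- by apply: sumr_ge0 => x _; exact: sqr_ge0.
- apply: (@le_trans _ _ (\sum_(x : I * J) 1)); first by apply: ler_sum => x _; exact: k1.
  by rewrite sumr_const card_prod natrM.
- rewrite mulr_suml; under [leRHS]eq_bigr do rewrite mulr_sumr.
  by rewrite [leRHS]pair_big /=; apply: ler_sum => x _; exact: bu.
Qed.

Section Family.
Variables (n : nat) (I K : finType) (lam : R) (c : I -> K -> {set 'I_n} -> R).

(* Cauchy-Schwarz over the [p^2 q^2] pairs of basis elements costs a factor
   [p^2 q^2], which the scalings [lam = p] and [lam = q] account for. *)
Definition stack (x : I * K) (S : {set 'I_n}) : R := lam * c x.1 x.2 S.

Lemma sqnorm_stack w : sqnorm stack w = lam ^+ 2 * \sum_i sqnorm (c i) w.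
Proof.
rewrite mulr_sumr /sqnorm; under [RHS]eq_bigr do rewrite mulr_sumr.
rewrite [RHS]pair_big /=; apply: eq_bigr => x _; rewrite -exprMn; congr (_ ^+ 2).
by rewrite /multiaff mulr_sumr; apply: eq_bigr => S _; rewrite mulrA.
Qed.

Lemma sumsq_stack S : \sum_x stack x S ^+ 2 = lam ^+ 2 * \sum_i \sum_k c i k S ^+ 2.
Proof.
rewrite mulr_sumr; under [RHS]eq_bigr do rewrite mulr_sumr.
by rewrite [RHS]pair_big /=; apply: eq_bigr => x _; rewrite -exprMn.
Qed.

Lemma coefnorm_stack : coefnorm stack = lam ^+ 2 * \sum_i coefnorm (c i).
Proof.
rewrite /coefnorm; under eq_bigr do rewrite sumsq_stack.
by rewrite -mulr_sumr exchange_big.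
Qed.

End Family.

Section Pairing.
Variables (n s t p q r a b h : nat).
Variables (phi : 'M[C]_(p * q * r)) (psi : 'M[C]_(s * t)) (rho : R).
Hypotheses (sphi : quantum_state phi) (spsi : noisy_max_entangled psi rho).
Variables (bP : 'I_(p ^ 2)%N -> 'M[C]_p) (bQ : 'I_(q ^ 2)%N -> 'M[C]_q)
  (bR : 'I_(r ^ 2)%N -> 'M[C]_r).
Hypotheses (hbP : orthonormal_basis bP) (hbQ : orthonormal_basis bQ)
  (hbR : orthonormal_basis bR).
Variables (MS : {set 'I_n} -> 'I_(p ^ 2)%N -> 'I_(a ^ 2)%N -> 'M[C]_(pow_dim s h))
  (NS : {set 'I_n} -> 'I_(q ^ 2)%N -> 'I_(b ^ 2)%N -> 'M[C]_(pow_dim t h)).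
Hypotheses (hMS : forall S jp ja, MS S jp ja \is hermsymmx)
  (hNS : forall S jq jb, NS S jq jb \is hermsymmx).
Variables (ja : 'I_(a ^ 2)%N) (jb : 'I_(b ^ 2)%N) (jr : 'I_(r ^ 2)%N).

Notation Psi := (state_pow h psi).
Let kap jp jq := Rec (\tr ((tilde (bP jp) *t tilde (bQ jq) *t tilde (bR jr)) *m phi)).
Let A jp S := MS S jp ja.
Let A' jq S := NS S jq jb.

(** [kap] is the part of the trace carried by [phi]; what remains is a form in the coefficients on
    S^h and T^h alone. *)
Definition pairform (S S' : {set 'I_n}) : R :=
  \sum_jp \sum_jq kap jp jq * traceform (A jp) (A' jq) Psi S S'.

Let hA jp S : A jp S \is hermsymmx. Proof. exact: hMS. Qed.
Let hA' jq S : A' jq S \is hermsymmx. Proof. exact: hNS. Qed.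

Let hPsi : Psi \is hermsymmx.
Proof. by case: spsi => -[hpsi _ _] _ _ _ _; exact: state_pow_herm. Qed.

Lemma polar_pairform x y : polar pairform x y =
  \sum_jp \sum_jq kap jp jq * polar (traceform (A jp) (A' jq) Psi) x y.
Proof.
rewrite /polar.
transitivity (\sum_(S : {set 'I_n}) \sum_jp \sum_jq \sum_(S' : {set 'I_n})
   kap jp jq * (traceform (A jp) (A' jq) Psi S S' * (\prod_(i in S) x i * \prod_(i in S') y i))).
  apply: eq_bigr => S _; transitivity (\sum_(S' : {set 'I_n}) \sum_jp \sum_jq
      kap jp jq * (traceform (A jp) (A' jq) Psi S S' *
        (\prod_(i in S) x i * \prod_(i in S') y i))).
    apply: eq_bigr => S' _; rewrite mulr_suml; apply: eq_bigr => jp _.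
    by rewrite mulr_suml; apply: eq_bigr => jq _; rewrite -mulrA.
  by rewrite exchange_big; apply: eq_bigr => jp _; rewrite exchange_big.
rewrite exchange_big; apply: eq_bigr => jp _; rewrite exchange_big; apply: eq_bigr => jq _.
by rewrite mulr_sumr; apply: eq_bigr => S _; rewrite mulr_sumr.
Qed.

(** Both factors of [tr_joint] are traces of products of Hermitian matrices, hence real; [expectC]
    then reduces to a real mean. *)
Lemma tr_op_a_joint x y :
  \tr ((op_a bP MS x ja *t op_a bQ NS y jb *t tilde (bR jr)) *m joint_state phi Psi) =
  (polar pairform x y)%:C.
Proof.
have [hP _ _] := hbP; have [hQ _ _] := hbQ; have [hR _ _] := hbR.
rewrite polar_pairform rmorph_sum /op_a !tens_suml mulmx_suml trsum; apply: eq_bigr => jp _.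
rewrite rmorph_sum tens_sumr tens_suml mulmx_suml trsum; apply: eq_bigr => jq _ /=.
rewrite tr_joint (state_pairing_real sphi (hP jp) (hQ jq) (hR jr)) rmorphM; congr (_ * _).
rewrite -Rec_tr_lincomb.
have hT : lincomb (A jp) x *t lincomb (A' jq) y \is hermsymmx.
  by apply: herm_tens; exact: herm_lincomb.
have := Imc_tr_herm hT hPsi; rewrite -/(op_pa MS x jp ja) -/(op_pa NS y jq jb).
by case: (\tr _) => u v /= ->.
Qed.

Let traceform_sqr_le (X : 'M[C]_(pow_dim s h)) (Y : 'M[C]_(pow_dim t h)) :
  X \is hermsymmx -> Y \is hermsymmx ->
  Rec (\tr ((X *t Y) *m Psi)) ^+ 2 <= hnorm2 X ^+ 2 * hnorm2 Y ^+ 2.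
Proof.
case: spsi => -[hpsi ppsi _] m1 m2 _ _ hX hY; apply: tr_tens_sqr_le => //.
- exact: state_pow_psd.
- exact: state_pow_marginal1.
- exact: state_pow_marginal2.
Qed.

Let kap1 jp jq : kap jp jq ^+ 2 <= 1.
Proof.
have [hP oP _] := hbP; have [hQ oQ _] := hbQ; have [hR oR _] := hbR.
by apply: state_pairing_sqr_le1 => //; rewrite ?oP ?oQ ?oR eqxx.
Qed.

Let cM := stack p%:R (fun jp => coefflat (A jp)).
Let cN := stack q%:R (fun jq => coefflat (A' jq)).

Lemma polar_pairform_sqr_le x y : polar pairform x y ^+ 2 <= sqnorm cM x * sqnorm cN y.
Proof.
rewrite polar_pairform !sqnorm_stack.
apply: le_trans (sum_weighted_sqr_le (u := fun jp => sqnorm (coefflat (A jp)) x)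
  (v := fun jq => sqnorm (coefflat (A' jq)) y) kap1 _) _.
  move=> jp jq; rewrite -Rec_tr_lincomb -(hnorm2_lincomb x (hA jp)) -(hnorm2_lincomb y (hA' jq)).
  by apply: traceform_sqr_le; exact: herm_lincomb.
by rewrite !card_ord !natrX.
Qed.

Lemma pairform_diag_sqr_le S :
  pairform S S ^+ 2 <= (\sum_k cM k S ^+ 2) * (\sum_k cN k S ^+ 2).
Proof.
rewrite !sumsq_stack.
apply: le_trans (sum_weighted_sqr_le (u := fun jp => \sum_k coefflat (A jp) k S ^+ 2)
  (v := fun jq => \sum_k coefflat (A' jq) k S ^+ 2) kap1 _) _.
  by move=> jp jq; rewrite -!hnorm2_coefflat//; exact: traceform_sqr_le.
by rewrite !card_ord !natrX.
Qed.

Lemma expectC_real d (T : measurableType d) (P : probability T R) (f : T -> R) :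
  expectC P (fun z => (f z)%:C) = (mean P f)%:C.
Proof.
rewrite /expectC /mean /=; congr (_ +i* _).
by rewrite /Rintegral integral0.
Qed.

Lemma pairing_fails_le D (dg : nat) (eps : R) : (0 < D)%N -> 0 < eps ->
  (forall (S : {set 'I_n}) jp, (dg < #|S|)%N -> MS S jp ja = 0) ->
  (forall (S : {set 'I_n}) jq, (dg < #|S|)%N -> NS S jq jb = 0) ->
  (forall jp, coefnorm (coefflat (A jp)) <= 1) ->
  (forall jq, coefnorm (coefflat (A' jq)) <= 1) ->
  (p%:R ^+ 4 + q%:R ^+ 4) / 2 * (dg%:R * (12 / Num.sqrt D%:R)) <= eps / 2 ->
  fails_le (gaussmx R n D)
    [set G : gmat R n D |
     `| expectC (corr_gaussn rho D) (fun z =>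
          \tr ((op_a bP MS (sketch G (fsts z)) ja *t op_a bQ NS (sketch G (snds z)) jb
                *t tilde (bR jr)) *m joint_state phi Psi))
        - expectC (corr_gaussn rho n) (fun z =>
          \tr ((op_a bP MS (gcoord (fsts z)) ja *t op_a bQ NS (gcoord (snds z)) jb
                *t tilde (bR jr)) *m joint_state phi Psi)) | <= eps%:C]
    (58 / Num.sqrt D%:R * (9 ^+ dg * (p%:R ^+ 4 * q%:R ^+ 4)) / (eps / 2) ^+ 2).
Proof.
move=> D0 e0 M0 N0 M1 N1 dev.
have r01 : 0 <= rho <= 1.
  by case: spsi => _ _ _ -> r1; rewrite max_correlation_ge0 ltW.
have flat0 m : flat (0 : 'M[C]_m) = fun=> 0.
  by apply/funext => k; rewrite /flat mxE; case: k.2.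
have cM0 k (S : {set 'I_n}) : (dg < #|S|)%N -> cM k S = 0.
  by move=> dS; rewrite /cM /stack /coefflat /A M0// flat0 !mulr0.
have cN0 k (S : {set 'I_n}) : (dg < #|S|)%N -> cN k S = 0.
  by move=> dS; rewrite /cN /stack /coefflat /A' N0// flat0 !mulr0.
(* One p^2 is the scaling of [stack], the other the number of basis elements, each contributing at
   most 1. *)
have Mu : coefnorm cM <= p%:R ^+ 4.
  rewrite coefnorm_stack (exprD _ 2 2) ler_wpM2l ?sqr_ge0//.
  apply: (@le_trans _ _ (\sum_(jp < p ^ 2) 1)); first by apply: ler_sum.
  by rewrite sumr_const card_ord natrX.
have Nv : coefnorm cN <= q%:R ^+ 4.
  rewrite coefnorm_stack (exprD _ 2 2) ler_wpM2l ?sqr_ge0//.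
  apply: (@le_trans _ _ (\sum_(jq < q ^ 2) 1)); first by apply: ler_sum.
  by rewrite sumr_const card_ord natrX.
apply: fails_le_sub (corr_fails_le D0 r01 e0 cM0 cN0 polar_pairform_sqr_le
  pairform_diag_sqr_le Mu Nv dev) => // G /=.
have -> : expectC (corr_gaussn rho D) (fun z =>
          \tr ((op_a bP MS (sketch G (fsts z)) ja *t op_a bQ NS (sketch G (snds z)) jb
                *t tilde (bR jr)) *m joint_state phi Psi)) = (sketchmean rho pairform G)%:C.
  by under eq_fun do rewrite tr_op_a_joint; rewrite expectC_real mean_corr_sketch.
have -> : expectC (corr_gaussn rho n) (fun z =>
          \tr ((op_a bP MS (gcoord (fsts z)) ja *t op_a bQ NS (gcoord (snds z)) jb
                *t tilde (bR jr)) *m joint_state phi Psi)) =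
    (\sum_(S : {set 'I_n}) pairform S S * rho ^+ #|S|)%:C.
  by under eq_fun do rewrite tr_op_a_joint; rewrite expectC_real mean_corr_polar.
by rewrite -rmorphB normc_def /= expr0n addr0 sqrtr_sqr lecR.
Qed.

End Pairing.
End Correlations.

(** * The dimension and the numerical constants *)

Section Dimension.
Variable R : realType.

(* Bonami's factor [9^d] is absorbed by [d^O(d)]. *)
Lemma expn9_le (d : nat) : (0 < d)%N -> (9 ^ d <= 9 * d ^ (4 * d))%N.
Proof.
case: d => [//|[_|d _]]; first by rewrite exp1n muln1.
(* For d >= 2 already d^4 >= 16 > 9. *)
apply: leq_trans (leq_pmull _ _) => //; rewrite expnM leq_exp2r//.
by apply: (@leq_trans (2 ^ 4)) => //; rewrite leq_exp2r.
Qed.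

Lemma sketch_dim_sqrt (K d p q : nat) (c delta : R) : 0 <= c -> 0 < delta -> K%:R = c ^+ 2 ->
  c * p%:R ^+ 4 * q%:R ^+ 4 * d%:R ^+ (4 * d) / delta ^+ 3 <=
  Num.sqrt (sketch_dim K 8 d delta p q)%:R.
Proof.
move=> c0 dl0 Kc; rewrite /sketch_dim; set X := K%:R * _ * _ * _ / _.
set y := c * _ * _ * _ / _.
have y0 : 0 <= y by rewrite !mulr_ge0 ?exprn_ge0// invr_ge0 exprn_ge0// ltW.
have yX : y ^+ 2 = X.
  have d8 : d%:R ^+ (8 * d) = (d%:R ^+ (4 * d)) ^+ 2 :> R by rewrite -exprM mulnAC.
  rewrite /y /X Kc d8 (exprM p%:R 4 2) (exprM q%:R 4 2) (exprM delta 3 2).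
  move: (p%:R ^+ 4) (q%:R ^+ 4) (d%:R ^+ (4 * d)) (delta ^+ 3) => x1 x2 x3 x4.
  by rewrite !exprMn exprVn.
rewrite -[leLHS]ger0_norm// -sqrtr_sqr yX ler_wsqrtr//.
apply: le_trans (ceil_ge X) _.
by rewrite natr_absz ler_int ler_norm.
Qed.

(* [464 = 58 * 8], where [58 / sqrt D] bounds the mean of [rowcorr] and
   [(delta / 2)^2 * (delta / 2) = delta^3 / 8]. *)
Lemma sketch_dim_bound (d p q : nat) (delta : R) :
  (0 < d)%N -> 0 < delta -> (0 < p)%N -> (0 < q)%N ->
  let D := sketch_dim (5 ^ 12) 8 d delta p q in
  (0 < D)%N /\
  464 * 9 ^+ d * (p%:R ^+ 4 * q%:R ^+ 4) / Num.sqrt D%:R <= delta ^+ 3.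
Proof.
move=> d0 dl0 p0 q0 D.
have KE : (5 ^ 12)%N%:R = (5 ^+ 6) ^+ 2 :> R by rewrite natrX -exprM.
have := sketch_dim_sqrt d p q (exprn_ge0 6 (ler0n R 5)) dl0 KE; rewrite -/D.
have pos (m k : nat) : (0 < m)%N -> 0 < m%:R ^+ k :> R by move=> m0; rewrite exprn_gt0// ltr0n.
have y0 : 0 < 5 ^+ 6 * p%:R ^+ 4 * q%:R ^+ 4 * d%:R ^+ (4 * d) / delta ^+ 3 :> R.
  apply: divr_gt0; last by rewrite exprn_gt0.
  by apply: mulr_gt0; [apply: mulr_gt0; [apply: mulr_gt0|]|]; exact: pos.
move=> yD; have sD : 0 < Num.sqrt D%:R :> R by exact: lt_le_trans yD.
split; first by move: sD; rewrite sqrtr_gt0 ltr0n.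
move: yD; rewrite !ler_pdivrMr ?exprn_gt0// => yD.
rewrite [leRHS]mulrC; apply: le_trans yD.
have h9 : (9 ^+ d : R) <= 9 * d%:R ^+ (4 * d).
  by rewrite -natrX -natrX -natrM ler_nat; exact: expn9_le.
(* This fixes the constant 5^12 of the dimension: its square root must be at least 464 * 9 = 4176,
   the 9 coming from [expn9_le]. *)
have h5 : (464 * 9 : R) <= 5 ^+ 6 by rewrite -natrX -natrM ler_nat.
have := ltW (pos p 4%N p0); have := ltW (pos q 4%N q0); have := ltW (pos d (4 * d)%N d0).
move: h9 h5; move: (p%:R ^+ 4) (q%:R ^+ 4) (d%:R ^+ (4 * d)) (9 ^+ d) (5 ^+ 6).
move=> x y z w f zw f5 z0 y1 x0.
apply: (@le_trans _ _ (464 * (9 * z) * (x * y))).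
  by apply: ler_wpM2r; [exact: mulr_ge0|apply: ler_wpM2l zw; exact: ler0n].
rewrite (_ : 464 * (9 * z) * (x * y) = 464 * 9 * (x * y * z)); last by ring.
rewrite (_ : f * x * y * z = f * (x * y * z)); last by ring.
by rewrite ler_wpM2r// !mulr_ge0.
Qed.

End Dimension.

Section OperatorNorm.
Variables (R : realType) (n D m : nat).
Notation C := R[i].

Lemma op_pa_fails_le p a (MS : {set 'I_n} -> 'I_(p ^ 2)%N -> 'I_(a ^ 2)%N -> 'M[C]_m) jp ja
    (dg : nat) (delta : R) :
  (0 < D)%N -> 0 < delta -> (forall S, MS S jp ja \is hermsymmx) ->
  (forall S : {set 'I_n}, (dg < #|S|)%N -> MS S jp ja = 0) ->
  fails_le (gaussmx R n D)
    [set G : gmat R n D |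
      (\int[gaussn R D]_x (hnorm2 (op_pa MS (sketch G x) jp ja) ^+ 2)%:E <=
       (1 + delta)%:E * \int[gaussn R n]_g (hnorm2 (op_pa MS (gcoord g) jp ja) ^+ 2)%:E)%E]
    (58 / Num.sqrt D%:R * 9 ^+ dg / delta ^+ 2).
Proof.
move=> D0 dl0 hM M0; pose A S := MS S jp ja.
have c0 k (S : {set 'I_n}) : (dg < #|S|)%N -> coefflat A k S = 0.
  by move=> dS; rewrite /coefflat /A M0// /flat mxE; case: k.2; rewrite mulr0.
apply: fails_le_sub (norm_fails_le D0 dl0 c0) => // G /= H.
under eq_integral do rewrite (hnorm2_lincomb _ hM).
under [in leRHS]eq_integral do rewrite (hnorm2_lincomb _ hM).
by rewrite integral_sqnorm_sketch integral_sqnorm_gauss -EFinM lee_fin.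
Qed.

Lemma coefnorm_op_pa p a (MS : {set 'I_n} -> 'I_(p ^ 2)%N -> 'I_(a ^ 2)%N -> 'M[C]_m) jp ja :
  (forall S, MS S jp ja \is hermsymmx) ->
  (\int[gaussn R n]_g (hnorm2 (op_pa MS (gcoord g) jp ja) ^+ 2)%:E <= 1)%E ->
  coefnorm (coefflat (fun S => MS S jp ja)) <= 1.
Proof.
move=> hM; under eq_integral do rewrite (hnorm2_lincomb _ hM).
by rewrite integral_sqnorm_gauss lee_fin.
Qed.

End OperatorNorm.

Section ErrorBounds.
Variable R : realType.

(** Used with w = 9^d, x = p^4, y = q^4, t = 1 / sqrt(n0) and g = d: the two failure probabilities,
    for a norm and for a correlation, and the bias of a correlation. The bias is first order in t,
    so it needs delta^3 <= delta. *)
Lemma error_bounds (w x y t delta g : R) : 1 <= x -> 1 <= y -> 0 <= t -> 0 < delta ->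
  delta <= 1 -> 0 <= g -> g <= w -> 464 * w * (x * y) * t <= delta ^+ 3 ->
  [/\ 58 * t * w / delta ^+ 2 <= delta / 2,
      58 * t * (w * (x * y)) / (delta / 2) ^+ 2 <= delta / 2
    & (x + y) / 2 * (g * (12 * t)) <= delta / 2].
Proof.
move=> x1 y1 t0 dl0 dl1 g0 gw key.
have w0 : 0 <= w := le_trans g0 gw.
have wt0 : 0 <= w * t by rewrite mulr_ge0.
have xy1 : 1 <= x * y by rewrite mulr_ege1.
have d3 : delta ^+ 3 <= delta by rewrite exprS ger_pMr// exprn_ile1// ltW.
have key' : 464 * (w * t * (x * y)) <= delta ^+ 3.
  by rewrite (_ : _ * _ = 464 * w * (x * y) * t)//; ring.
have h1 : w * t <= w * t * (x * y) by rewrite ler_peMr.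
split.
- rewrite ler_pdivrMr ?exprn_gt0//.
  rewrite (_ : delta / 2 * _ = delta ^+ 3 / 2); last by field.
  rewrite (_ : 58 * t * w = 58 * (w * t)); last by ring.
  by move: h1 key' wt0; move: (w * t) (w * t * (x * y)) => u v; lra.
- rewrite ler_pdivrMr ?exprn_gt0 ?divr_gt0//.
  rewrite (_ : delta / 2 * _ = delta ^+ 3 / 8); last by field.
  rewrite (_ : 58 * t * (w * _) = 58 * (w * t * (x * y))); last by ring.
  by move: key'; move: (w * t * (x * y)) => v; lra.
have xy : (x + y) / 2 <= x * y by nra.
have gt : g * (12 * t) <= w * (12 * t) by rewrite ler_wpM2r// mulr_ge0.
have := ler_pM (_ : 0 <= (x + y) / 2) (mulr_ge0 g0 (mulr_ge0 (ler0n R 12) t0)) xy gt.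
have x2 : 0 <= (x + y) / 2 by lra.
move=> /(_ x2) H; apply: le_trans H _.
rewrite (_ : x * y * _ = 12 * (w * t * (x * y))); last by ring.
by move: key' d3; move: (w * t * (x * y)) (delta ^+ 3) => v u; lra.
Qed.

(** Each of the three families of events has at most (a b p q r)^2 members, failing with probability
    at most delta / 2. Their total is 3/2 of (a b p q r)^2 delta, within the factor 2 allowed. *)
Lemma union_bound (p q r a b : nat) (delta alpha e1 e3 : R) :
  (0 < p)%N -> (0 < q)%N -> (0 < r)%N -> (0 < a)%N -> (0 < b)%N ->
  0 <= delta -> e1 <= delta / 2 -> e3 <= delta / 2 ->
  (p ^ 2)%:R * ((a ^ 2)%:R * e1) + (q ^ 2)%:R * ((b ^ 2)%:R * e1) + (alpha + alpha)
    + (a ^ 2)%:R * ((b ^ 2)%:R * ((r ^ 2)%:R * e3)) <=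
  2 * (a * b * p * q * r)%:R ^+ 2 * delta + 2 * alpha.
Proof.
move=> p0 q0 r0 a0 b0 dl0 h1 h3; set X := _ ^+ 2.
have d2 : 0 <= delta / 2 by rewrite divr_ge0.
have bnd (k : nat) e : (0 < k)%N -> (k <= (a * b * p * q * r) ^ 2)%N -> e <= delta / 2 ->
    k%:R * e <= X * (delta / 2).
  move=> k0 kX he; apply: (@le_trans _ _ (k%:R * (delta / 2))); first exact: ler_wpM2l.
  by apply: ler_wpM2r => //; rewrite /X -natrX ler_nat.
have A : (a * (b * r) <= a * b * p * q * r)%N.
  by rewrite (_ : a * b * p * q * r = a * (b * r) * (p * q))%N ?leq_pmulr ?muln_gt0 ?p0//; ring.
have B : (q * b <= a * b * p * q * r)%N.
  by rewrite (_ : a * b * p * q * r = q * b * (a * p * r))%N ?leq_pmulr ?muln_gt0 ?a0 ?p0//; ring.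
have E : (p * a <= a * b * p * q * r)%N.
  by rewrite (_ : a * b * p * q * r = p * a * (b * q * r))%N ?leq_pmulr ?muln_gt0 ?b0 ?q0//; ring.
have H1 : (p ^ 2)%:R * ((a ^ 2)%:R * e1) <= X * (delta / 2).
  by rewrite mulrA -natrM; apply: bnd; rewrite -?expnMn ?leq_exp2r ?expn_gt0 ?muln_gt0 ?p0 ?a0.
have H2 : (q ^ 2)%:R * ((b ^ 2)%:R * e1) <= X * (delta / 2).
  by rewrite mulrA -natrM; apply: bnd; rewrite -?expnMn ?leq_exp2r ?expn_gt0 ?muln_gt0 ?q0 ?b0.
have H3 : (a ^ 2)%:R * ((b ^ 2)%:R * ((r ^ 2)%:R * e3)) <= X * (delta / 2).
  rewrite [leLHS]mulrA [leLHS]mulrA -!natrM -mulnA; apply: bnd; rewrite -?expnMn ?leq_exp2r//.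
  by rewrite expn_gt0 !muln_gt0 a0 b0 r0.
have X0 : 0 <= X * (delta / 2) by rewrite mulr_ge0// sqr_ge0.
move: H1 H2 H3 X0; rewrite (_ : 2 * X * delta = 4 * (X * (delta / 2))); last by field.
by lra.
Qed.

End ErrorBounds.

(** * Combination of the failure events *)

Local Open Scope complex_scope.

Theorem lemma5p13 (R : realType) :
  exists K k : nat,
  forall (d : nat) (delta alpha : R) (p q : nat),
    (0 < d)%N -> 0 < delta -> 0 < alpha -> (0 < p)%N -> (0 < q)%N ->
  let n0 := sketch_dim K k d delta p q in
  forall (r s t a b n h : nat),
    (0 < r)%N -> (0 < s)%N -> (0 < t)%N -> (0 < a)%N -> (0 < b)%N ->
    (0 < n)%N -> (0 < h)%N ->
  forall (phi : 'M[R[i]]_(p * q * r)) (psi : 'M[R[i]]_(s * t)) (rho : R),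
    quantum_state phi ->
    noisy_max_entangled psi rho ->
  forall (bA : 'I_(a ^ 2)%N -> 'M[R[i]]_a) (bB : 'I_(b ^ 2)%N -> 'M[R[i]]_b)
         (bP : 'I_(p ^ 2)%N -> 'M[R[i]]_p) (bQ : 'I_(q ^ 2)%N -> 'M[R[i]]_q)
         (bR : 'I_(r ^ 2)%N -> 'M[R[i]]_r),
    orthonormal_basis bA -> orthonormal_basis bB -> orthonormal_basis bP ->
    orthonormal_basis bQ -> orthonormal_basis bR ->
  forall (M : gvec R n -> 'M[R[i]]_(pow_dim s h * p * a))
         (N : gvec R n -> 'M[R[i]]_(pow_dim t h * q * b))
         (MS : {set 'I_n} -> 'I_(p ^ 2)%N -> 'I_(a ^ 2)%N ->
               'M[R[i]]_(pow_dim s h))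
         (NS : {set 'I_n} -> 'I_(q ^ 2)%N -> 'I_(b ^ 2)%N ->
               'M[R[i]]_(pow_dim t h)),
    L2_random_operator M -> L2_random_operator N ->
    multilinear_operator d M -> multilinear_operator d N ->
    (forall S jp ja, MS S jp ja \is hermsymmx) ->
    (forall S jq jb, NS S jq jb \is hermsymmx) ->
    (forall g, M g = op bP bA MS (gcoord g)) ->
    (forall g, N g = op bQ bB NS (gcoord g)) ->
    (forall jp ja,
      (\int[gaussn R n]_g (hnorm2 (op_pa MS (gcoord g) jp ja) ^+ 2)%:E <= 1)%E) ->
    (forall jq jb,
      (\int[gaussn R n]_g (hnorm2 (op_pa NS (gcoord g) jq jb) ^+ 2)%:E <= 1)%E) ->
    (forall (ja : 'I_(a ^ 2)%N) g, ja = 0%N :> nat ->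
      op_a bP MS (gcoord g) ja = ((Num.sqrt a%:R)^-1)%:C%:M) ->
    (forall (jb : 'I_(b ^ 2)%N) g, jb = 0%N :> nat ->
      op_a bQ NS (gcoord g) jb = ((Num.sqrt b%:R)^-1)%:C%:M) ->
  let MG (G : gmat R n n0) (x : gvec R n0) := op bP bA MS (sketch G x) in
  let NG (G : gmat R n n0) (y : gvec R n0) := op bQ bB NS (sketch G y) in
  (forall G, L2_random_operator (MG G) /\ L2_random_operator (NG G)) /\
  prob_at_least (gaussmx R n n0)
    [set G : gmat R n n0 |
      [/\ (forall jp ja,
            (\int[gaussn R n0]_x
                (hnorm2 (op_pa MS (sketch G x) jp ja) ^+ 2)%:E
             <= (1 + delta)%:E *
                \int[gaussn R n]_g
                  (hnorm2 (op_pa MS (gcoord g) jp ja) ^+ 2)%:E)%E) /\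
          (forall jq jb,
            (\int[gaussn R n0]_y
                (hnorm2 (op_pa NS (sketch G y) jq jb) ^+ 2)%:E
             <= (1 + delta)%:E *
                \int[gaussn R n]_g
                  (hnorm2 (op_pa NS (gcoord g) jq jb) ^+ 2)%:E)%E),
          (\int[gaussn R n0]_x (tr_zeta (MG G x))%:E
             <= (alpha^-1)%:E * \int[gaussn R n]_g (tr_zeta (M g))%:E)%E /\
          (\int[gaussn R n0]_y (tr_zeta (NG G y))%:E
             <= (alpha^-1)%:E * \int[gaussn R n]_g (tr_zeta (N g))%:E)%E,
          (forall ja jb jr,
            `| expectC (corr_gaussn rho n0) (fun z =>
                 \tr ((op_a bP MS (sketch G (fsts z)) ja
                       *t op_a bQ NS (sketch G (snds z)) jb
                       *t tilde (bR jr))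
                      *m joint_state phi (state_pow h psi)))
               - expectC (corr_gaussn rho n) (fun z =>
                   \tr ((op_a bP MS (gcoord (fsts z)) ja
                         *t op_a bQ NS (gcoord (snds z)) jb
                         *t tilde (bR jr))
                        *m joint_state phi (state_pow h psi))) |
            <= delta%:C)
        & (forall (ja : 'I_(a ^ 2)%N) x, ja = 0%N :> nat ->
            op_a bP MS (sketch G x) ja = ((Num.sqrt a%:R)^-1)%:C%:M) /\
          (forall (jb : 'I_(b ^ 2)%N) y, jb = 0%N :> nat ->
            op_a bQ NS (sketch G y) jb = ((Num.sqrt b%:R)^-1)%:C%:M)]]
    (1 - 2 * (a * b * p * q * r)%:R ^+ 2 * delta - 2 * alpha).
Proof.
(* The exponent 8 d becomes 4 d under the square root, where d^(4 d) absorbs Bonami's 9^d. *)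
exists (5 ^ 12)%N, 8%N => d delta alpha p q d0 dl0 al0 p0 q0 n0 r s t a b n h.
move=> r0 s0 t0 a0 b0 npos h0 phi psi rho sphi spsi bA bB bP bQ bR hbA hbB hbP hbQ hbR.
move=> M N MS NS _ _ mM mN hMS hNS ME NE M1 N1 Mid Nid MG NG.
split=> [G|]; first by split; exact: L2_sketch.
(* For delta > 1 the claimed probability is negative, and the empty event serves. *)
have [dl1|dl1] := ltP 1 delta.
  exists set0; split; [exact: measurable0|exact: sub0set|].
  rewrite measure0 lee_fin.
  have ge1 : 1 <= (a * b * p * q * r)%:R ^+ 2 :> R.
    by rewrite exprn_ege1// ler1n !muln_gt0 a0 b0 p0 q0 r0.
  move: ge1; set X := _ ^+ 2; nra.
have [D0 key] := sketch_dim_bound d0 dl0 p0 q0.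
(* Restated in terms of [n0], which is then generalized: from here on only its positivity and this
   inequality are known. *)
have [D0' key'] : (0 < n0)%N /\
  464 * 9 ^+ d * (p%:R ^+ 4 * q%:R ^+ 4) / Num.sqrt n0%:R <= delta ^+ 3 by [].
clear D0 key; move: n0 D0' key' @MG @NG => D D0 key MG NG.
have degM (S : {set 'I_n}) jp ja : (d < #|S|)%N -> MS S jp ja = 0.
  exact: (degree_coef0 p0 a0 hbP hbA hMS mM ME).
have degN (S : {set 'I_n}) jq jb : (d < #|S|)%N -> NS S jq jb = 0.
  exact: (degree_coef0 q0 b0 hbQ hbB hNS mN NE).
have inv0 : 0 <= (Num.sqrt D%:R)^-1 :> R by rewrite invr_ge0 sqrtr_ge0.
have ge1 m k : (0 < m)%N -> 1 <= m%:R ^+ k :> R by move=> m0; rewrite exprn_ege1// ler1n.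
have d9 : d%:R <= 9 ^+ d :> R by rewrite -natrX ler_nat ltnW// ltn_expl.
have [e1 e3 dev] := error_bounds (ge1 _ 4%N p0) (ge1 _ 4%N q0) inv0 dl0 dl1 (ler0n R d) d9 key.
have F1 : fails_le (gaussmx R n D) [set G : gmat R n D | forall jp ja, _] _ :=
  fails_le_forall (fun jp => fails_le_forall (fun ja =>
    op_pa_fails_le D0 dl0 (fun S => hMS S jp ja) (fun S => degM S jp ja))).
have F2 : fails_le (gaussmx R n D) [set G : gmat R n D | forall jq jb, _] _ :=
  fails_le_forall (fun jq => fails_le_forall (fun jb =>
    op_pa_fails_le D0 dl0 (fun S => hNS S jq jb) (fun S => degN S jq jb))).
have [mM' PM] := sketch_tr_zeta D0 hbP hbA hMS al0.
have [mN' PN] := sketch_tr_zeta D0 hbQ hbB hNS al0.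
have F3 := fails_leI (event_fails_le mM' PM) (event_fails_le mN' PN).
have F4 : fails_le (gaussmx R n D) [set G : gmat R n D | forall ja jb jr, _] _ :=
  fails_le_forall (fun ja => fails_le_forall (fun jb => fails_le_forall (fun jr =>
    pairing_fails_le sphi spsi hbP hbQ hbR hMS hNS jr D0 dl0
      (fun S jp => degM S jp ja) (fun S jq => degN S jq jb)
      (fun jp => coefnorm_op_pa (fun S => hMS S jp ja) (M1 jp ja))
      (fun jq => coefnorm_op_pa (fun S => hNS S jq jb) (N1 jq jb)) dev))).
have F := fails_leI (fails_leI (fails_leI F1 F2) F3) F4.
rewrite -addrA -opprD; apply: fails_le_prob.
apply: fails_le_sub F; last by rewrite !card_ord; apply: union_bound (ltW dl0) e1 e3.
move=> G [[[G1 G2] [G3 G4]] G5]; split; [by split| |exact: G5|].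
  rewrite /= in G3 G4; split; rewrite /MG /NG.
    by under [X in (_ <= _ * X)%E]eq_integral do rewrite ME; exact: G3.
  by under [X in (_ <= _ * X)%E]eq_integral do rewrite NE; exact: G4.
(* [sketch G x] is one point of R^n, and the hypothesis holds at every point. *)
split=> j x j0; rewrite -(gcoord_mktuple (sketch G x)); first exact: (Mid _ _ j0).
exact: (Nid _ _ j0).
Qed.
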